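(* For every $0 < \gamma \le 1$ and $c > 0$, there exists $\alpha > 0$ such that for all sufficiently large $n \in \mathbb{N}$ (how large depends only on $\gamma$ and $c$) and all real $\delta$ with $n^{-\alpha} \le \delta \le 1 - c$, $$\frac{1 - \gamma}{\log (1 / \delta)} \le \frac{\phi(\delta, n)}{\log n} \le \frac{3 + \gamma}{\log (1 / \delta)}.$$
   Context: $\mathbb{N} = \{1, 2, 3, \ldots\}$ and $[n] = \{1, \ldots, n\}$. For sets $A, B$, the sumset is $A + B = \{a + b : a \in A,\ b \in B\}$. For $0<\delta<1$ and $n \in \mathbb{N}$, $\phi(\delta, n)$ is defined to be the largest integer such that every $S \subseteq [n]$ with $|S| \ge \delta n$ contains a sumset $A + B$ (i.e. $A + B \subseteq S$) where $A, B \subseteq [n]$ satisfy $\min\{|A|, |B|\} \ge \phi(\delta, n)$. $\log$ is the natural logarithm. *)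

(* Defs.v *)
From HB Require Import structures.
From mathcomp Require Import all_boot all_order all_algebra finmap.
From mathcomp Require Import all_classical all_reals all_analysis.

Set Implicit Arguments.
Unset Strict Implicit.
Unset Printing Implicit Defensive.

Import Order.TTheory GRing.Theory Num.Theory.

Local Open Scope ring_scope.
Local Open Scope fset_scope.
Local Open Scope classical_set_scope.

Definition interval1 (n : nat) : {fset nat} := [fset i in iota 1 n].

Definition sumset (A B : {fset nat}) : {fset nat} :=
  [fset (a + b)%N | a in A, b in B].

Definition dense_contains_sumset (R : realType) (delta : R) (n k : nat) : Prop :=
  forall S : {fset nat}, (S `<=` interval1 n)%fset ->
    delta * n%:R <= #|` S|%:R ->
    exists A B : {fset nat},
      [/\ (A `<=` interval1 n)%fset, (B `<=` interval1 n)%fset,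
          (sumset A B `<=` S)%fset & (k <= minn #|` A| #|` B|)%N].

(* The largest k with the property, as a natural number: every k <= 0 has it,
   with A and B empty.  The default 0 is never used when delta <= 1
   (lemma phiP). *)
Definition phi (R : realType) (delta : R) (n : nat) : nat :=
  xget 0%N [set k | dense_contains_sumset delta n k /\
    forall m, dense_contains_sumset delta n m -> (m <= k)%N].

Lemma card_interval1 n : #|` interval1 n| = n.
Proof.
by rewrite /interval1 card_fseq undup_id ?size_iota // iota_uniq.
Qed.

Lemma phiP (R : realType) (delta : R) (n : nat) : delta <= 1 ->
  dense_contains_sumset delta n (phi delta n) /\
  forall m, dense_contains_sumset delta n m -> (m <= phi delta n)%N.
Proof.
move=> d1; rewrite /phi.
set P := [set k | _].
suff [k Pk] : exists k, P k by exact: (xgetPex 0%N (ex_intro _ k Pk)).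
have h0 : exists k, `[< dense_contains_sumset delta n k >].
  exists 0%N; apply/asboolP => S _ _; exists fset0, fset0.
  split; rewrite ?fsub0set //.
  by apply/fsubsetP => x /imfset2P [a]; rewrite inE.
have hb k : `[< dense_contains_sumset delta n k >] -> (k <= n)%N.
  move=> /asboolP /(_ (interval1 n) (fsubset_refl _)); rewrite card_interval1.
  case; first by rewrite ler_piMl.
  move=> A [B [sA _ _]]; rewrite leq_min => /andP[kA _].
  by rewrite (leq_trans kA)// -(card_interval1 n) fsubset_leq_card.
case: (ex_maxnP h0 hb) => k /asboolP Pk maxk.
by exists k; split=> // m Pm; apply: maxk; apply/asboolP.
Qed.

(* Main.v *)
(** Lower bound: join a to b when a + b lies in S, for b in a short interval, and
    pick the b's greedily, keeping at each step a proportion close to delta of the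
    common neighbours of those already chosen.

    Upper bound: a set T of m = ceil (delta n) elements of [n] is found by a union
    bound. Instead of all pairs (A, B) with |A| = |B| = k one only avoids sumsets
    X = A' + B' of certified subpairs; a given X lies in a proportion at most
    (m/n)^|X| of the sets T, and certificates of rank tau are few: n^tau up to a
    factor that is negligible. The rank is the number of values which determine
    all Freiman homomorphisms of a small configuration, and one needs
    |X| >= (1 - o(1)) tau k / 3.
    If |A + B| is much larger than k, then (A, B) is its own certificate, since
    tau <= 2 |A + B| / k by a Freiman-type inequality. Otherwise a small random-like
    subset hits every sum having many representations; enlarging it until all
    its homomorphisms extend realizes most of A and B in a rational vector space,
    where, after deleting few elements, the pair is robust: its rank does not drop
    under further small deletions. For robust pairs the popular sums alone number
    (1 - o(1)) (d + 2) k / 3, d being the dimension: choose a subspace U of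
    dimension u' having a heavy coset, whereas subspaces of dimension < u have
    none even at a much lower threshold, with u' - u <= (d - 1) / 3; Freiman's
    inequality modulo U and the spreading inside the cosets of U together give
    about (d - u' + 1 + u) k / 2 popular sums. *)

Require Import Defs.
From HB Require Import structures.
From mathcomp Require Import all_boot all_order all_algebra finmap.
From mathcomp Require Import all_classical all_reals all_analysis.
From mathcomp Require Import zify ring lra.

Set Implicit Arguments.
Unset Strict Implicit.
Unset Printing Implicit Defensive.

Import Order.TTheory GRing.Theory Num.Theory.

Local Open Scope fset_scope.
Local Open Scope ring_scope.

(** * Freiman-type lower bounds for sumsets *)

(** The price of a certificate shapes the proof. Describing a configuration of size S costs a factor
    k^(O(S)), to be paid for by delta^|X|. With S of order k this is affordable only when |X| is
    much larger than k log k; so the dichotomy is |A + B| against k b, where b is about k^(1/30).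
    Below k b one works with S <= k / b^2, and so small a sample can be expected to catch only sums
    with many representations: this is why popular sums, not all sums, have to be bounded from
    below. For k about (3 + gamma) log n / log (1 / delta) and |X| about tau k / 3, delta^|X| is
    about n^(-tau (1 + gamma / 3)), which beats the n^tau choices of label values; the 3 of the
    theorem is the 3 in the bound for popular sums. Homomorphisms take rational values so that
    linear algebra can select, among all additive coincidences in a configuration, linearly many
    that imply the others. *)

Lemma count_lt (T : eqType) (p q : pred T) (s : seq T) x :
  subpred p q -> x \in s -> q x -> ~~ p x -> (count p s < count q s)%N.
Proof.
move=> pq xs qx px; elim: s xs => //= y s IH; rewrite inE => /orP[/eqP <-|/IH].
  by rewrite qx (negPf px) add0n add1n ltnS sub_count.
move=> h; rewrite -addnS leq_add //; case: (boolP (p y)) => // /pq -> //.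
Qed.

(** The order of [rat] is not well-founded; the induction is on the number of entries of [s] with a
    smaller value of [h]. *)
Lemma seq_wf_ind (T : eqType) (s : seq T) (h : T -> rat) (P : T -> Prop) :
  (forall g, g \in s -> (forall g', g' \in s -> h g' < h g -> P g') -> P g) ->
  forall g, g \in s -> P g.
Proof.
move=> H g; have [n] := ubnP (count (fun x => h x < h g) s).
elim: n g => // n IH g hn gs; apply: H => // g' g's lt'; apply: IH => //.
apply: leq_trans (hn : (_ <= n)%N); apply: (@count_lt _ _ _ _ g') => //.
- by move=> x /= /lt_trans; apply.
- by rewrite /= ltxx.
Qed.

Section Functionals.
Variable vT : vectType rat.
Implicit Types (W U : {vspace vT}) (A B P Q : {fset vT}).

Definition islin f := forall a (u v : vT), f (a *: u + v) = a * f u + f v.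

Lemma islin0 f : islin f -> f 0 = 0.
Proof.
move=> lf; have := lf 1 0 0; rewrite scale1r addr0 mul1r => h.
by apply: (addrI (f 0)); rewrite addr0 -h.
Qed.

Lemma islinD f u v : islin f -> f (u + v) = f u + f v.
Proof. by move=> lf; have := lf 1 u v; rewrite scale1r mul1r. Qed.

Lemma islinZ f a u : islin f -> f (a *: u) = a * f u.
Proof. by move=> lf; have := lf a u 0; rewrite addr0 (islin0 lf) addr0. Qed.

Lemma islinB f u v : islin f -> f (u - v) = f u - f v.
Proof.
by move=> lf; rewrite islinD // -scaleN1r islinZ // mulN1r.
Qed.

Lemma islin_comb f g a b : islin f -> islin g -> islin (fun v => a * f v + b * g v).
Proof. by move=> lf lg c u v; rewrite lf lg; ring. Qed.

(** The component of [c] complementary to its projection on W is nonzero, so one of its coordinates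
    is nonzero. *)
Lemma separating_functional W c : c \notin W ->
  exists f, [/\ islin f, forall w, w \in W -> f w = 0 & f c != 0].
Proof.
move=> cW; pose u := c - projv W c.
have u0 : u != 0.
  apply: contra cW; rewrite subr_eq0 => /eqP ->; exact: memv_proj.
pose X := vbasis (fullv : {vspace vT}).
have [i hi] : exists i, coord X i u != 0.
  apply/existsP; apply: contraR u0; rewrite negb_exists => /forallP hX.
  have := coord_vbasis (memvf u); rewrite big1 => [->//|i _].
  by have := hX i; rewrite negbK => /eqP ->; rewrite scale0r.
exists (fun v => coord X i (v - projv W v)); split => //.
- move=> a x y /=; rewrite -linearP /=; congr (coord X i _).
  by rewrite linearP /= scalerBr opprD addrACA.
- by move=> w wW; rewrite projv_id // subrr linear0.
Qed.

Lemma nat_avoid (s : seq rat) : exists n : nat, n%:R \notin s.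
Proof.
have : ~~ all (mem s) [seq i%:R | i <- iota 0 (size s).+1].
  apply/negP => /allP h.
  suff /uniq_leq_size/(_ h) : uniq [seq i%:R : rat | i <- iota 0 (size s).+1].
    by rewrite size_map size_iota ltnn.
  by rewrite map_inj_uniq ?iota_uniq // => i j /eqP; rewrite eqr_nat => /eqP.
by move=> /allPn[x /mapP[i _ ->] hi]; exists i.
Qed.

(** Induction on [s]: to a functional f that suits the tail one adds m g, where g separates the head
    from W. Each vector on which g is nonzero forbids a single value of m. *)
Lemma generic_functional W (s : seq vT) : all (fun c => c \notin W) s ->
  exists f, [/\ islin f, forall w, w \in W -> f w = 0 &
    forall c, c \in s -> f c != 0].
Proof.
elim: s => [_|c s IH /= /andP[cW /IH[f [lf fW fs]]]].
  by exists (fun=> 0); split => // a u v; rewrite mulr0 addr0.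
have [g [lg gW gc]] := separating_functional cW.
have [m hm] := nat_avoid [seq - (f x / g x) | x <- c :: s & g x != 0].
exists (fun v => 1 * f v + m%:R * g v); split.
- exact: islin_comb.
- by move=> w wW; rewrite fW // gW // !mulr0 addr0.
- move=> x xs; rewrite mul1r; have [g0|g0] := eqVneq (g x) 0.
    rewrite g0 mulr0 addr0; move: xs; rewrite inE => /orP[/eqP xc|/fs//].
    by move: gc; rewrite -xc g0 eqxx.
  apply: contra hm => /eqP h; apply/mapP; exists x; first by rewrite mem_filter g0.
  apply: (mulIf g0); rewrite mulNr mulfVK //; apply/eqP.
  by rewrite -subr_eq0 opprK addrC h.
Qed.

Definition sumv (A B : {fset vT}) : {fset vT} := [fset a + b | a in A, b in B].

Lemma sumvP A B z :
  reflect (exists a b, [/\ a \in A, b \in B & z = a + b]) (z \in sumv A B).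
Proof.
apply: (iffP idP) => [/imfset2P[a aA [b bB ->]]|[a [b [aA bB ->]]]].
  by exists a, b.
exact: in_imfset2.
Qed.

Lemma mem_sumv A B a b : a \in A -> b \in B -> a + b \in sumv A B.
Proof. by move=> aA bB; apply/sumvP; exists a, b. Qed.

Lemma sumvC A B : sumv A B = sumv B A.
Proof.
by apply/fsetP => z; apply/sumvP/sumvP => -[a [b [? ? ->]]]; exists b, a; rewrite addrC.
Qed.

Lemma sumvS A B A' B' : A' `<=` A -> B' `<=` B -> sumv A' B' `<=` sumv A B.
Proof.
move=> /fsubsetP sA /fsubsetP sB; apply/fsubsetP => z /sumvP[a [b [? ? ->]]].
by apply: mem_sumv; [apply: sA|apply: sB].
Qed.

(** The direction space of the affine hull of A. The dimension of a pair is always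
    [\dim (Dsp A + Dsp B)]. *)
Definition Dsp (A : {fset vT}) : {vspace vT} := <<[seq x - y | x <- A, y <- A]>>%VS.

Lemma mem_Dsp A x y : x \in A -> y \in A -> x - y \in Dsp A.
Proof. by move=> xA yA; apply: memv_span; apply: allpairs_f. Qed.

Lemma Dsp_sub A U a0 : (forall x, x \in A -> x - a0 \in U) -> (Dsp A <= U)%VS.
Proof.
move=> h; apply/span_subvP => _ /allpairsP[[x y] /= [xA yA ->]].
have -> : x - y = (x - a0) - (y - a0) by rewrite opprB addrA addrNK.
by apply: memvB; apply: h.
Qed.

Lemma DspS A B : A `<=` B -> (Dsp A <= Dsp B)%VS.
Proof.
move=> /fsubsetP s; apply/span_subvP => _ /allpairsP[[x y] /= [xA yA ->]].
by apply: mem_Dsp; apply: s.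
Qed.

Lemma fset_argmax (T : choiceType) (A : {fset T}) (h : T -> rat) :
  A != fset0 -> exists2 a, a \in A & forall x, x \in A -> h x <= h a.
Proof.
move=> /fset0Pn[x0 x0A]; pose m := \big[Num.max/h x0]_(x <- A) h x.
have [a aA ham] : exists2 a, a \in A & h a = m.
  rewrite /m big_seq; elim/big_ind: _ => [|u v [a ? <-] [b ? <-]|i iA].
  - by exists x0.
  - by case: (leP (h a) (h b)) => _; [exists b|exists a].
  - by exists i.
by exists a => // x xA; rewrite ham; apply: le_bigmax_seq.
Qed.

Lemma injective_functional A B : exists h, islin h /\
  forall x y, (x \in A) && (y \in A) || (x \in B) && (y \in B) -> h x = h y -> x = y.
Proof.
pose s := [seq c <- [seq x - y | x <- A, y <- A] ++ [seq x - y | x <- B, y <- B] | c != 0].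
have : all (fun c => c \notin (0%VS : {vspace vT})) s.
  by apply/allP => c; rewrite mem_filter memv0 => /andP[].
move=> /generic_functional[h [lh _ hs]]; exists h; split => // x y xy hxy.
apply/eqP; rewrite -subr_eq0; apply/negPn/negP => n0.
have : h (x - y) != 0.
  apply: hs; rewrite mem_filter n0 mem_cat.
  by case/orP: xy => /andP[xA yA]; rewrite (allpairs_f _ xA yA) ?orbT.
by rewrite islinB // hxy subrr eqxx.
Qed.

(** Take a and b maximal for an injective functional h. Among the positive gaps a - x and b - y,
    those that are not a gap of A plus a gap of B still span the whole direction space, by induction
    on h. Each such gap g yields a sum a + b - g that needs a or b, and a + b itself is one more. *)
Lemma top_step A B : A != fset0 -> B != fset0 -> exists a b,
  [/\ a \in A, b \in B, a + b \notin sumv (A `\ a) (B `\ b) &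
   (\dim (Dsp A + Dsp B) + 1 + #|` sumv (A `\ a) (B `\ b)| <= #|` sumv A B|)%N].
Proof.
move=> A0 B0; have [h [lh hinj]] := injective_functional A B.
have [a aA amax] := fset_argmax h A0; have [b bB bmax] := fset_argmax h B0.
have alt x : x \in A `\ a -> h x < h a.
  rewrite !inE => /andP[xa xA]; rewrite lt_neqAle amax // andbT.
  by apply: contra xa => /eqP hh; apply/eqP; apply: hinj => //; rewrite xA aA.
have blt y : y \in B `\ b -> h y < h b.
  rewrite !inE => /andP[xa xA]; rewrite lt_neqAle bmax // andbT.
  by apply: contra xa => /eqP hh; apply/eqP; apply: hinj => //; rewrite xA bB orbT.
pose GA := [seq a - x | x <- A `\ a]; pose GB := [seq b - y | y <- B `\ b].
pose I := [seq g <- undup (GA ++ GB) | g \notin [seq u + v | u <- GA, v <- GB]].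
have posG g : g \in GA ++ GB -> 0 < h g.
  rewrite mem_cat => /orP[] /mapP[x xA ->]; rewrite islinB // subr_gt0; [exact: alt|exact: blt].
have posGA g : g \in GA -> 0 < h g by move=> gG; apply: posG; rewrite mem_cat gG.
have posGB g : g \in GB -> 0 < h g by move=> gG; apply: posG; rewrite mem_cat gG orbT.
have spanI : forall g, g \in GA ++ GB -> g \in <<I>>%VS.
  apply: (@seq_wf_ind _ _ h) => g gG IH.
  have [gi|gi] := boolP (g \in [seq u + v | u <- GA, v <- GB]); last first.
    by apply: memv_span; rewrite mem_filter gi mem_undup.
  case/allpairsP: gi => -[u v] /= [uG vG ge].
  rewrite ge; apply: memvD; apply: IH; rewrite ?mem_cat ?uG ?vG ?orbT //.
    by rewrite ge islinD // ltrDl posGB.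
  by rewrite ge islinD // ltrDr posGA.
have spA x : x \in A -> x - a \in <<I>>%VS.
  move=> xA; have [->|xa] := eqVneq x a; first by rewrite subrr mem0v.
  rewrite -opprB memvN; apply: spanI; rewrite mem_cat; apply/orP; left.
  by apply/mapP; exists x => //; rewrite !inE xa.
have spB x : x \in B -> x - b \in <<I>>%VS.
  move=> xB; have [->|xb] := eqVneq x b; first by rewrite subrr mem0v.
  rewrite -opprB memvN; apply: spanI; rewrite mem_cat; apply/orP; right.
  by apply/mapP; exists x => //; rewrite !inE xb.
have dimI : (\dim (Dsp A + Dsp B) <= size I)%N.
  apply: leq_trans (dim_span I); apply: dimvS; rewrite subv_add.
  by rewrite (Dsp_sub spA) (Dsp_sub spB).
have nab : a + b \notin sumv (A `\ a) (B `\ b).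
  apply/negP => /sumvP[x [y [xA yB /eqP]]]; rewrite eq_sym => /eqP e.
  by have := ltrD (alt x xA) (blt y yB); rewrite -!islinD // e ltxx.
exists a, b; split => //.
pose N := a + b :: [seq a + b - g | g <- I].
have uN : uniq N.
  rewrite /N /= map_inj_uniq ?filter_uniq ?undup_uniq ?andbT //; last first.
    by move=> u v /addrI/oppr_inj.
  apply/negP => /mapP[g]; rewrite mem_filter mem_undup => /andP[_ /posG g0] e.
  by move: g0; have -> : g = 0; [rewrite -(subKr (a + b) g) -e subrr|rewrite islin0 // ltxx].
have uM : uniq (sumv (A `\ a) (B `\ b) ++ N).
  rewrite cat_uniq fset_uniq uN andbT; apply/negP => /hasP[z].
  rewrite inE => /orP[/eqP ->|]; first by rewrite (negPf nab).
  move=> /mapP[g]; rewrite mem_filter => /andP[gi _] -> /sumvP[x [y [xA yB e]]].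
  move/negP: gi; apply; apply/allpairsP; exists (a - x, b - y) => /=; split.
  - exact: map_f.
  - exact: map_f.
  - by rewrite -[LHS](subKr (a + b)) e opprD addrACA.
have := uniq_leq_size uM (s2 := sumv A B); rewrite size_cat /= size_map => hs.
have : (#|` sumv (A `\ a) (B `\ b)| + (size I).+1 <= #|` sumv A B|)%N.
  apply: hs => z; rewrite mem_cat => /orP[|].
    by move/(fsubsetP (sumvS (fsubD1set _ _) (fsubD1set _ _))).
  rewrite inE => /orP[/eqP ->|]; first exact: mem_sumv.
  move=> /mapP[g]; rewrite mem_filter mem_undup mem_cat => /andP[_ /orP[]] /mapP[x].
    rewrite !inE => /andP[_ xA] -> ->.
    by rewrite opprB addrC addrA subrK mem_sumv.
  rewrite !inE => /andP[_ xA] -> ->.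
  by rewrite opprB addrC (addrC a) addrA subrK addrC mem_sumv.
by apply: leq_trans; rewrite addnC leq_add2l addn1 ltnS.
Qed.

(** A coincidence a + y = x + z would give a - a0 = (x - a0) + (z - y). *)
Lemma sumv_fresh A B a a0 y : a0 \in A -> a - a0 \notin (Dsp A + Dsp B)%VS ->
  y \in B -> a + y \notin sumv A B.
Proof.
move=> a0A + yB; apply: contra => /sumvP[x [z [xA zB e]]].
have -> : a - a0 = (x - a0) + (z - y).
  by rewrite addrACA -e -opprD opprD addrACA subrr addr0.
by apply: memv_add; apply: mem_Dsp.
Qed.

Lemma sumv_drop1 A B a b a0 : a \in A -> a + b \notin sumv (A `\ a) (B `\ b) ->
  a0 \in A `\ a -> a - a0 \notin (Dsp (A `\ a) + Dsp (B `\ b))%VS ->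
  (#|` sumv (A `\ a) (B `\ b)| + #|` B| <= #|` sumv A B|)%N.
Proof.
move=> aA nab a0A na.
have uM : uniq (sumv (A `\ a) (B `\ b) ++ [seq a + y | y <- B]).
  rewrite cat_uniq fset_uniq map_inj_uniq ?fset_uniq ?andbT; last exact: addrI.
  apply/negP => /hasP[_ /mapP[y yB ->]]; apply/negP.
  have [->//|yb] := eqVneq y b; apply: sumv_fresh a0A na _.
  by rewrite !inE yb.
have := uniq_leq_size uM (s2 := sumv A B); rewrite size_cat size_map; apply => z.
rewrite mem_cat => /orP[|/mapP[y yB ->]]; last exact: mem_sumv.
by move/(fsubsetP (sumvS (fsubD1set _ _) (fsubD1set _ _))).
Qed.

(** When both removals lower the dimension, the translates a + B and (A minus a) + b are new and
    disjoint from each other; the 1 on the right accounts for a + b, which is counted once. *)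
Lemma sumv_drop2 A B a b a0 b0 : a \in A -> b \in B ->
  a + b \notin sumv (A `\ a) (B `\ b) -> a0 \in A `\ a -> b0 \in B `\ b ->
  a - a0 \notin (Dsp (A `\ a) + Dsp (B `\ b))%VS ->
  b - b0 \notin (Dsp (A `\ a) + Dsp (B `\ b) + <[a - a0]>)%VS ->
  (#|` sumv (A `\ a) (B `\ b)| + #|` A| + #|` B| <= (#|` sumv A B|).+1)%N.
Proof.
move=> aA bB nab a0A b0B na nb.
have nb' : b - b0 \notin (Dsp (B `\ b) + Dsp (A `\ a))%VS.
  by apply: contra nb; rewrite addvC; apply/subvP; exact: addvSl.
have uM : uniq (sumv (A `\ a) (B `\ b) ++ [seq a + y | y <- B] ++ [seq x + b | x <- A `\ a]).
  rewrite cat_uniq fset_uniq cat_uniq /= !map_inj_uniq ?fset_uniq ?andbT /=;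
    try exact: addrI; try exact: addIr.
  apply/andP; split.
    apply/negP => /hasP[z]; rewrite mem_cat => /orP[/mapP[y yB ->]|/mapP[x xA ->]]; apply/negP.
      have [->//|yb] := eqVneq y b; apply: sumv_fresh a0A na _.
      by rewrite !inE yb.
    by rewrite sumvC addrC; apply: sumv_fresh b0B nb' xA.
  apply/negP => /hasP[_ /mapP[x xA ->]] /mapP[y yB e].
  have [yb|yb] := eqVneq y b.
    by move: xA; rewrite yb in e; rewrite (addIr _ e) !inE eqxx.
  move/negP: nb; apply.
  have -> : b - b0 = ((a0 - x) + (y - b0)) + (a - a0).
    by rewrite addrAC [a0 - x + _]addrC [a - a0 + (a0 - x)]addrA subrK addrACA -e addrACA subrr add0r.
  apply: memv_add; last exact: memv_line.
  by apply: memv_add; apply: mem_Dsp => //; rewrite !inE yb.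
have := uniq_leq_size uM (s2 := sumv A B); rewrite !size_cat !size_map => hs.
have -> : #|` A| = (#|` A `\ a|).+1 by rewrite (cardfsD1 a A) aA.
rewrite addnS addSn ltnS -addnA [X in (_ + X)%N]addnC; apply: hs => z.
rewrite !mem_cat => /or3P[|/mapP[y yB ->]|/mapP[x]]; last first.
- by rewrite !inE => /andP[_ xA] ->; apply: mem_sumv.
- exact: mem_sumv.
by move/(fsubsetP (sumvS (fsubD1set _ _) (fsubD1set _ _))).
Qed.

Lemma DspD1 A a a0 : a0 \in A `\ a -> (Dsp A <= Dsp (A `\ a) + <[a - a0]>)%VS.
Proof.
move=> a0A; apply: (@Dsp_sub _ _ a0) => x xA; have [->|xa] := eqVneq x a.
  by apply: (subvP (addvSr _ _)); exact: memv_line.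
by apply: (subvP (addvSl _ _)); apply: mem_Dsp; rewrite // !inE xa.
Qed.

Lemma dim_addv_line U (v : vT) : (\dim (U + <[v]>) <= (\dim U).+1)%N.
Proof. by rewrite (leq_trans (dimv_add_leqif _ _))// -addn1 leq_add2l dim_vline leq_b1. Qed.

Lemma addv_line_id U (v : vT) : v \in U -> (U + <[v]> = U)%VS.
Proof. by move=> vU; apply/addv_idPl; rewrite -memvE. Qed.

(** The inductive step at equal sizes: one vertex leaves each side, and each dimension lost is paid
    for by about one full translate. *)
Lemma remove_both A B : (1 < #|` A|)%N -> #|` A| = #|` B| -> exists A' B',
  [/\ #|` A| = (#|` A'|).+1, #|` B| = (#|` B'|).+1,
   (\dim (Dsp A + Dsp B) + 1 + #|` sumv A' B'| <= #|` sumv A B|)%N &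
   [\/ \dim (Dsp A + Dsp B) = \dim (Dsp A' + Dsp B'),
     \dim (Dsp A + Dsp B) = (\dim (Dsp A' + Dsp B')).+1 /\
       (#|` sumv A' B'| + #|` A| <= #|` sumv A B|)%N |
     \dim (Dsp A + Dsp B) = (\dim (Dsp A' + Dsp B')).+2 /\
       (#|` sumv A' B'| + #|` A| + #|` A| <= (#|` sumv A B|).+1)%N]].
Proof.
move=> A1 AB.
have [||a [b [aA bB nab top]]] := @top_step A B.
- by rewrite -cardfs_gt0; lia.
- by rewrite -cardfs_gt0; lia.
have cA : #|` A| = (#|` A `\ a|).+1 by rewrite (cardfsD1 a A) aA.
have cB : #|` B| = (#|` B `\ b|).+1 by rewrite (cardfsD1 b B) bB.
exists (A `\ a), (B `\ b); split => //.
have /fset0Pn[a0 a0A] : A `\ a != fset0 by rewrite -cardfs_gt0; lia.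
have /fset0Pn[b0 b0B] : B `\ b != fset0 by rewrite -cardfs_gt0; lia.
set D := (Dsp A + Dsp B)%VS; set D' := (Dsp (A `\ a) + Dsp (B `\ b))%VS.
have DD : (D <= D' + <[a - a0]> + <[b - b0]>)%VS.
  apply: subv_trans (addvS (DspD1 a0A) (DspD1 b0B)) _.
  rewrite -!addvA addvS // [(<[a - a0]> + _)%VS]addvA [(<[a - a0]> + Dsp _)%VS]addvC.
  by rewrite -addvA subvv.
have D'D : (D' <= D)%VS by rewrite addvS // DspS // fsubD1set.
have d1 : (\dim D' <= \dim D)%N by apply: dimvS.
have aD : a - a0 \in D.
  apply: (subvP (addvSl _ _)); apply: mem_Dsp => //.
  by move: a0A; rewrite !inE => /andP[].
have [ia|na] := boolP (a - a0 \in D').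
  rewrite (addv_line_id ia) in DD.
  have [ib|nb] := boolP (b - b0 \in D').
    apply: Or31; rewrite (addv_line_id ib) in DD.
    by apply/eqP; rewrite eqn_leq d1 dimvS.
  have h : (#|` sumv (A `\ a) (B `\ b)| + #|` A| <= #|` sumv A B|)%N.
    rewrite (sumvC A) (sumvC (A `\ a)).
    apply: (sumv_drop1 (b := a) (a0 := b0)) => //; first by rewrite addrC sumvC.
    by rewrite addvC.
  have := leq_trans (dimvS DD) (dim_addv_line _ _).
  rewrite leq_eqVlt => /orP[/eqP e|]; first by apply: Or32.
  by rewrite ltnS => d2; apply: Or31; apply/eqP; rewrite eqn_leq d1 d2.
have h1 := sumv_drop1 aA nab a0A na.
have e1 : (\dim D' < \dim D)%N.
  rewrite ltn_neqAle d1 andbT; apply: contra na => /eqP e.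
  by have /eqP -> : D' == D by rewrite eqEdim D'D e leqnn.
have [ib|nb] := boolP (b - b0 \in (D' + <[a - a0]>)%VS).
  rewrite (addv_line_id ib) in DD; apply: Or32; rewrite AB; split => //.
  by apply/eqP; rewrite eqn_leq e1 (leq_trans (dimvS DD) (dim_addv_line _ _)).
have h2 := sumv_drop2 aA bB nab a0A b0B na nb.
have bD : b - b0 \in D.
  apply: (subvP (addvSr _ _)); apply: mem_Dsp => //.
  by move: b0B; rewrite !inE => /andP[].
have d3 : (\dim D <= (\dim D').+2)%N.
  apply: leq_trans (dimvS DD) _; apply: leq_trans (dim_addv_line _ _) _.
  exact: dim_addv_line.
move: d3; rewrite leq_eqVlt => /orP[/eqP e|]; first by apply: Or33; rewrite {2}AB.
rewrite ltnS => d3; apply: Or32; split; last by rewrite AB.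
by apply/eqP; rewrite eqn_leq e1 d3.
Qed.

(** The inductive step that trims the larger set; the sums are only seen to drop when the dimension
    does. *)
Lemma remove_one A B : (1 < #|` A|)%N -> exists A',
  [/\ #|` A| = (#|` A'|).+1, (#|` sumv A' B| <= #|` sumv A B|)%N &
   \dim (Dsp A + Dsp B) = \dim (Dsp A' + Dsp B) \/
     \dim (Dsp A + Dsp B) = (\dim (Dsp A' + Dsp B)).+1 /\
       (#|` sumv A' B| + #|` B| <= #|` sumv A B|)%N].
Proof.
move=> A1; have /fset0Pn[a aA] : A != fset0 by rewrite -cardfs_gt0; lia.
have cA : #|` A| = (#|` A `\ a|).+1 by rewrite (cardfsD1 a A) aA.
exists (A `\ a); split => //.
  by rewrite fsubset_leq_card // sumvS // fsubD1set.
have /fset0Pn[a0 a0A] : A `\ a != fset0 by rewrite -cardfs_gt0; lia.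
set D := (Dsp A + Dsp B)%VS; set D' := (Dsp (A `\ a) + Dsp B)%VS.
have DD : (D <= D' + <[a - a0]>)%VS.
  by apply: subv_trans (addvS (DspD1 a0A) (subvv _)) _; rewrite -!addvA addvS // addvC subvv.
have D'D : (D' <= D)%VS by rewrite addvS // DspS // fsubD1set.
have d1 : (\dim D' <= \dim D)%N by apply: dimvS.
have [ia|na] := boolP (a - a0 \in D').
  rewrite (addv_line_id ia) in DD; left; apply/eqP.
  by rewrite eqn_leq d1 dimvS.
have aD : a - a0 \in D.
  apply: (subvP (addvSl _ _)); apply: mem_Dsp => //.
  by move: a0A; rewrite !inE => /andP[].
have e1 : (\dim D' < \dim D)%N.
  rewrite ltn_neqAle d1 andbT; apply: contra na => /eqP e.
  by have /eqP -> : D' == D by rewrite eqEdim D'D e leqnn.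
right; split; first by apply/eqP; rewrite eqn_leq e1 (leq_trans (dimvS DD) (dim_addv_line _ _)).
have uM : uniq (sumv (A `\ a) B ++ [seq a + y | y <- B]).
  rewrite cat_uniq fset_uniq map_inj_uniq ?fset_uniq ?andbT; last exact: addrI.
  by apply/negP => /hasP[_ /mapP[y yB ->]]; apply/negP; apply: sumv_fresh a0A na _.
have := uniq_leq_size uM (s2 := sumv A B); rewrite size_cat size_map; apply => z.
rewrite mem_cat => /orP[|/mapP[y yB ->]]; last exact: mem_sumv.
by move/(fsubsetP (sumvS (fsubD1set _ _) (fsubset_refl _))).
Qed.

Lemma Dsp1 (a : vT) : Dsp [fset a] = 0%VS.
Proof.
apply/eqP; rewrite -subv0; apply: (@Dsp_sub _ _ a) => x; rewrite inE => /eqP ->.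
by rewrite subrr mem0v.
Qed.

Lemma sumv_gt0 A B : A != fset0 -> B != fset0 -> (0 < #|` sumv A B|)%N.
Proof.
move=> /fset0Pn[a aA] /fset0Pn[b bB]; rewrite cardfs_gt0; apply/fset0Pn.
by exists (a + b); apply: mem_sumv.
Qed.

Lemma dim_Dsp A : A != fset0 -> (\dim (Dsp A) < #|` A|)%N.
Proof.
move=> /fset0Pn[a aA]; rewrite (cardfsD1 a A) aA add1n ltnS.
have -> : #|` A `\ a| = size [seq x - a | x <- A `\ a] by rewrite size_map.
apply: leq_trans (dim_span _); apply: dimvS; apply: (@Dsp_sub _ _ a) => x xA.
have [->|xa] := eqVneq x a; first by rewrite subrr mem0v.
by apply: memv_span; apply: map_f; rewrite !inE xa.
Qed.

Lemma dim_pair_le A B : A != fset0 -> B != fset0 ->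
  ((\dim (Dsp A + Dsp B)).+2 <= #|` A| + #|` B|)%N.
Proof.
move=> /dim_Dsp hA /dim_Dsp hB; have [+ _] := dimv_add_leqif (Dsp A) (Dsp B).
lia.
Qed.

(** Having no error term, this version remains useful when the dimension is comparable to |A|, as
    may happen for whole pairs. *)
Theorem freiman_weak A B : (0 < #|` A|)%N -> #|` A| = #|` B| ->
  ((\dim (Dsp A + Dsp B)).+2 * #|` A| <= 2 * #|` sumv A B|)%N.
Proof.
have [n] := ubnP #|` A|; elim: n A B => // n IH A B hn A0 AB.
have [A1|A1] := ltnP 1 #|` A|; last first.
  have /eqP/cardfs1P[a ea] : #|` A| = 1%N by lia.
  have /eqP/cardfs1P[b eb] : #|` B| = 1%N by lia.
  have : (0 < #|` sumv A B|)%N by apply: sumv_gt0; rewrite -cardfs_gt0; lia.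
  by rewrite ea eb !Dsp1 addv0 dimv0 cardfs1; lia.
have [A' [B' [cA cB t h]]] := remove_both A1 AB.
have {IH}ih : ((\dim (Dsp A' + Dsp B')).+2 * #|` A'| <= 2 * #|` sumv A' B'|)%N.
  by apply: IH; lia.
have : ((\dim (Dsp A + Dsp B)).+2 <= #|` A| + #|` B|)%N.
  by apply: dim_pair_le; rewrite -cardfs_gt0; lia.
move: cA cB t h ih AB A1 A0.
move: (\dim (Dsp A + Dsp B)) (\dim (Dsp A' + Dsp B')) => d d'.
move: #|` A| #|` B| #|` A'| #|` B'| #|` sumv A B| #|` sumv A' B'| => a b a' b' T T'.
move=> -> -> t h ih [ab] _ _ dl; subst b'.
case: h => [e|[e h]|[e h]]; rewrite ?e in t dl *; nia.
Qed.

(** Freiman's |A + B| >= (d + 1) m - d (d + 1) / 2, with twice the leading term of [freiman_weak]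
    for large d; the quadratic error is harmless when d is small against m. The larger set is
    trimmed to equal size with m kept, after which both sets and m decrease together. *)
Theorem freiman_strong A B m : A != fset0 -> B != fset0 ->
  (m <= #|` A|)%N -> (m <= #|` B|)%N ->
  (2 * (\dim (Dsp A + Dsp B)).+1 * m <=
     2 * #|` sumv A B| + \dim (Dsp A + Dsp B) * (\dim (Dsp A + Dsp B)).+1)%N.
Proof.
have [n] := ubnP (#|` A| + #|` B|); elim: n A B m => // n IH A B m hn A0 B0 mA mB.
wlog le : A B hn A0 B0 mA mB / (#|` B| <= #|` A|)%N.
  move=> W; have [le|/ltnW le] := leqP #|` B| #|` A|; first exact: W.
  by rewrite sumvC addvC; apply: W => //; rewrite addnC.
move: (A0) (B0); rewrite -!cardfs_gt0 => A0' B0'.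
have [lt|ge] := ltnP #|` B| #|` A|.
  have [A' [cA t h]] := @remove_one A B (leq_ltn_trans B0' lt).
  have {IH}ih : (2 * (\dim (Dsp A' + Dsp B)).+1 * m <= 2 * #|` sumv A' B| +
      \dim (Dsp A' + Dsp B) * (\dim (Dsp A' + Dsp B)).+1)%N.
    by apply: IH => //; rewrite -?cardfs_gt0; lia.
  case: h => [e|[e h]]; rewrite e; first by lia.
  move: ih t h mB; move: (\dim (Dsp A' + Dsp B)) => d'; nia.
have AB : #|` A| = #|` B| by apply/eqP; rewrite eqn_leq ge le.
have [A1|A1] := ltnP 1 #|` A|; last first.
  have /eqP/cardfs1P[a ea] : #|` A| = 1%N by lia.
  have /eqP/cardfs1P[b eb] : #|` B| = 1%N by lia.
  have : (0 < #|` sumv A B|)%N by apply: sumv_gt0.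
  by rewrite ea eb !Dsp1 addv0 dimv0; move: mA; rewrite ea cardfs1; lia.
case: m mA mB => [|m] mA mB; first by rewrite muln0.
have [A' [B' [cA cB t h]]] := remove_both A1 AB.
have {IH}ih : (2 * (\dim (Dsp A' + Dsp B')).+1 * m <= 2 * #|` sumv A' B'| +
    \dim (Dsp A' + Dsp B') * (\dim (Dsp A' + Dsp B')).+1)%N.
  by apply: IH => //; rewrite -?cardfs_gt0; lia.
move: cA cB t h ih AB A1 A0' mA mB.
move: (\dim (Dsp A + Dsp B)) (\dim (Dsp A' + Dsp B')) => d d'.
move: #|` A| #|` B| #|` A'| #|` B'| #|` sumv A B| #|` sumv A' B'| => a b a' b' T T'.
move=> -> -> t h ih [ab] _ _ mA mB; subst b'.
case: h => [e|[e h]|[e h]]; rewrite ?e in t *; nia.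
Qed.
End Functionals.

(** * Pairs without heavy cosets *)

Lemma sub_in_count (T : eqType) (p q : pred T) (s : seq T) :
  {in s, subpred p q} -> (count p s <= count q s)%N.
Proof.
elim: s => //= x s IH h; apply: leq_add.
  by case: (boolP (p x)) => // /h ->; rewrite ?inE ?eqxx.
by apply: IH => y ys; apply: h; rewrite inE ys orbT.
Qed.

Section Spread.
Variable vT : vectType rat.
Implicit Types (W U : {vspace vT}) (A B P Q : {fset vT}).

(* A generic pencil f, g of functionals vanishing on W is turned until the zeros of
   g - s f split B in half; the fibre lost on the way lies in a line modulo W. *)
Lemma halving A B W (a0 b0 : vT) mu r :
  (forall U (x : vT), (\dim U < r)%N -> (count (fun a => (a - x \in U)%R) A <= mu)%N) ->
  (forall U (x : vT), (\dim U < r)%N -> (count (fun b => (b - x \in U)%R) B <= mu)%N) ->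
  ((\dim W).+1 < r)%N ->
  exists h, [/\ islin h, forall w, w \in W -> h w = 0,
    (#|` B| <= 2 * count (fun b => (0 < h (b - b0))%R) B + 2 * mu)%N,
    (#|` B| <= 2 * count (fun b => (h (b - b0) < 0)%R) B + 2 * mu)%N &
    (count (fun a => (h (a - a0) == 0)%R) A <= mu)%N].
Proof.
move=> hA hB dW.
pose C := [seq a - a0 | a <- A] ++ [seq b - b0 | b <- B].
pose CW := [seq c <- C | c \notin W].
pose Bo := [seq b <- B | b - b0 \notin W].
have BoC b : b \in Bo -> b - b0 \in CW.
  rewrite !mem_filter => /andP[-> bB] /=; rewrite mem_cat; apply/orP; right.
  exact: map_f.
have CA a : a \in A -> a - a0 \in C.
  by move=> aA; rewrite mem_cat; apply/orP; left; apply: (map_f (fun a => a - a0)).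
have CB b : b \in B -> b - b0 \in C.
  by move=> bB; rewrite mem_cat; apply/orP; right; apply: (map_f (fun b => b - b0)).
have sB : (size Bo + count (fun b => (b - b0 \in W)%R) B = #|` B|)%N.
  rewrite size_filter addnC -(count_predC (fun b => b - b0 \in W) B).
  by congr (_ + _)%N; apply: eq_count.
(* Up to replacing f by -f, at most half of the values on [Bo] are negative. *)
have [f [lf fW fC hsgn]] : exists f, [/\ islin f, forall w, w \in W -> f w = 0,
    forall c, c \in CW -> f c != 0 &
    (2 * count (fun b => (f (b - b0) < 0)%R)%R Bo <= size Bo)%N].
  have [|f [lf fW fC]] := @generic_functional _ W CW; first by apply/allP => c; rewrite mem_filter => /andP[].
  have cc : (count (fun b => (f (b - b0) < 0)%R) Bo + count (fun b => (- f (b - b0) < 0)%R) Bo = size Bo)%N.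
    rewrite -(count_predC (fun b => f (b - b0) < 0) Bo); congr (_ + _)%N.
    apply: eq_in_count => b /BoC/fC n0 /=.
    by rewrite oppr_lt0 -leNgt lt_neqAle eq_sym n0.
  have [le|lt] := leqP (2 * count (fun b => (f (b - b0) < 0)%R) Bo) (size Bo).
    by exists f.
  exists (fun v => - f v); split.
  - by move=> a u v; rewrite lf opprD mulrN.
  - by move=> w /fW ->; rewrite oppr0.
  - by move=> c /fC; rewrite oppr_eq0.
  - move: cc lt; set u := count _ Bo; set w := count _ Bo.
    by move=> cc lt; lia.
have fout c : c \in C -> f c = 0 -> c \in W.
  move=> cC; apply: contra_eqT => cW; apply: fC.
  by rewrite mem_filter cW.
have [Bo0|Bo0] := eqVneq Bo [::].
  have szB : (#|` B| <= mu)%N by rewrite -sB Bo0 add0n; exact: (hB W b0 (ltnW dW)).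
  exists f; split => //; try by lia.
  apply: leq_trans (hA W a0 (ltnW dW)).
  apply: sub_in_count => a aA /eqP f0.
  by apply: fout f0; apply: CA.
(* If g avoids zero on these vectors, two elements with the same slope g / f are proportional modulo
   W. *)
pose s2 := [seq v <- [seq f c *: c' - f c' *: c | c <- CW, c' <- CW] | v \notin W].
have [|g [lg gW gC]] := @generic_functional _ W s2; first by apply/allP => c; rewrite mem_filter => /andP[].
pose q b := g (b - b0) / f (b - b0).
(* [Pa s] counts the positive values of g - t f for t just above s. The turn stops at the least
   slope s of a point of [Bo] for which at most half of the values are positive just afterwards. *)
pose Pa s := count (fun b => ((0 < f (b - b0)) && (s < q b) || (f (b - b0) < 0) && (q b <= s))%R) Bo.
pose S := [fset b in Bo | (2 * Pa (q b) <= size Bo)%N].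
have S0 : S != fset0.
  have : [fset b in Bo] != fset0.
    by case: (Bo) Bo0 => // b s _; apply/fset0Pn; exists b; rewrite !inE eqxx.
  case/(fset_argmax q) => b; rewrite inE => bBo bmax; apply/fset0Pn; exists b.
  rewrite !inE bBo /=; apply: leq_trans _ hsgn; rewrite leq_mul2l /= /Pa.
  apply: sub_in_count => b' b'Bo /orP[/andP[_]|/andP[]//].
  by rewrite ltNge bmax // inE.
have [bs bsS bsmin] := fset_argmax (fun b => - q b) S0.
have {bsmin}bsmin x : x \in S -> q bs <= q x by move/bsmin; rewrite lerN2.
move: (bsS); rewrite !inE => /andP[/= bsBo hPa]; set s := q bs in bsmin hPa.
pose h v := 1 * g v + (- s) * f v.
have lh : islin h by apply: islin_comb.
have fB b : b \in Bo -> f (b - b0) != 0 by move/BoC/fC.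
have hq b : b \in Bo -> h (b - b0) = f (b - b0) * (q b - s).
  by move=> /fB n0; rewrite /h /q; field.
have zin c : c \in C -> h c = 0 -> c \in (W + <[(bs - b0)%R]>)%VS.
  move=> cC hc; have [cW|cW] := boolP (c \in W); first exact: (subvP (addvSl _ _)).
  have cCW : c \in CW by rewrite mem_filter cW.
  have vW : f (bs - b0) *: c - f c *: (bs - b0) \in W.
    apply/negPn/negP => nW.
    have /negP : g (f (bs - b0) *: c - f c *: (bs - b0)) != 0.
      apply: gC; rewrite mem_filter nW /=; apply/allpairsP.
      by exists (bs - b0, c) => /=; split => //; apply: BoC.
    apply; rewrite islinB // !islinZ //; apply/eqP.
    have -> : g c = s * f c by move: hc; rewrite /h mul1r mulNr => /eqP; rewrite subr_eq0 => /eqP.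
    by rewrite /s /q; field; apply: fB.
  have -> : c = (f (bs - b0))^-1 *: ((f (bs - b0) *: c - f c *: (bs - b0)) + f c *: (bs - b0)).
    by rewrite subrK scalerA mulVf ?scale1r // fB.
  by apply: memvZ; apply: memv_add => //; apply: memvZ; exact: memv_line.
have dZ : (\dim (W + <[(bs - b0)%R]>) < r)%N.
  by apply: leq_ltn_trans (dim_addv_line _ _) dW.
pose z := count (fun b => (q b == s)%R) Bo.
have hz : (z + count (fun b => (b - b0 \in W)%R) B <= mu)%N.
  apply: leq_trans (hB _ b0 dZ); rewrite /z count_filter -count_predUI.
  rewrite [X in (_ + X)%N](@eq_in_count _ _ pred0) ?count_pred0 ?addn0; last first.
    by move=> b _ /=; case: (b - b0 \in W); rewrite ?andbF.
  apply: sub_in_count => b bB /= /orP[/andP[/eqP qb bW]|bW]; last exact: (subvP (addvSl _ _)).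
  apply: zin; first exact: CB.
  by rewrite hq ?qb ?subrr ?mulr0 // mem_filter bW.
pose pos := count (fun b => (0 < h (b - b0))%R) Bo.
pose neg := count (fun b => (h (b - b0) < 0)%R) Bo.
have sz : (pos + neg + z = size Bo)%N.
  rewrite -(count_predC (fun b => 0 < h (b - b0)) Bo) -addnA; congr (_ + _)%N.
  rewrite /neg /z -count_predUI.
  rewrite [X in (_ + X)%N](@eq_in_count _ _ pred0) ?count_pred0 ?addn0; last first.
    by move=> b bB /=; case: eqP => [e|]; rewrite ?andbF // hq // e subrr mulr0 ltxx.
  apply: eq_in_count => b bB /=; rewrite -leNgt le_eqVlt orbC; congr (_ || _).
  by rewrite hq // mulf_eq0 (negPf (fB _ bB)) /= subr_eq0.
have hpos : (2 * pos <= size Bo)%N.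
  apply: leq_trans hPa; rewrite leq_mul2l /=; apply: sub_in_count => b bB /=.
  rewrite hq //; case: (ltgtP (f (b - b0)) 0) (fB _ bB) => // f0 _.
    by rewrite nmulr_rgt0 // subr_lt0 => /ltW.
  by rewrite pmulr_rgt0 // subr_gt0 => ->.
(* The same count just before s, which is still at least half by minimality of s; before the first
   slope this is the choice of sign of f. *)
pose Pb := count (fun b => ((0 < f (b - b0)) && (s <= q b) || (f (b - b0) < 0) && (q b < s))%R) Bo.
have hPb : (Pb <= pos + z)%N.
  rewrite /pos /z -count_predUI; apply: leq_trans (leq_addr _ _).
  apply: sub_in_count => b bB /=; rewrite hq // => /orP[/andP[f0]|/andP[f0 lt]].
    rewrite le_eqVlt eq_sym => /orP[->|lt]; first by rewrite orbT.
    by rewrite pmulr_rgt0 // subr_gt0 lt.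
  by rewrite nmulr_rgt0 // subr_lt0 lt.
have hPb2 : (size Bo <= 2 * Pb)%N.
  have [T0|T0] := eqVneq [fset b in Bo | q b < s] fset0.
    have <- : (count (fun b => (f (b - b0) < 0)%R) Bo + Pb = size Bo)%N.
      rewrite -(count_predC (fun b => f (b - b0) < 0) Bo); congr (_ + _)%N.
      apply: eq_in_count => b bB /=; have nlt : (q b < s) = false.
        by apply/negP => lt; have := in_fset0 b; rewrite -T0 !inE bB lt.
      by rewrite nlt andbF orbF leNgt nlt andbT -leNgt lt_neqAle eq_sym fB.
    move: hsgn; rewrite -{1}(count_predC (fun b => f (b - b0) < 0) Bo).
    rewrite (@eq_in_count _ (predC _) (fun b => (0 < f (b - b0)) && (s <= q b) || (f (b - b0) < 0) && (q b < s))).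
      by rewrite -/Pb; lia.
    move=> b bB /=; have nlt : (q b < s) = false.
      by apply/negP => lt; have := in_fset0 b; rewrite -T0 !inE bB lt.
    by rewrite nlt andbF orbF leNgt nlt andbT -leNgt lt_neqAle eq_sym fB.
  have [b1 b1T b1max] := fset_argmax q T0.
  move: b1T; rewrite !inE => /andP[/= b1Bo b1s].
  have -> : Pb = Pa (q b1).
    apply: eq_in_count => b bB /=.
    have e : (q b < s) = (q b <= q b1).
      apply/idP/idP => [lt|le]; last exact: le_lt_trans le b1s.
      by apply: b1max; rewrite !inE bB lt.
    by rewrite leNgt e -ltNge.
  apply: ltnW; rewrite ltnNge; apply/negP => le.
  by have := bsmin b1; rewrite !inE b1Bo le leNgt b1s => /(_ isT).
have hB' p : (count p Bo <= count p B)%N.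
  by rewrite count_filter; apply: sub_count => b /= /andP[].
exists h; split => //.
- by move=> w wW; rewrite /h fW // gW // !mulr0 addr0.
- have hp : (pos <= count (fun b => (0 < h (b - b0))%R) B)%N := hB' _.
  rewrite -sB; move: hp hz hPb hPb2 sz; move: (size Bo) z (count _ B) (count _ B) => *; lia.
- have hp : (neg <= count (fun b => (h (b - b0) < 0)%R) B)%N := hB' _.
  rewrite -sB; move: hp hz hpos sz hPb; move: (size Bo) z (count _ B) (count _ B) => *; lia.
- apply: leq_trans (hA _ a0 dZ); apply: sub_in_count => a aA /eqP ha.
  by apply: zin ha; apply: CA.
Qed.

Lemma translate_in B P (x : vT) p D g :
  (count (fun b => (x + b)%R \notin P) B <= D)%N -> (g + D <= count p B)%N ->
  exists N : {fset vT}, [/\ (g <= #|` N|)%N, N `<=` P &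
    forall z, z \in N -> exists b, [/\ b \in B, p b & z = x + b]].
Proof.
move=> hD hg; pose B' := [fset b in B | p b && (x + b \in P)].
exists [fset x + b | b in B']; split.
- rewrite card_imfset /=; last exact: addrI.
  have -> : #|` B'| = count (fun b => p b && ((x + b)%R \in P)) B.
    by rewrite -size_filter; apply: perm_size; apply: uniq_perm;
      rewrite ?filter_uniq ?fset_uniq // => b; rewrite !inE mem_filter andbC.
  have : (count p B <= count (fun b => p b && ((x + b)%R \in P)) B + count (fun b => (x + b)%R \notin P) B)%N.
    rewrite -count_predUI; apply: leq_trans (leq_addr _ _); apply: sub_count => b /= ->.
    by case: (_ \in P).
  lia.
- by apply/fsubsetP => _ /imfsetP[b /= + ->]; rewrite !inE => /and3P[].
- move=> z /imfsetP[b /= + ->]; rewrite !inE => /and3P[bB pb _].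
  by exists b.
Qed.

(* A chain of subspaces W: a functional vanishing on W and halving B attains one of
   its extrema over A and B at some point, whose translate of a half of the other set
   is new. *)
Lemma spread A B P D g mu r :
  (forall U (x : vT), (\dim U < r)%N -> (count (fun a => (a - x \in U)%R) A <= mu)%N) ->
  (forall U (x : vT), (\dim U < r)%N -> (count (fun b => (b - x \in U)%R) B <= mu)%N) ->
  (forall a, a \in A -> (count (fun b => (a + b)%R \notin P) B <= D)%N) ->
  (forall b, b \in B -> (count (fun a => (b + a)%R \notin P) A <= D)%N) ->
  A != fset0 -> B != fset0 ->
  (2 * (g + D + mu) <= #|` A|)%N -> (2 * (g + D + mu) <= #|` B|)%N ->
  (#|` B| + r.-1 * g <= #|` P `&` sumv A B| + D)%N.
Proof.
move=> hA hB hPA hPB A0 B0 cA cB.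
have [/fset0Pn[a0 a0A] /fset0Pn[b0 b0B]] := (A0, B0).
(* Invariant: each sum in Q has a summand in the coset of W through a0 or through b0. A functional
   that vanishes on W therefore takes on Q, relative to a0 + b0, only values that it takes on A or
   on B alone. *)
suff H w : (w < maxn r 1)%N -> exists W Q, [/\ (\dim W <= w)%N,
    (#|` B| + w * g <= #|` Q| + D)%N, Q `<=` P &
    forall z, z \in Q -> exists a b, [/\ a \in A, b \in B, z = a + b &
      (a - a0 \in W) || (b - b0 \in W)]].
  have [|W [Q [_ h sQ hQ]]] := H r.-1; first by lia.
  apply: leq_trans h _; rewrite leq_add2r fsubset_leq_card // fsubsetI sQ.
  by apply/fsubsetP => z /hQ[a [b [aA bB -> _]]]; apply: mem_sumv.
elim: w => [_|w IH hw].
  have [|N [gN NP hN]] := @translate_in B P a0 predT D (#|` B| - D)%N (hPA _ a0A).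
    rewrite count_predT; apply: leq_trans (leqnn _); rewrite subnK //; lia.
  exists 0%VS, N; split; rewrite ?dimv0 //; first by lia.
  by move=> z /hN[b [bB _ ->]]; exists a0, b; rewrite subrr mem0v.
have {IH}[|W [Q [dW hQ QP inQ]]] := IH; first by lia.
pose G := exists N W', [/\ (g <= #|` N|)%N, N `<=` P, (W <= W')%VS,
    (\dim W' <= (\dim W).+1)%N & forall z, z \in N -> z \notin Q /\ exists a b,
      [/\ a \in A, b \in B, z = a + b & (a - a0 \in W') || (b - b0 \in W')]].
suff [N [W' [gN NP WW' dW' hN]]] : G.
  exists W', (Q `|` N); split.
  - by apply: leq_trans dW' _; rewrite ltnS.
  - rewrite cardfsU; have -> : Q `&` N = fset0.
      apply/fsetP => z; rewrite !inE; apply/negP => /andP[zQ /hN[]].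
      by rewrite zQ.
    rewrite cardfs0; lia.
  - by rewrite fsubUset QP NP.
  - move=> z; rewrite inE => /orP[/inQ[a [b [aA bB e h]]]|/hN[]//].
    exists a, b; split => //; case/orP: h => h; apply/orP; [left|right]; exact: (subvP WW').
have [|h [lh hW hBp hBn hA0]] := @halving A B W a0 b0 mu r hA hB; first by lia.
have [ap apA apm] := fset_argmax (fun a => h (a - a0)) A0.
have [bp bpB bpm] := fset_argmax (fun b => h (b - b0)) B0.
have [an anA anm'] := fset_argmax (fun a => - h (a - a0)) A0.
have [bn bnB bnm'] := fset_argmax (fun b => - h (b - b0)) B0.
have anm x : x \in A -> h (an - a0) <= h (x - a0) by move/anm'; rewrite lerN2.
have bnm x : x \in B -> h (bn - b0) <= h (x - b0) by move/bnm'; rewrite lerN2.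
have hs a b : h (a + b - (a0 + b0)) = h (a - a0) + h (b - b0).
  by rewrite opprD addrACA islinD.
have Qmax z : z \in Q -> h (z - (a0 + b0)) <= Num.max (h (ap - a0)) (h (bp - b0)).
  case/inQ => a [b [aA bB -> /orP[] /hW e]]; rewrite hs e le_max ?add0r ?addr0.
    by rewrite bpm ?orbT.
  by rewrite apm.
have Qmin z : z \in Q -> Num.min (h (an - a0)) (h (bn - b0)) <= h (z - (a0 + b0)).
  case/inQ => a [b [aA bB -> /orP[] /hW e]]; rewrite hs e ge_min ?add0r ?addr0.
    by rewrite bnm ?orbT.
  by rewrite anm.
have stepA a p : a \in A -> (g + D <= count p B)%N ->
    (forall b, b \in B -> p b -> a + b \notin Q) -> G.
  move=> aA hg new; have [N [gN NP hN]] := translate_in (hPA _ aA) hg.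
  exists N, (W + <[a - a0]>)%VS; split => //; [exact: addvSl|exact: dim_addv_line|].
  move=> z /hN[b [bB pb ->]]; split; first exact: new.
  exists a, b; split => //; apply/orP; left; apply: (subvP (addvSr _ _)); exact: memv_line.
have stepB b p : b \in B -> (g + D <= count p A)%N ->
    (forall a, a \in A -> p a -> a + b \notin Q) -> G.
  move=> bB hg new; have [N [gN NP hN]] := translate_in (hPB _ bB) hg.
  exists N, (W + <[b - b0]>)%VS; split => //; [exact: addvSl|exact: dim_addv_line|].
  move=> z /hN[a [aA pa ->]]; rewrite addrC; split; first exact: new.
  exists a, b; split => //; apply/orP; right; apply: (subvP (addvSr _ _)); exact: memv_line.
(* If an extremum over both sets is attained in A, half of B is translated past it. Otherwise both
   extrema lie in B; h need not halve A, but one of its two sign classes in A is large enough, and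
   that one is used. *)
have [le1|lt1] := leP (h (bp - b0)) (h (ap - a0)).
  apply: (stepA ap (fun b => 0 < h (b - b0))) => //.
    by move: hBp cB; set c := count _ B; move: #|` B|; clear; lia.
  move=> b bB hb; apply/negP => /Qmax; rewrite hs (max_idPl le1).
  by apply/negP; rewrite -ltNge ltrDl.
have [le2|lt2] := leP (h (an - a0)) (h (bn - b0)).
  apply: (stepA an (fun b => h (b - b0) < 0)) => //.
    by move: hBn cB; set c := count _ B; move: #|` B|; clear; lia.
  move=> b bB hb; apply/negP => /Qmin; rewrite hs (min_idPl le2).
  by apply/negP; rewrite -ltNge gtrDl.
pose cp := count (fun a => (0 < h (a - a0))%R) A.
pose cn := count (fun a => (h (a - a0) < 0)%R) A.
have cc : (#|` A| <= cp + cn + mu)%N.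
  apply: leq_trans (leq_add (leqnn _) hA0); rewrite /cp /cn -addnA -count_predUI.
  rewrite -{1}(count_predC (fun a => (0 < h (a - a0))%R) A) leq_add2l.
  apply: leq_trans (leq_addr _ _); apply: sub_count => a /=.
  by rewrite -leNgt le_eqVlt orbC.
have [l|l] := leqP (g + D) cp.
  apply: (stepB bp _ bpB l) => a aA hb; apply/negP => /Qmax; rewrite hs (max_idPr (ltW lt1)).
  by apply/negP; rewrite -ltNge ltrDr.
have l' : (g + D <= cn)%N.
  by move: cA cc l; move: cp cn #|` A|; clear; lia.
apply: (stepB bn _ bnB l') => a aA hb; apply/negP => /Qmin; rewrite hs (min_idPr (ltW lt2)).
by apply/negP; rewrite -ltNge gtrDr.
Qed.
End Spread.

(** * Fibres over a quotient *)

Lemma sum_count_fibers_eq (T I : eqType) (f : T -> I) (Z : seq I) (s : seq T) :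
  uniq Z -> (\sum_(z <- Z) count (fun p => f p == z) s = count (fun p => f p \in Z) s)%N.
Proof.
move=> uZ; elim: s => [|x s IH] /=; first by rewrite big1.
rewrite big_split /= IH; congr (_ + _)%N.
have [xZ|xZ] := boolP (f x \in Z).
  rewrite (bigD1_seq (f x)) //= eqxx big1 // => i; rewrite eq_sym => /negPf ->.
  by [].
rewrite big_seq big1 // => i iZ; case: eqP => // e; by rewrite e iZ in xZ.
Qed.

Lemma sum_count_fibers (T I : eqType) (f : T -> I) (Z : seq I) (s : seq T) :
  uniq Z -> (\sum_(z <- Z) count (fun p => f p == z) s <= size s)%N.
Proof. by move=> uZ; rewrite sum_count_fibers_eq // count_size. Qed.

Lemma leq_sum_subset (I : eqType) (s Z : seq I) (F : I -> nat) :
  uniq s -> uniq Z -> {subset s <= Z} -> (\sum_(z <- s) F z <= \sum_(z <- Z) F z)%N.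
Proof.
move=> us uZ sZ; rewrite [leqRHS](bigID (mem s)) /=.
apply: leq_trans (leq_addr _ _); rewrite -[leqRHS]big_filter leq_eqVlt; apply/orP; left.
apply/eqP; apply: perm_big; apply: uniq_perm => //; first exact: filter_uniq.
by move=> z; rewrite mem_filter /=; case: (boolP (z \in s)) => // /sZ ->.
Qed.

Lemma card_fset_filter (T : choiceType) (A : {fset T}) (p : pred T) :
  #|` [fset a in A | p a]| = count p A.
Proof.
rewrite -size_filter; apply: perm_size; apply: uniq_perm;
  by rewrite ?filter_uniq ?fset_uniq // => b; rewrite !inE mem_filter andbC.
Qed.

Section Fibers.
Variable vT : vectType rat.
Implicit Types (W U : {vspace vT}) (A B P Q : {fset vT}).

(** The representative of v in the kernel of [projv U]: the quotient by U is realized inside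
    [vT]. *)
Definition modv U (v : vT) := v - projv U v.

Lemma modvD U (u v : vT) : modv U (u + v) = modv U u + modv U v.
Proof. by rewrite /modv linearD opprD addrACA. Qed.

Lemma modvB U (u v : vT) : modv U (u - v) = modv U u - modv U v.
Proof.
by rewrite /modv linearB !opprB [projv U v - projv U u]addrC addrACA [- v + _]addrC.
Qed.

Lemma modv_eq0 U (v : vT) : (modv U v == 0) = (v \in U).
Proof.
rewrite subr_eq0; apply/eqP/idP => [->|/projv_id ->//]; exact: memv_proj.
Qed.

Lemma modv_eq U (x y : vT) : (modv U x == modv U y) = (x - y \in U).
Proof. by rewrite -modv_eq0 modvB subr_eq0. Qed.

Lemma proj_modv U (v : vT) : projv U (modv U v) = 0.
Proof. by rewrite /modv linearB /= [X in _ - X]projv_id ?memv_proj // subrr. Qed.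

Lemma modv_id U (v : vT) : modv U (modv U v) = modv U v.
Proof. by rewrite {1}/modv proj_modv subr0. Qed.

Definition fib U A (x : vT) := count (fun a => modv U a == x) A.
Definition modf U A : {fset vT} := [fset modv U a | a in A].

Lemma mem_modf U A a : a \in A -> modv U a \in modf U A.
Proof. by move=> aA; apply: in_imfset. Qed.

Lemma sum_fib U A : (\sum_(x <- modf U A) fib U A x = #|` A|)%N.
Proof.
rewrite sum_count_fibers_eq //; apply/eqP; rewrite -all_count.
by apply/allP => a aA; apply: mem_modf.
Qed.

(* Blow-up: elements of a common fibre are separated along w, by their rank. *)
Definition spreadv U (w : vT) A (a : vT) : vT :=
  modv U a + (index a [seq a' <- A | modv U a' == modv U a])%:R *: w.

Lemma spreadv_inj U (w : vT) A : w \in U -> w != 0 -> {in A &, injective (spreadv U w A)}.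
Proof.
move=> wU w0 a a' aA a'A e.
have e1 : modv U a = modv U a'.
  have h c : modv U (spreadv U w A c) = modv U c.
    rewrite /spreadv modvD modv_id [X in _ + X](_ : _ = 0) ?addr0 //.
    by apply/eqP; rewrite modv_eq0 memvZ.
  by rewrite -h e h.
move: e; rewrite /spreadv e1 => /addrI/eqP.
rewrite -subr_eq0 -scalerBl scaler_eq0 (negPf w0) orbF subr_eq0 eqr_nat => /eqP.
have m c : c \in A -> modv U c = modv U a' -> c \in [seq x <- A | modv U x == modv U a'].
  by move=> cA ce; rewrite mem_filter ce eqxx.
move=> e2; have := nth_index a (m _ aA e1).
by rewrite e2 (nth_index a (m _ a'A erefl)).
Qed.

(** The blow-ups have the cardinalities of A and B, and dimension e + 1: the fibre over y0 has two
    points, so w itself becomes a difference. Over a sum z their sums are of the form z + t w with t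
    < 2 [mx z]. The claim is [freiman_strong] for the blow-ups. *)
Lemma blowup A B U (w y0 : vT) (mx : vT -> nat) m : w \in U -> w != 0 ->
  A != fset0 -> B != fset0 -> (1 < fib U B y0)%N ->
  (forall x y, x \in modf U A -> y \in modf U B ->
     (fib U A x <= mx (x + y)%R)%N /\ (fib U B y <= mx (x + y)%R)%N) ->
  (m <= #|` A|)%N -> (m <= #|` B|)%N ->
  let e := \dim (Dsp (modf U A) + Dsp (modf U B)) in
  (2 * e.+2 * m <= 4 * \sum_(z <- sumv (modf U A) (modf U B)) mx z + e.+1 * e.+2)%N.
Proof.
move=> wU w0 A0 B0 hy0 hmx mA mB /=.
set E := (Dsp _ + Dsp _)%VS; set Z := sumv _ _.
pose At := [fset spreadv U w A a | a in A]; pose Bt := [fset spreadv U w B b | b in B].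
have cAt : #|` At| = #|` A| by apply: card_in_imfset => /=; apply: spreadv_inj.
have cBt : #|` Bt| = #|` B| by apply: card_in_imfset => /=; apply: spreadv_inj.
have At0 : At != fset0 by rewrite -cardfs_gt0 cAt cardfs_gt0.
have Bt0 : Bt != fset0 by rewrite -cardfs_gt0 cBt cardfs_gt0.
pose H := (Dsp At + Dsp Bt)%VS.
have mAt a : a \in A -> spreadv U w A a \in At by move=> ?; apply: in_imfset.
have mBt a : a \in B -> spreadv U w B a \in Bt by move=> ?; apply: in_imfset.
have diff (C : {fset vT}) a a' : spreadv U w C a - spreadv U w C a' - (modv U a - modv U a') \in <[w]>%VS.
  have e4 (p i p' j : vT) : p + i - (p' + j) - (p - p') = i - j.
    have -> : p + i - (p' + j) = (i - j) + (p - p') by rewrite opprD addrACA addrC.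
    by rewrite addrK.
  by rewrite /spreadv e4 -scalerBl; apply: memvZ; apply: memv_line.
have wH : w \in H.
  move: hy0; rewrite /fib -size_filter; set s := seq.filter _ _ => hs.
  have us : uniq s by rewrite filter_uniq ?fset_uniq.
  have s0 : nth 0 s 0 \in s by rewrite mem_nth // ltnW.
  have s1 : nth 0 s 1 \in s by rewrite mem_nth.
  have ee i : (i < size s)%N -> nth 0 s i \in B /\ spreadv U w B (nth 0 s i) = y0 + i%:R *: w.
    move=> hi; have := mem_nth 0 hi; rewrite {1}/s mem_filter => /andP[/eqP ey ->].
    by rewrite /spreadv ey -/s index_uniq.
  have [b0 e0] := ee 0%N (ltnW hs); have [b1 e1] := ee 1%N hs.
  have -> : w = spreadv U w B (nth 0 s 1) - spreadv U w B (nth 0 s 0).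
    by rewrite e0 e1 scale0r scale1r addr0 [y0 + w]addrC addrK.
  by apply: (subvP (addvSr _ _)); apply: mem_Dsp; apply: mBt.
have lH : (<[w]> <= H)%VS by rewrite -memvE.
have EH : (E <= H)%VS.
  have key (C : {fset vT}) Ct : (forall a, a \in C -> spreadv U w C a \in Ct) -> (Dsp Ct <= H)%VS ->
      (Dsp (modf U C) <= H)%VS.
    move=> hC sH; have [->|/fset0Pn[c0 c0C]] := eqVneq C fset0.
      by apply/span_subvP => v /allpairsP[[x y] /= []]; rewrite /modf imfset0.
    apply: (@Dsp_sub _ _ _ (modv U c0)) => _ /imfsetP[c /= cC ->].
    have -> : modv U c - modv U c0 = (spreadv U w C c - spreadv U w C c0) -
       (spreadv U w C c - spreadv U w C c0 - (modv U c - modv U c0)) by rewrite subKr.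
    apply: memvB; last exact: (subvP lH).
    by apply: (subvP sH); apply: mem_Dsp; apply: hC.
  by rewrite subv_add (key A At) ?(key B Bt) ?addvSl ?addvSr.
have HE : (H <= E + <[w]>)%VS.
  have key (C : {fset vT}) : (Dsp (modf U C) <= E)%VS ->
      (Dsp [fset spreadv U w C c | c in C] <= E + <[w]>)%VS.
    move=> sE; have [->|/fset0Pn[c0 c0C]] := eqVneq C fset0.
      by apply/span_subvP => v /allpairsP[[x y] /= []]; rewrite imfset0.
    apply: (@Dsp_sub _ _ _ (spreadv U w C c0)) => _ /imfsetP[c /= cC ->].
    rewrite -[X in X \in _](subrK (modv U c - modv U c0)) addrC.
    apply: memv_add => //; apply: (subvP sE); apply: mem_Dsp; exact: mem_modf.
  by rewrite subv_add !key ?addvSl ?addvSr.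
have wE : w \notin E.
  apply: contra w0 => wE.
  have : (E <= lker (projv U))%VS.
    have key (C : {fset vT}) : (Dsp (modf U C) <= lker (projv U))%VS.
      apply/span_subvP => v /allpairsP[[x y] /= [/imfsetP[c /= _ ->] /imfsetP[c' /= _ ->] ->]].
      by rewrite memv_ker linearB /= !proj_modv subrr.
    by rewrite subv_add !key.
  by move=> /subvP/(_ _ wE); rewrite memv_ker projv_id.
have dH : \dim H = (\dim E).+1.
  apply/eqP; rewrite eqn_leq (leq_trans (dimvS HE) (dim_addv_line _ _)) /=.
  rewrite ltn_neqAle dimvS // andbT; apply: contra wE => /eqP e.
  by have /eqP -> : E == H by rewrite eqEdim EH e leqnn.
have hs : (#|` sumv At Bt| <= 2 * \sum_(z <- Z) mx z)%N.
  pose L := flatten [seq [seq z + t%:R *: w | t <- iota 0 (2 * mx z)] | z <- Z].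
  have -> : (2 * \sum_(z <- Z) mx z = size L)%N.
    rewrite size_flatten /shape -map_comp sumnE big_map big_distrr /=.
    by apply: eq_bigr => z _; rewrite size_map size_iota.
  apply: uniq_leq_size => // z /sumvP[_ [_ [/imfsetP[a /= aA ->] /imfsetP[b /= bB ->] ->]]].
  apply/flatten_mapP; exists (modv U a + modv U b); first by apply: mem_sumv; apply: mem_modf.
  rewrite /spreadv; set i := index _ _; set j := index _ _.
  apply/mapP; exists (i + j)%N; last by rewrite addrACA -scalerDl natrD.
  rewrite mem_iota add0n /=.
  have [ha hb] := hmx _ _ (mem_modf U aA) (mem_modf U bB).
  have hi : (i < fib U A (modv U a))%N.
    by rewrite /fib -size_filter index_mem mem_filter eqxx.
  have hj : (j < fib U B (modv U b))%N.
    by rewrite /fib -size_filter index_mem mem_filter eqxx.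
  by move: hi hj ha hb; clear; lia.
have := @freiman_strong _ At Bt m At0 Bt0; rewrite cAt cBt -/H dH => /(_ mA mB).
move: hs; move: (\dim E) #|` _| (\sum_(z <- Z) mx z)%N; clear; lia.
Qed.

Lemma count_fset_sub A A' p : A' `<=` A -> (count p A' <= count p A)%N.
Proof.
move=> /fsubsetP s; rewrite -!card_fset_filter fsubset_leq_card //.
by apply/fsubsetP => x; rewrite !inE => /andP[/s -> ->].
Qed.

Lemma fib_sub A A' U x : A' `<=` A -> (fib U A' x <= fib U A x)%N.
Proof. exact: count_fset_sub. Qed.

Lemma card_sub_fib A U x N : N `<=` A -> (forall a, a \in N -> modv U a = x) ->
  (#|` N| <= fib U A x)%N.
Proof.
move=> /fsubsetP s h; rewrite /fib -card_fset_filter fsubset_leq_card //.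
by apply/fsubsetP => a aN; rewrite !inE s //= h.
Qed.

Lemma fib_ge A B P U D a y : a \in A ->
  (count (fun b => (a + b)%R \notin P) B <= D)%N ->
  (fib U B y <= fib U (P `&` sumv A B) (modv U a + y)%R + D)%N.
Proof.
move=> aA hD; have [le|gt] := leqP (fib U B y) D; first exact: leq_trans le (leq_addl _ _).
have [|N [gN NP hN]] := @translate_in _ B P a (fun b => modv U b == y) D (fib U B y - D)%N hD.
  by rewrite subnK // ltnW.
suff : (#|` N| <= fib U (P `&` sumv A B) (modv U a + y)%R)%N.
  by move: gN gt; move: (fib U B y) (fib _ _ _) => p q; clear; lia.
apply: card_sub_fib.
  rewrite fsubsetI NP; apply/fsubsetP => z /hN[b [bB _ ->]]; exact: mem_sumv.
by move=> z /hN[b [bB /eqP <- ->]]; rewrite modvD.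
Qed.

Lemma fib_spread A B P U D g mu r x y :
  (forall W (v : vT), (\dim W < r)%N -> (count (fun a => (a - v \in W)%R) A <= mu)%N) ->
  (forall W (v : vT), (\dim W < r)%N -> (count (fun b => (b - v \in W)%R) B <= mu)%N) ->
  (forall a, a \in A -> (count (fun b => (a + b)%R \notin P) B <= D)%N) ->
  (forall b, b \in B -> (count (fun a => (b + a)%R \notin P) A <= D)%N) ->
  (0 < fib U A x)%N -> (0 < fib U B y)%N ->
  (2 * (g + D + mu) <= fib U A x)%N -> (2 * (g + D + mu) <= fib U B y)%N ->
  (fib U B y + r.-1 * g <= fib U (P `&` sumv A B) (x + y)%R + D)%N.
Proof.
move=> hA hB dA dB A0 B0 cA cB.
pose FA := [fset a in A | modv U a == x]; pose FB := [fset b in B | modv U b == y].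
have sA : FA `<=` A by apply/fsubsetP => a; rewrite !inE => /andP[].
have sB : FB `<=` B by apply/fsubsetP => a; rewrite !inE => /andP[].
have eA : #|` FA| = fib U A x by apply: card_fset_filter.
have eB : #|` FB| = fib U B y by apply: card_fset_filter.
have := @spread _ FA FB P D g mu r.
rewrite eA eB => h; apply: leq_trans (h _ _ _ _ _ _ _ _) _ => //.
- by move=> W v dW; apply: leq_trans (hA W v dW); apply: count_fset_sub.
- by move=> W v dW; apply: leq_trans (hB W v dW); apply: count_fset_sub.
- by move=> a /(fsubsetP sA)/dA; apply: leq_trans; apply: count_fset_sub.
- by move=> a /(fsubsetP sB)/dB; apply: leq_trans; apply: count_fset_sub.
- by rewrite -cardfs_gt0 eA.
- by rewrite -cardfs_gt0 eB.
- rewrite leq_add2r; apply: card_sub_fib.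
    by rewrite fsetIS // sumvS.
  move=> z; rewrite inE => /andP[_ /sumvP[a [b [+ + ->]]]].
  by rewrite !inE modvD => /andP[_ /eqP ->] /andP[_ /eqP ->].
Qed.

(* The fibre over x + y0 is counted with [spread], every other fibre by the larger of
   the two fibres summing to it; the blow-up turns the latter into a sumset. *)
Lemma core A B P U D M R L b u m y0 :
  (0 < b)%N -> (0 < L)%N -> (1 < M)%N -> (b * D * L <= M)%N -> (0 < \dim U)%N ->
  A != fset0 -> B != fset0 -> fib U B y0 = M ->
  (forall x, (fib U A x <= M)%N) -> (forall x, (fib U B x <= M)%N) ->
  (forall a, a \in A -> (M <= L * fib U A (modv U a))%N) ->
  (forall W (v : vT), (\dim W < u)%N -> (count (fun a => (a - v \in W)%R) A <= R)%N) ->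
  (forall W (v : vT), (\dim W < u)%N -> (count (fun b => (b - v \in W)%R) B <= R)%N) ->
  (forall a, a \in A -> (count (fun b => (a + b)%R \notin P) B <= D)%N) ->
  (forall b, b \in B -> (count (fun a => (b + a)%R \notin P) A <= D)%N) ->
  (m <= #|` A|)%N -> (m <= #|` B|)%N ->
  let e := \dim (Dsp (modf U A) + Dsp (modf U B)) in
  (b.-1 * (2 * e.+2 * m - e.+1 * e.+2) +
    2 * b * (u.-1 * (#|` A| - #|` modf U A| * (2 * (D + R)).+1))
   <= 4 * b * #|` P `&` sumv A B|)%N.
Proof.
move=> b0 L0 M1 hM U0 A0 B0 hy0 hmA hmB heavy lA lB dA dB mA mB /=.
set P' := P `&` sumv A B; set e := \dim _.
set TA := modf U A; set TB := modf U B; pose Z := sumv TA TB.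
have y0B : y0 \in TB.
  have : (0 < fib U B y0)%N by rewrite hy0 ltnW.
  by rewrite -has_count => /hasP[y yB /eqP <-]; apply: mem_modf.
pose mx z := (\max_(x <- TA | (z - x)%R \in TB) maxn (fib U A x) (fib U B (z - x)%R))%N.
have hmx x y : x \in TA -> y \in TB -> (maxn (fib U A x) (fib U B y) <= mx (x + y)%R)%N.
  move=> xA yB; rewrite /mx.
  have h : ((x + y) - x)%R \in TB by rewrite [x + y]addrC addrK.
  by apply: (bigmaxn_sup_seq x) => //; rewrite [x + y]addrC addrK.
have mxM z : (mx z <= M)%N.
  by apply/bigmax_leqP_seq => x _ _; rewrite geq_max hmA hmB.
have bd x y : x \in TA -> y \in TB ->
    (maxn (fib U A x) (fib U B y) <= fib U P' (x + y)%R + D)%N.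
  move=> /imfsetP[a /= aA ->] /imfsetP[c /= cB ->].
  rewrite geq_max (fib_ge _ _ aA) ?dA // andbT addrC /P' sumvC.
  by apply: fib_ge => //; apply: dB.
have bdz z : z \in Z -> (mx z <= fib U P' z + D)%N.
  move=> zZ; apply/bigmax_leqP_seq => x xA yB.
  by have := bd _ _ xA yB; rewrite [x + _]addrC subrK.
have heavyx x : x \in TA -> (M <= L * fib U A x)%N.
  by move=> /imfsetP[a /= aA ->]; apply: heavy.
have Dmx z : z \in Z -> (b * D <= mx z)%N.
  move=> /sumvP[x [y [xA yB ->]]].
  have := leq_trans hM (heavyx _ xA); rewrite mulnC leq_pmul2l // => h.
  by apply: leq_trans h _; apply: leq_trans _ (hmx _ _ xA yB); apply: leq_maxl.
(* The largest gain that the size condition 2 (g + D + R) <= |fibre| of [fib_spread] admits. *)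
pose g x := ((fib U A x)./2 - (D + R))%N.
pose ex z := (if (z - y0)%R \in TA then u.-1 * g (z - y0)%R else 0)%N.
(* Since D is at most [mx z] / b, the additive loss D becomes a factor (b - 1) / b. *)
have key z : z \in Z -> (b.-1 * mx z + b * ex z <= b * fib U P' z)%N.
  move=> zZ; have := bdz z zZ; have := Dmx z zZ; have := mxM z.
  rewrite /ex; case: ifP => [xA|_]; last first.
    by move: (mx z) (fib U P' z) b0; clear; case: b => // n mz p; nia.
  have [g0|g0] := posnP (g (z - y0)%R).
    by rewrite g0; move: (mx z) (fib U P' z) b0; clear; case: b => // n mz p; nia.
  have := @fib_spread A B P U D (g (z - y0)%R) R u (z - y0)%R y0 lA lB dA dB.
  rewrite subrK -/P' hy0; move: g0; rewrite /g; set f := fib U A _ => g0.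
  have fM : (f <= M)%N := hmA _.
  have hh : (2 * f./2 <= f)%N by rewrite mul2n -[leqRHS]odd_double_half leq_addl.
  move=> /(_ _ _ _ _) h mM Dm mP.
  have {h} : (M + u.-1 * (f./2 - (D + R)) <= fib U P' z + D)%N.
    by apply: h; move: g0 hh fM M1; clear; lia.
  move: (f./2 - (D + R))%N mM Dm mP b0 => gg; move: (mx z) (fib U P' z); clear.
  by case: b => // n mz p; move: (u.-1 * gg)%N => t; nia.
have sumkey : (b.-1 * \sum_(z <- Z) mx z + b * \sum_(z <- Z) ex z <= b * #|` P'|)%N.
  apply: leq_trans (_ : b * \sum_(z <- Z) fib U P' z <= _)%N; last first.
    by rewrite leq_mul2l sum_count_fibers ?orbT // fset_uniq.
  by rewrite !big_distrr -big_split /= big_seq [leqRHS]big_seq; apply: leq_sum.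
have exsum : (u.-1 * \sum_(x <- TA) g x <= \sum_(z <- Z) ex z)%N.
  have -> : (u.-1 * \sum_(x <- TA) g x = \sum_(z <- [seq (x + y0)%R | x <- TA]) ex z)%N.
    rewrite big_distrr big_map /= !big_seq; apply: eq_bigr => x xA.
    by rewrite /ex addrK xA.
  apply: leq_sum_subset; rewrite ?fset_uniq //.
    by rewrite map_inj_uniq ?fset_uniq //; apply: addIr.
  by move=> _ /mapP[x xA ->]; apply: mem_sumv.
have gsum : (#|` A| <= 2 * \sum_(x <- TA) g x + #|` TA| * (2 * (D + R)).+1)%N.
  rewrite -(sum_fib U A) -/TA.
  have -> : (#|` TA| * (2 * (D + R)).+1 = \sum_(x <- TA) (2 * (D + R)).+1)%N.
    by rewrite big_const_seq count_predT iter_addn_0 mulnC.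
  rewrite big_distrr -big_split; apply: leq_sum => x _ /=; rewrite /g.
  rewrite -{1}(odd_double_half (fib U A x)) -mul2n.
  by case: (odd _); move: (fib U A x)./2 (D + R)%N => p q; clear; lia.
have [w wU w0] : exists2 w, w \in U & w != 0.
  by exists (vpick U); rewrite ?memv_pick // vpick0 -dimv_eq0 -lt0n.
have hy1 : (1 < fib U B y0)%N by rewrite hy0.
have hmx2 x y : x \in TA -> y \in TB ->
     (fib U A x <= mx (x + y)%R)%N /\ (fib U B y <= mx (x + y)%R)%N.
  by move=> xA yB; have := hmx _ _ xA yB; rewrite geq_max => /andP[].
have : (2 * e.+2 * m <= 4 * \sum_(z <- Z) mx z + e.+1 * e.+2)%N := blowup wU w0 A0 B0 hy1 hmx2 mA mB.
move: sumkey exsum gsum.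
move: (\sum_(z <- Z) mx z)%N (\sum_(z <- Z) ex z)%N (\sum_(x <- TA) g x)%N => s1 s2 s3.
move: #|` A| #|` P'| (#|` TA| * _)%N => cA cP t.
clear => h1 h2 h3 h4.
have h5 : (b.-1 * (2 * e.+2 * m - e.+1 * e.+2) <= b.-1 * (4 * s1))%N.
  by rewrite leq_mul2l leq_subLR addnC h4 orbT.
have h6 : (u.-1 * (cA - t) <= u.-1 * (2 * s3))%N.
  by rewrite leq_mul2l leq_subLR addnC h3 orbT.
have h7 : (2 * b * (u.-1 * (cA - t)) <= 2 * b * (2 * s2))%N.
  rewrite leq_mul2l; apply/orP; right; apply: leq_trans h6 _; nia.
move: h1 h5 h7; move: (b.-1 * (2 * e.+2 * m - e.+1 * e.+2))%N (u.-1 * _)%N => p q.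
by clear; nia.
Qed.
End Fibers.

(** * Popular sums of robust pairs *)

Section Robust.
Variable vT : vectType rat.
Implicit Types (W U : {vspace vT}) (A B P Q : {fset vT}).

Lemma fibE U A (v : vT) : fib U A (modv U v) = count (fun a => (a - v \in U)%R) A.
Proof. by apply: eq_count => a /=; rewrite modv_eq. Qed.

Lemma modv_diff U (x y : vT) : x - y - (modv U x - modv U y) \in U.
Proof.
by rewrite -modv_eq0 (modvB U (x - y)) (modvB U x) (modvB U (modv U x)) !modv_id subrr.
Qed.

(** Each coset of U met by A, added to the fibre of size M over y0, carries at least M - D sums in
    P, so A meets at most 2 T / M cosets. Those with fewer than M / L points of A contain at most 2
    T / L <= rho points altogether; robustness allows their deletion. [core] then applies, with a
    dimension modulo U of at least d - dim U. *)
Lemma robust_half A B P U D M R R' L b u k T rho y0 :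
  let d := \dim (Dsp A + Dsp B) in
  (1 < b)%N -> (0 < L)%N -> (1 < R')%N -> (R' <= M)%N -> (b * D * L <= R')%N ->
  ((2 * (D + R)).+1 * (2 * T) <= rho * R')%N -> (2 * T <= L * rho)%N ->
  (0 < u)%N -> (0 < \dim U)%N -> (\dim U <= d)%N -> ((2 * d).+1 <= rho)%N ->
  fib U B y0 = M ->
  (forall x, (fib U A x <= M)%N) -> (forall x, (fib U B x <= M)%N) ->
  (forall W (v : vT), (\dim W < u)%N -> (count (fun a => (a - v \in W)%R) A <= R)%N) ->
  (forall W (v : vT), (\dim W < u)%N -> (count (fun b => (b - v \in W)%R) B <= R)%N) ->
  (forall a, a \in A -> (count (fun b => (a + b)%R \notin P) B <= D)%N) ->
  (forall b, b \in B -> (count (fun a => (b + a)%R \notin P) A <= D)%N) ->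
  (k <= #|` A|)%N -> (k <= #|` B|)%N -> (#|` P `&` sumv A B| <= T)%N ->
  (forall A1, A1 `<=` A -> (#|` A| <= #|` A1| + rho)%N -> (d <= \dim (Dsp A1 + Dsp B))%N) ->
  (b.-1 * (d - \dim U + 1 + u) * (k - 2 * rho) <= 2 * b * #|` P `&` sumv A B|)%N.
Proof.
move=> d b1 L0 R1 RM hbD hT hL u0 U0 Ud hd hy0 mA mB lA lB dA dB kA kB hP rob.
have [kr|kr] := leqP k (2 * rho).
  by move: kr; rewrite -subn_eq0 => /eqP ->; rewrite muln0.
have M1 : (1 < M)%N by apply: leq_trans RM.
pose TA := modf U A.
set P' := P `&` sumv A B in hP *.
have y0B : y0 \in modf U B.
  have : (0 < fib U B y0)%N by rewrite hy0 ltnW.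
  by rewrite -has_count => /hasP[y yB /eqP <-]; apply: mem_modf.
have hTA : (#|` TA| * M <= 2 * T)%N.
  have h : (#|` TA| * (M - D) <= #|` P'|)%N.
    have -> : (#|` TA| * (M - D) = \sum_(z <- [seq (x + y0)%R | x <- TA]) (M - D))%N.
      by rewrite big_const_seq count_predT iter_addn_0 size_map mulnC.
    apply: leq_trans (sum_count_fibers (modv U) P' (_ : uniq [seq (x + y0)%R | x <- TA])); last first.
      by rewrite map_inj_uniq ?fset_uniq //; apply: addIr.
    rewrite !big_map !big_seq; apply: leq_sum => _ /imfsetP[a /= aA ->].
    by rewrite leq_subLR addnC -hy0; apply: fib_ge => //; apply: dA.
  have : (2 * D <= M)%N.
    by apply: leq_trans RM; apply: leq_trans hbD; clear -b1 L0; case: L L0 => // L _; rewrite mulnS; nia.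
  by move: h hP; move: #|` TA| #|` P'|; clear; nia.
pose A1 := [fset a in A | (M <= L * fib U A (modv U a))%N].
have sA1 : A1 `<=` A by apply/fsubsetP => a; rewrite !inE => /andP[].
have fA1 a : a \in A1 -> fib U A1 (modv U a) = fib U A (modv U a).
  move=> aA1; rewrite /fib -!card_fset_filter; congr #|` _|.
  apply/fsetP => x; rewrite !inE /=; case: eqP => [->|_]; rewrite ?andbF // !andbT.
  by move: aA1; rewrite !inE => /andP[_ ->]; rewrite andbT.
have hA1 : (#|` A| <= #|` A1| + rho)%N.
  have -> : #|` A1| = count (fun a => (M <= L * fib U A (modv U a))%N) A by exact: card_fset_filter.
  rewrite -(count_predC (fun a => (M <= L * fib U A (modv U a))%N) A) leq_add2l.
  set c := count _ _; suff : (L * c <= L * rho)%N by rewrite leq_pmul2l.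
  apply: leq_trans (leq_trans hTA hL).
  have -> : (c = \sum_(x <- TA | (L * fib U A x < M)%N) fib U A x)%N.
    rewrite -big_filter sum_count_fibers_eq ?filter_uniq ?fset_uniq //.
    apply: eq_in_count => a aA /=; rewrite -ltnNge mem_filter.
    by rewrite mem_modf // andbT.
  rewrite big_distrr /= big_mkcond /= mulnC -sum1_size big_distrr /=.
  apply: leq_sum => x _; rewrite muln1; case: ifP => // /ltnW //.
have cA1 : (k - rho <= #|` A1|)%N by move: hA1 kA; move: #|` A| #|` A1|; clear; lia.
have A1nz : A1 != fset0 by rewrite -cardfs_gt0; move: cA1 kr; clear; lia.
have Bnz : B != fset0 by rewrite -cardfs_gt0; move: kB kr; clear; lia.
pose e := \dim (Dsp (modf U A1) + Dsp (modf U B)).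
have hc : (b.-1 * (2 * e.+2 * (k - rho) - e.+1 * e.+2) +
    2 * b * (u.-1 * (#|` A1| - #|` modf U A1| * (2 * (D + R)).+1))
   <= 4 * b * #|` P `&` sumv A1 B|)%N.
  apply: (@core _ A1 B P U D M R L b u (k - rho) y0) => //; try by [exact: ltnW|exact: leq_trans RM].
  - by move=> x; apply: leq_trans (mA x); apply: fib_sub.
  - by move=> a aA; rewrite fA1 //; move: aA; rewrite !inE => /andP[].
  - by move=> W v dW; apply: leq_trans (lA W v dW); apply: count_fset_sub.
  - by move=> a /(fsubsetP sA1)/dA.
  - by move=> c /dB; apply: leq_trans; apply: count_fset_sub.
  - by apply: leq_trans kB; exact: leq_subr.
have de : (d <= e + \dim U)%N.
  apply: leq_trans (rob A1 sA1 hA1) _.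
  apply: (@leq_trans (\dim (Dsp (modf U A1) + Dsp (modf U B) + U))); last first.
    by have [] := dimv_add_leqif (Dsp (modf U A1) + Dsp (modf U B)) U.
  have sp (C : {fset vT}) : C != fset0 -> (Dsp C <= Dsp (modf U C) + U)%VS.
    move=> /fset0Pn[c0 c0C]; apply: (@Dsp_sub _ _ _ c0) => c cC.
    rewrite -[X in X \in _](subrK (modv U c - modv U c0)) addrC.
    apply: memv_add; first by apply: mem_Dsp; apply: mem_modf.
    exact: modv_diff.
  apply: dimvS; rewrite subv_add; apply/andP; split.
    by apply: subv_trans (sp _ A1nz) _; rewrite addvS // addvSl.
  by apply: subv_trans (sp _ Bnz) _; rewrite addvS // addvSr.
have ed : (e.+1 <= rho)%N.
  apply: leq_trans hd; rewrite ltnS mul2n -addnn.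
  apply: (@leq_trans (\dim (Dsp A + Dsp B + U))); last first.
    have [h _] := dimv_add_leqif (Dsp A + Dsp B) U.
    by apply: leq_trans h _; rewrite leq_add2l.
  have sp (C : {fset vT}) : (Dsp C <= Dsp A + Dsp B)%VS -> (Dsp (modf U C) <= Dsp A + Dsp B + U)%VS.
    move=> sC; apply/span_subvP => v /allpairsP[[x y] /= [/imfsetP[c /= cC ->] /imfsetP[c' /= c'C ->] ->]].
    rewrite -[X in X \in _](subrK (c - c')) addrC.
    apply: memv_add; first by apply: (subvP sC); apply: mem_Dsp.
    by rewrite -memvN opprB modv_diff.
  apply: dimvS; rewrite subv_add !sp ?addvSr //.
  by apply: subv_trans (addvSl _ _); apply: DspS.
have hl : (#|` modf U A1| * (2 * (D + R)).+1 <= rho)%N.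
  have h1 : (#|` modf U A1| <= #|` TA|)%N.
    by apply: fsubset_leq_card; apply/fsubsetP => _ /imfsetP[a /= /(fsubsetP sA1) aA ->]; apply: mem_modf.
  have hM : (0 < M)%N by apply: ltnW.
  rewrite -(leq_pmul2r hM); apply: leq_trans (_ : rho * R' <= _)%N; last by rewrite leq_mul2l RM orbT.
  apply: leq_trans hT; rewrite mulnAC mulnC leq_mul2l /=.
  by apply: leq_trans hTA; rewrite leq_mul2r h1 orbT.
have sP : (#|` P `&` sumv A1 B| <= #|` P'|)%N by apply: fsubset_leq_card; rewrite fsetIS // sumvS.
move: hc; set q := (k - 2 * rho)%N.
have e1 : (2 * (e.+2 * q) <= 2 * e.+2 * (k - rho) - e.+1 * e.+2)%N.
  have h : (2 * q + e.+1 <= 2 * (k - rho))%N by rewrite /q; move: ed kr; clear; lia.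
  have : (e.+2 * (2 * q + e.+1) <= e.+2 * (2 * (k - rho)))%N by rewrite leq_mul2l h orbT.
  rewrite mulnDr mulnCA [(e.+2 * e.+1)%N]mulnC [leqRHS]mulnCA [leqRHS]mulnA.
  by move: (2 * e.+2 * (k - rho))%N (2 * (e.+2 * q))%N (e.+1 * _)%N => x y z; clear; lia.
have e2 : (q <= #|` A1| - #|` modf U A1| * (2 * (D + R)).+1)%N.
  by rewrite /q; move: hl cA1 kr; move: #|` A1| (_ * (2 * (D + R)).+1)%N; clear; lia.
have e3 : (b.-1 * (2 * (e.+2 * q)) <= b.-1 * (2 * e.+2 * (k - rho) - e.+1 * e.+2))%N.
  by rewrite leq_mul2l e1 orbT.
have e4 : (b.-1 * (u.-1 * q) <= b * (u.-1 * (#|` A1| - #|` modf U A1| * (2 * (D + R)).+1)))%N.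
  by rewrite leq_mul ?leq_pred // leq_mul2l e2 orbT.
move: e3 e4; set x1 := (b.-1 * _)%N; set x2 := (b.-1 * (u.-1 * q))%N.
set x3 := (b.-1 * _)%N; rewrite -[(2 * b * _)%N]mulnA; set x4 := (b * (u.-1 * _))%N => e3 e4 hc.
have e5 : (b.-1 * (d - \dim U + 1 + u) * q <= b.-1 * (e.+2 * q) + x2)%N.
  rewrite /x2 -mulnDr -mulnDl -mulnA leq_mul2l leq_mul2r; apply/orP; right; apply/orP; right.
  by move: de Ud u0; clear; lia.
have e6 : x1 = (2 * (b.-1 * (e.+2 * q)))%N by rewrite /x1; clear; lia.
have e7 : (4 * b * #|` P `&` sumv A1 B| <= 4 * (b * #|` P'|))%N by rewrite -mulnA !leq_mul2l sP !orbT.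
rewrite -[(2 * b * _)%N]mulnA; move: e3 e4 hc e5 e6 e7.
move: x1 x2 x3 x4 (b * #|` P'|)%N (4 * b * _)%N (b.-1 * (e.+2 * q))%N (b.-1 * _ * q)%N.
by clear; lia.
Qed.

Lemma fib_max U A : A != fset0 -> exists x, forall y, (fib U A y <= fib U A x)%N.
Proof.
move=> /fset0Pn[a aA]; have : modf U A != fset0.
  by apply/fset0Pn; exists (modv U a); apply: mem_modf.
case/(fset_argmax (fun x => (fib U A x)%:R)) => x _ h; exists x => y.
have [y0|] := posnP (fib U A y); first by rewrite y0.
rewrite -has_count => /hasP[c cA /eqP ey].
by have := h y; rewrite ler_nat; apply; rewrite -ey; apply: mem_modf.
Qed.

Definition heavy r U A B := exists v : vT,
  (r <= count (fun a => (a - v \in U)%R) A)%N \/ (r <= count (fun a => (a - v \in U)%R) B)%N.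

(** By symmetry, whichever set has the largest fibre over the quotient by U plays the role of B in
    [robust_half]. *)
Lemma robust_step A B P U D R R' L b u k T rho :
  let d := \dim (Dsp A + Dsp B) in
  (1 < b)%N -> (0 < L)%N -> (1 < R')%N -> (b * D * L <= R')%N ->
  ((2 * (D + R)).+1 * (2 * T) <= rho * R')%N -> (2 * T <= L * rho)%N ->
  (0 < u)%N -> (0 < \dim U)%N -> (\dim U <= d)%N -> ((2 * d).+1 <= rho)%N ->
  heavy R' U A B -> (forall W, (\dim W < u)%N -> ~ heavy R.+1 W A B) ->
  (forall a, a \in A -> (count (fun b => (a + b)%R \notin P) B <= D)%N) ->
  (forall b, b \in B -> (count (fun a => (b + a)%R \notin P) A <= D)%N) ->
  A != fset0 -> B != fset0 ->
  (k <= #|` A|)%N -> (k <= #|` B|)%N -> (#|` P `&` sumv A B| <= T)%N ->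
  (forall A1 B1, A1 `<=` A -> B1 `<=` B -> (#|` A| <= #|` A1| + rho)%N ->
     (#|` B| <= #|` B1| + rho)%N -> (d <= \dim (Dsp A1 + Dsp B1))%N) ->
  (b.-1 * (d - \dim U + 1 + u) * (k - 2 * rho) <= 2 * b * #|` P `&` sumv A B|)%N.
Proof.
move=> d b1 L0 R1 hbD hT hL u0 U0 Ud hd hv nhv dA dB A0 B0 kA kB hP rob.
have lA W (v : vT) : (\dim W < u)%N -> (count (fun a => (a - v \in W)%R) A <= R)%N.
  by move=> /nhv h; rewrite leqNgt; apply/negP => lt; apply: h; exists v; left.
have lB W (v : vT) : (\dim W < u)%N -> (count (fun a => (a - v \in W)%R) B <= R)%N.
  by move=> /nhv h; rewrite leqNgt; apply/negP => lt; apply: h; exists v; right.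
have [x0 hx0] := fib_max U A0; have [y0 hy0] := fib_max U B0.
have hM : (R' <= maxn (fib U A x0) (fib U B y0))%N.
  case: hv => v [] h; rewrite leq_max; apply/orP; [left|right].
    by apply: leq_trans (hx0 (modv U v)); rewrite fibE.
  by apply: leq_trans (hy0 (modv U v)); rewrite fibE.
have [le|/ltnW le] := leqP (fib U A x0) (fib U B y0).
  rewrite (maxn_idPr le) in hM.
  apply: (@robust_half A B P U D (fib U B y0) R R' L b u k T rho y0) => //.
    by move=> x; apply: leq_trans le; apply: hx0.
  by move=> A1 sA hA; apply: rob => //; rewrite leq_addr.
rewrite (maxn_idPl le) in hM; rewrite sumvC in hP *.
have ed : \dim (Dsp B + Dsp A) = d by rewrite addvC.
rewrite -ed; apply: (@robust_half B A P U D (fib U A x0) R R' L b u k T rho x0) => //; rewrite ?ed //.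
  by move=> x; apply: leq_trans le; apply: hy0.
by move=> A1 sA hA; rewrite addvC; apply: rob => //; rewrite leq_addr.
Qed.

Lemma min_heavy A B r U0 : heavy r U0 A B -> exists U, heavy r U A B /\
  forall W, heavy r W A B -> (\dim U <= \dim W)%N.
Proof.
have [n] := ubnP (\dim U0); elim: n U0 => // n IH U0 hn h0.
have [[W [hW dW]]|no] := pselect (exists W, heavy r W A B /\ (\dim W < \dim U0)%N).
  by apply: (IH W) hW; lia.
exists U0; split => // W hW; rewrite leqNgt; apply/negP => lt; apply: no.
by exists W.
Qed.

(* Four thresholds leave three gaps between the least dimensions of subspaces with a
   heavy coset; one of the gaps is at most (d - 1) / 3. *)
Lemma robust_popular A B P D (R : nat -> nat) L b k T rho :
  let d := \dim (Dsp A + Dsp B) in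
  (1 < b)%N -> (0 < L)%N -> (0 < d)%N -> (1 < R 0%N)%N -> {homo R : i j / (i <= j)%N} ->
  (forall i, b * D * L <= R i.+1)%N ->
  (forall i, (2 * (D + R i)).+1 * (2 * T) <= rho * R i.+1)%N -> (2 * T <= L * rho)%N ->
  ((2 * d).+1 <= rho)%N -> (R 3 < k)%N ->
  (forall a, a \in A -> (count (fun b => (a + b)%R \notin P) B <= D)%N) ->
  (forall b, b \in B -> (count (fun a => (b + a)%R \notin P) A <= D)%N) ->
  (k <= #|` A|)%N -> (k <= #|` B|)%N -> (#|` P `&` sumv A B| <= T)%N ->
  (forall A1 B1, A1 `<=` A -> B1 `<=` B -> (#|` A| <= #|` A1| + rho)%N ->
     (#|` B| <= #|` B1| + rho)%N -> (d <= \dim (Dsp A1 + Dsp B1))%N) ->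
  (b.-1 * d.+2 * (k - 2 * rho) <= 3 * b * #|` P `&` sumv A B|)%N.
Proof.
move=> d b1 L0 d0 R0 Rm hbD hT hL hd R3 dA dB kA kB hP rob.
have A0 : A != fset0 by rewrite -cardfs_gt0; apply: leq_trans kA; apply: leq_trans R3.
have B0 : B != fset0 by rewrite -cardfs_gt0; apply: leq_trans kB; apply: leq_trans R3.
have /fset0Pn[a0 a0A] := A0.
have hfull i : (i <= 3)%N -> heavy (R i).+1 (Dsp A + Dsp B)%VS A B.
  move=> i3; exists a0; left; rewrite -fibE.
  have -> : fib (Dsp A + Dsp B) A (modv (Dsp A + Dsp B) a0) = #|` A|.
    rewrite fibE; apply/eqP; rewrite -all_count; apply/allP => a aA.
    by apply: (subvP (addvSl _ _)); apply: mem_Dsp.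
  by apply: leq_trans kA; apply: leq_trans R3; rewrite ltnS; apply: Rm.
have [U0 [h0 m0]] := min_heavy (hfull 0%N isT).
have [U1 [h1 m1]] := min_heavy (hfull 1%N isT).
have [U2 [h2 m2]] := min_heavy (hfull 2%N isT).
have [U3 [h3 m3]] := min_heavy (hfull 3%N isT).
have mono i j U : (i <= j)%N -> heavy (R j).+1 U A B -> heavy (R i).+1 U A B.
  by move=> ij [v h]; exists v; case: h => h; [left|right]; apply: leq_trans h; rewrite ltnS; apply: Rm.
have u01 : (\dim U0 <= \dim U1)%N by apply: m0; apply: (mono _ 1%N).
have u12 : (\dim U1 <= \dim U2)%N by apply: m1; apply: (mono _ 2%N).
have u23 : (\dim U2 <= \dim U3)%N by apply: m2; apply: (mono _ 3%N).
have u3d : (\dim U3 <= d)%N by apply: m3; apply: hfull.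
(* A coset of the zero space is a single point, and the thresholds exceed 1. *)
have u0 : (0 < \dim U0)%N.
  rewrite lt0n dimv_eq0; apply/eqP => e; case: h0 => v; rewrite e.
  have cnt (C : {fset vT}) : (count (fun a => (a - v \in 0%VS)%R) C <= 1)%N.
    rewrite (@eq_count _ _ (pred1 v)); last by move=> a /=; rewrite memv0 subr_eq0.
    by rewrite count_uniq_mem ?fset_uniq // leq_b1.
  by case=> h; have := leq_trans h (cnt _); rewrite ltnS leqNgt ltnW.
have step i U U' : heavy (R i.+1).+1 U' A B ->
   (forall W, heavy (R i).+1 W A B -> (\dim U <= \dim W)%N) ->
   (0 < \dim U)%N -> (\dim U <= \dim U')%N -> (\dim U' <= d)%N ->
   (b.-1 * (d - \dim U' + 1 + \dim U) * (k - 2 * rho) <= 2 * b * #|` P `&` sumv A B|)%N.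
  move=> hU' mU U_0 UU' U'd.
  apply: (@robust_step A B P U' D (R i) (R i.+1) L b (\dim U) k T rho) => //.
  - by apply: leq_trans R0 _; apply: Rm.
  - exact: leq_trans UU'.
  - by case: hU' => v h; exists v; case: h => /ltnW h; [left|right].
  - by move=> W dW /mU; rewrite leqNgt dW.
(* A gap with 3 (u' - u) <= d - 1 gives 3 (d - u' + 1 + u) >= 3 d + 3 - (d - 1) = 2 (d + 2). *)
have fin u' u : (b.-1 * (d - u' + 1 + u) * (k - 2 * rho) <= 2 * b * #|` P `&` sumv A B|)%N ->
    (2 * d.+2 <= 3 * (d - u' + 1 + u))%N -> (b.-1 * d.+2 * (k - 2 * rho) <= 3 * b * #|` P `&` sumv A B|)%N.
  move: (d - u' + 1 + u)%N (k - 2 * rho)%N #|` _| => x q p hx1 hx2.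
  have hx3 : (b.-1 * (2 * d.+2) * q <= b.-1 * (3 * x) * q)%N.
    by rewrite leq_mul2r leq_mul2l hx2 !orbT.
  move: hx1 hx3; rewrite [(b.-1 * (2 * _))%N]mulnCA [(b.-1 * (3 * _))%N]mulnCA -!mulnA.
  by move: (b.-1 * (d.+2 * q))%N (b.-1 * (x * q))%N (b * p)%N; clear; lia.
have u1d : (\dim U1 <= d)%N by apply: leq_trans u12 (leq_trans u23 u3d).
have u2d : (\dim U2 <= d)%N by apply: leq_trans u23 u3d.
have [l1|g1] := leqP (3 * (\dim U1 - \dim U0)) d.-1.
  apply: (fin _ _ (step 0%N U0 U1 h1 m0 u0 u01 u1d)).
  by move: l1 d0 u01 u1d; clear; lia.
have [l2|g2] := leqP (3 * (\dim U2 - \dim U1)) d.-1.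
  apply: (fin _ _ (step 1%N U1 U2 h2 m1 (leq_trans u0 u01) u12 u2d)).
  by move: l2 d0 u12 u2d; clear; lia.
apply: (fin _ _ (step 2%N U2 U3 h3 m2 (leq_trans u0 (leq_trans u01 u12)) u23 u3d)).
by move: g1 g2 u0 u3d d0 u01 u12 u23; clear; lia.
Qed.
End Robust.

(** * Sampling the popular sums *)

Local Open Scope nat_scope.

Section Hitting.
Variables (T I : eqType) (V : seq T) (S : I -> pred T).
Implicit Types (Z : seq I) (H : seq T).

Lemma sum_count_swap Z :
  \sum_(v <- V) count (S^~ v) Z = \sum_(z <- Z) count (S z) V.
Proof.
rewrite (eq_bigr (fun v => \sum_(z <- Z) S z v)); last first.
  by move=> v _; rewrite -sum1_count big_mkcond /=; apply: eq_bigr => z _; case: (S z v).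
rewrite exchange_big; apply: eq_bigr => z _.
by rewrite -sum1_count [RHS]big_mkcond /=; apply: eq_bigr => v _; case: (S z v).
Qed.

Lemma hit_one Z R : 0 < R -> (forall z, z \in Z -> R <= count (S z) V) -> Z != [::] ->
  exists2 v, v \in V & R * size Z <= size V * count (S^~ v) Z.
Proof.
move=> R0 hS Z0; have hsum : R * size Z <= \sum_(v <- V) count (S^~ v) Z.
  rewrite sum_count_swap mulnC -sum1_size big_distrl /= big_seq [leqRHS]big_seq.
  by apply: leq_sum => z /hS; rewrite mul1n.
have [/hasP[v vV hv]|/hasPn no] := boolP (has (fun v => R * size Z <= size V * count (S^~ v) Z) V).
  by exists v.
have V0 : 0 < size V.
  case: (V) hsum => //; rewrite big_nil; case: Z Z0 {hS no} => //= z Z _; lia.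
have hs : \sum_(v <- V) (size V * count (S^~ v) Z + 1) <= \sum_(v <- V) R * size Z.
  rewrite big_seq [leqRHS]big_seq; apply: leq_sum => v /no.
  by rewrite -ltnNge addn1.
move: hs; rewrite big_split /= -big_distrr /= sum1_size big_const_seq count_predT iter_addn_0.
rewrite [_ * size V]mulnC; have := leq_mul (leqnn (size V)) hsum.
by move=> h1 h2; exfalso; move: V0 h1 h2; move: (size V) (size V * _) (size V * (R * _)) => x y z; clear; lia.
Qed.

(* While more than half of Z is unhit, one more element hits at least |Z| R / (2 |V|) of it. *)
Lemma hit_half Z R : 0 < R -> (forall z, z \in Z -> R <= count (S z) V) ->
  exists H, [/\ {subset H <= V}, size H <= (size V %/ R).+1 &
    2 * count (fun z => ~~ has (S z) H) Z <= size Z].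
Proof.
move=> R0 hS.
suff [H [sH cH [h|h]]] : exists H, [/\ {subset H <= V}, size H <= (size V %/ R).+1 &
    2 * count (fun z => ~~ has (S z) H) Z <= size Z \/
    (size V %/ R).+1 * R * size Z <= 2 * size V * count (fun z => has (S z) H) Z].
- by exists H.
- exists H; split => //.
  have := count_predC (fun z => has (S z) H) Z; rewrite /predC /=.
  set c := count _ _; set c' := count _ _ => hc.
  have [Z0|Z0] := posnP (size Z); first by lia.
  have h2 : size V < (size V %/ R).+1 * R by rewrite ltn_ceil.
  have h3 : size V * size Z < 2 * size V * c.
    by apply: leq_trans h; rewrite ltn_mul2r Z0.
  suff : size Z <= 2 * c by move: hc; clear; lia.
  rewrite leqNgt; apply/negP => lt; have := leq_mul (leqnn (size V)) (ltnW lt).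
  by rewrite mulnCA mulnA leqNgt h3.
elim: (size V %/ R).+1 => [|t [H [sH cH h]]]; first by exists [::]; split => //; right.
case: h => h; first by exists H; split => //; [exact: leqW | left].
pose U := [seq z <- Z | ~~ has (S z) H].
have [U0|U0] := eqVneq U [::].
  exists H; split => //; [exact: leqW | left].
  by rewrite -size_filter -/U U0 /= muln0.
have [le|gt] := leqP (2 * count (fun z => ~~ has (S z) H) Z) (size Z).
  by exists H; split => //; [exact: leqW | left].
have [|v vV hv] := @hit_one U R R0 _ U0.
  by move=> z; rewrite mem_filter => /andP[_ /hS].
exists (v :: H); split => //.
- by move=> x; rewrite inE => /orP[/eqP ->|/sH].
right; rewrite (_ : count _ Z = count (fun z => has (S z) H) Z + count (S^~ v) U); last first.
  rewrite /U count_filter -count_predUI [X in _ = _ + X](@eq_count _ _ pred0).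
    rewrite count_pred0 addn0; apply: eq_count => z /=.
    by case: (has _ H); rewrite ?orbT ?andbT ?orbF ?andbF.
  by move=> z /=; case: (has _ H); rewrite ?andbF.
rewrite mulnDr mulSn mulnDl addnC leq_add //.
rewrite -mulnA; apply: leq_trans (_ : 2 * (R * size U) <= _); last by rewrite leq_mul2l hv.
by rewrite mulnCA leq_mul2l size_filter ltnW ?orbT.
Qed.

(** Each use of [hit_half] leaves at most half of Z unhit, so l rounds exhaust fewer than 2^l
    elements. *)
Lemma hit_all Z R l : 0 < R -> (forall z, z \in Z -> R <= count (S z) V) ->
  size Z < 2 ^ l ->
  exists H, [/\ {subset H <= V}, size H <= l * (size V %/ R).+1 &
    forall z, z \in Z -> has (S z) H].
Proof.
move=> R0; elim: l Z => [|l IH] Z hS hZ.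
  by exists [::]; split => //; case: Z hS hZ.
have [H [sH cH h]] := hit_half R0 hS.
have [||H' [sH' cH' h']] := IH [seq z <- Z | ~~ has (S z) H].
- by move=> z; rewrite mem_filter => /andP[_ /hS].
- by rewrite size_filter; move: hZ; rewrite expnS; move: h; clear; lia.
exists (H ++ H'); split => //.
- by move=> x; rewrite mem_cat => /orP[/sH|/sH'].
- by rewrite size_cat mulSn leq_add.
- move=> z zZ; rewrite has_cat; have [//|nh] := boolP (has (S z) H).
  by rewrite h' // mem_filter nh.
Qed.

End Hitting.

(** One round for each required hit. An element hit exactly c times so far has at least R further
    candidates outside H, which is why R + c is asked for. *)
Lemma hit_many (T I : eqType) (V : seq T) (S : I -> pred T) (Z : seq I) R l c :
  uniq V -> 0 < R -> (forall z, z \in Z -> R + c <= count (S z) V) -> size Z < 2 ^ l ->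
  exists H, [/\ uniq H, {subset H <= V}, size H <= c * (l * (size V %/ R).+1) &
    forall z, z \in Z -> c <= count (S z) H].
Proof.
move=> uV R0; elim: c => [|c IH] hS hZ; first by exists [::]; split.
have [|H [uH sH cH h]] := IH _ hZ.
  by move=> z /hS; apply: leq_trans; rewrite addnS.
pose S' z := predI (S z) (predC (mem H)).
pose Z' := [seq z <- Z | count (S z) H == c].
have [||H' [sH' cH' h']] := @hit_all T I V S' Z' R l R0.
- move=> z; rewrite mem_filter => /andP[/eqP hc /hS].
  have : count (S z) V <= count (S' z) V + count (S z) H.
    rewrite -[count (S z) V]size_filter -(count_predC (mem H) [seq v <- V | S z v]) addnC.
    rewrite leq_add //.
      by rewrite count_filter; apply: sub_count => v /= /andP[nH Sv]; rewrite Sv.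
    rewrite -size_filter -[leqRHS]size_filter; apply: uniq_leq_size.
      by rewrite !filter_uniq.
    move=> v; rewrite !mem_filter => /and3P[nH Sv vV].
    by rewrite /= Sv.
  by rewrite hc; lia.
- by apply: leq_ltn_trans hZ; rewrite size_filter count_size.
exists (H ++ [seq v <- undup H' | v \notin H]); split.
- rewrite cat_uniq uH filter_uniq ?undup_uniq // andbT.
  by apply/hasPn => v; rewrite mem_filter => /andP[].
- by move=> x; rewrite mem_cat mem_filter mem_undup => /orP[/sH|/andP[_ /sH']].
- rewrite size_cat mulSn addnC leq_add //; apply: leq_trans cH'.
  by rewrite size_filter (leq_trans (count_size _ _)) // size_undup.
- move=> z zZ; rewrite count_cat.
  have := h z zZ; rewrite leq_eqVlt => /orP[/eqP e|lt]; last by rewrite (leq_trans lt) // leq_addr.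
  have /h'/hasP[v vH' /andP[/= Sv nv]] : z \in Z' by rewrite mem_filter -e eqxx.
  rewrite -e -addn1 leq_add2l -has_count; apply/hasP; exists v => //.
  by rewrite mem_filter mem_undup vH' nv.
Qed.

Section Sample.
Local Open Scope fset_scope.
Local Open Scope nat_scope.
Variables (T T3 : choiceType) (f : T -> T -> T3).
Hypothesis injl : forall b, injective (f^~ b).
Hypothesis injr : forall a, injective (f a).
Implicit Types (A B X Y : {fset T}) (Z P : {fset T3}).

Definition fsum A B : {fset T3} := [fset f a b | a in A, b in B].
(** The number of representations of z: its pairs are counted by their first entries, which
    determine them once [f a] is injective. *)
Definition reps A B z := count (fun a => has (fun b => f a b == z) B) A.
Definition popular R A B := [fset z in fsum A B | R <= reps A B z].

Lemma fsumP A B z :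
  reflect (exists a b, [/\ a \in A, b \in B & z = f a b]) (z \in fsum A B).
Proof.
apply: (iffP idP) => [/imfset2P[a aA [b bB ->]]|[a [b [aA bB ->]]]].
  by exists a, b.
exact: in_imfset2.
Qed.

Lemma count_le1 (S : {fset T}) (g : T -> T3) z : injective g ->
  count (fun b => g b == z) S = has (fun b => g b == z) S.
Proof.
move=> gi; have [/hasP[b bS /eqP e]|no] := boolP (has _ S); last by apply/eqP; rewrite -leqn0 leqNgt -has_count.
rewrite (@eq_count _ _ (pred1 b)); last by move=> x /=; rewrite -e (inj_eq gi).
by rewrite count_uniq_mem ?fset_uniq // bS.
Qed.

Lemma reps_sum A B z : reps A B z = \sum_(a <- A) count (fun b => f a b == z) B.
Proof.
rewrite /reps -sum1_count big_mkcond /=; apply: eq_bigr => a _.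
by rewrite (count_le1 _ _ (@injr a)); case: (has _ _).
Qed.

Lemma reps_swap A B z : reps A B z = count (fun b => has (fun a => f a b == z) A) B.
Proof.
rewrite reps_sum; rewrite (sum_count_swap A (fun b a => f a b == z) B).
rewrite -[RHS]sum1_count [RHS]big_mkcond /=; apply: eq_bigr => b _.
by rewrite (count_le1 _ _ (@injl b)); case: (has _ _).
Qed.

(** A representation needs both of its entries in the sample, so there are two stages: X is chosen
    so that every z keeps C representations starting in X, and then Y hits their second entries. *)
Lemma sample A B Z R C l : 0 < R -> 0 < C ->
  (forall z, z \in Z -> R + C <= reps A B z) -> #|` Z| < 2 ^ l ->
  exists X Y, [/\ X `<=` A, Y `<=` B, #|` X| <= C * (l * (#|` A| %/ R).+1),
    #|` Y| <= l * (#|` B| %/ C).+1 & Z `<=` fsum X Y].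
Proof.
move=> R0 C0 hZ lZ.
have [H [uH sH cH hH]] := hit_many (fset_uniq A) R0 hZ lZ.
pose X := [fset x in H]; have sX : X `<=` A by apply/fsubsetP => x; rewrite !inE => /sH.
have cX : #|` X| = size H by rewrite card_fseq undup_id.
have hX z : z \in Z -> C <= reps X B z.
  move=> /hH; rewrite /reps -!size_filter => h; apply: leq_trans h _.
  apply: uniq_leq_size; first exact: filter_uniq.
  by move=> x; rewrite !mem_filter !inE.
have [|H' [sH' cH' hH']] := @hit_all _ _ B (fun z b => has (fun a => f a b == z) X) Z C l C0 _ lZ.
  by move=> z /hX; rewrite reps_swap.
exists X, [fset y in H']; split => //; rewrite ?cX //.
- by apply/fsubsetP => x; rewrite !inE => /sH'.
- by apply: leq_trans cH'; rewrite card_fseq size_undup.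
- apply/fsubsetP => z /hH'/hasP[b bH /hasP[a aX /eqP <-]].
  by apply/fsumP; exists a, b; split => //; rewrite inE.
Qed.

Lemma unpopular A B R :
  \sum_(a <- A) count (fun b => f a b \notin popular R A B) B <= R * #|` fsum A B|.
Proof.
pose Z := fsum A B `\` popular R A B.
have -> : \sum_(a <- A) count (fun b => f a b \notin popular R A B) B = \sum_(z <- Z) reps A B z.
  transitivity (\sum_(z <- Z) \sum_(a <- A) count (fun b => f a b == z) B); last first.
    by apply: eq_bigr => z _; rewrite reps_sum.
  rewrite exchange_big /= !big_seq; apply: eq_bigr => a aA.
  rewrite sum_count_fibers_eq ?fset_uniq //; apply: eq_in_count => b bB /=.
  by rewrite in_fsetD (_ : f a b \in fsum A B) ?andbT //; apply: in_imfset2.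
apply: leq_trans (_ : \sum_(z <- Z) R <= _).
  rewrite big_seq [leqRHS]big_seq; apply: leq_sum => z.
  rewrite !inE => /andP[+ zs]; rewrite zs /= -ltnNge; exact: ltnW.
rewrite big_const_seq count_predT iter_addn_0 leq_mul2l; apply/orP; right.
by apply: fsubset_leq_card; apply: fsubsetDl.
Qed.

Lemma markov (S : {fset T}) (g : T -> nat) D :
  #|` [fset a in S | D < g a]| * D <= \sum_(a <- S) g a.
Proof.
rewrite card_fset_filter mulnC -sum1_count big_distrr /= big_mkcond /=.
by apply: leq_sum => a _; case: ifP => // /ltnW; rewrite muln1.
Qed.

End Sample.

Section SampleSwap.
Local Open Scope fset_scope.
Local Open Scope nat_scope.
Variables (T T3 : choiceType) (f : T -> T -> T3).
Hypothesis injl : forall b, injective (f^~ b).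
Hypothesis injr : forall a, injective (f a).
Implicit Types (A B X Y : {fset T}).

Lemma fsum_swap A B : fsum (fun b a => f a b) B A = fsum f A B.
Proof.
by apply/fsetP => z; apply/fsumP/fsumP => -[a [b [? ? ->]]]; exists b, a.
Qed.

Lemma popular_swap A B R : popular (fun b a => f a b) R B A = popular f R A B.
Proof.
apply/fsetP => z; rewrite !inE fsum_swap; congr (_ && (_ <= _)).
by rewrite (reps_swap injl injr).
Qed.

Definition goodl R D A B := [fset a in A | count (fun b => f a b \notin popular f R A B) B <= D].
Definition goodr R D A B := [fset b in B | count (fun a => f a b \notin popular f R A B) A <= D].

Lemma card_goodl R D A B : #|` A| * D <= #|` goodl R D A B| * D + R * #|` fsum f A B|.
Proof.
apply: leq_trans (leq_add (leqnn _) (unpopular injr A B R)).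
apply: leq_trans (leq_add (leqnn _) (markov A _ D)).
rewrite -mulnDl leq_mul2r; apply/orP; right; rewrite !card_fset_filter.
by rewrite -(count_predC (fun a => count (fun b => f a b \notin popular f R A B) B <= D) A)
  leq_add2l; apply: sub_count => a /=; rewrite -ltnNge.
Qed.

Lemma card_goodr R D A B : #|` B| * D <= #|` goodr R D A B| * D + R * #|` fsum f A B|.
Proof.
rewrite -fsum_swap; apply: leq_trans (leq_add (leqnn _) (unpopular injl B A R)).
apply: leq_trans (leq_add (leqnn _) (markov B _ D)).
rewrite -mulnDl leq_mul2r; apply/orP; right; rewrite !card_fset_filter popular_swap.
by rewrite -(count_predC (fun b => count (fun a => f a b \notin popular f R A B) A <= D) B)
  leq_add2l; apply: sub_count => a /=; rewrite -ltnNge.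
Qed.
End SampleSwap.

Local Open Scope ring_scope.

(** * Homomorphisms and realizations *)

Section Subspaces.
Variable vT : vectType rat.

Lemma islin_span (f : vT -> rat) (s : seq vT) : islin f ->
  (forall u, u \in s -> f u = 0) -> forall v, v \in << s >>%VS -> f v = 0.
Proof.
move=> lf; elim: s => [|x s IH] h v.
  by rewrite span_nil memv0 => /eqP ->; apply: islin0.
rewrite span_cons => /memv_addP[_ /vlineP[k ->] [u us ->]].
rewrite islinD // islinZ // h ?inE ?eqxx // mulr0 add0r; apply: IH us.
by move=> y ys; apply: h; rewrite inE ys orbT.
Qed.

(** The basis is returned as a list of indices, not of vectors, since certificates store labels and
    relations themselves. *)
Lemma basis_subseq (T : eqType) (g : T -> vT) (L : seq T) : exists t,
  [/\ {subset t <= L}, (size t <= \dim << map g L >>)%N &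
      forall x, x \in L -> g x \in << map g t >>%VS].
Proof.
elim: L => [|x L [t [st ct ht]]]; first by exists [::].
have [xi|xi] := boolP (g x \in << map g L >>%VS).
  exists t; split.
  - by move=> y /st; rewrite inE orbC => ->.
  - by apply: leq_trans ct _; apply: dimvS; rewrite /= span_cons addvSr.
  - move=> y; rewrite inE => /orP[/eqP ->|/ht//].
    by apply: (subvP _ _ xi); apply/span_subvP => _ /mapP[z zL ->]; apply: ht.
exists (x :: t); split.
- by move=> y; rewrite !inE => /orP[->//|/st ->]; rewrite orbT.
- rewrite /= span_cons; apply: leq_ltn_trans ct _.
  rewrite ltn_neqAle dimvS ?addvSr // andbT; apply: contra xi => /eqP e.
  have /eqP -> : << map g L >>%VS == (<[g x]> + << map g L >>)%VS by rewrite eqEdim addvSr e leqnn.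
  by apply: (subvP (addvSl _ _)); apply: memv_line.
- move=> y; rewrite inE /= span_cons => /orP[/eqP ->|/ht h].
    by apply: (subvP (addvSl _ _)); apply: memv_line.
  exact: (subvP (addvSr _ _)).
Qed.

Lemma subspace_ex (P : vT -> Prop) : P 0 ->
  (forall a u v, P u -> P v -> P (a *: u + v)) ->
  exists U : {vspace vT}, forall v, v \in U <-> P v.
Proof.
move=> P0 Pl.
suff H n (U : {vspace vT}) : (forall v, v \in U -> P v) -> (\dim (fullv : {vspace vT}) - \dim U <= n)%N ->
    exists U' : {vspace vT}, forall v, v \in U' <-> P v.
  by apply: (H _ 0%VS _ (leqnn _)) => v; rewrite memv0 => /eqP ->.
elim: n U => [|n IH] U UP hd.
  exists U => v; split; first exact: UP.
  suff /eqP -> : U == fullv by rewrite memvf.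
  by rewrite eqEdim subvf; move: hd; rewrite leqn0 subn_eq0.
have [[v [Pv vU]]|no] := pselect (exists v, P v /\ v \notin U); last first.
  exists U => v; split; first exact: UP.
  by move=> Pv; apply/negPn/negP => vU; apply: no; exists v.
apply: (IH (U + <[v]>)%VS).
  move=> _ /memv_addP[u uU [_ /vlineP[k ->] ->]]; rewrite addrC; apply: Pl => //; exact: UP.
have lt : (\dim U < \dim (U + <[v]>))%N.
  rewrite ltn_neqAle dimvS ?addvSl // andbT; apply: contra vU => /eqP e.
  have /eqP -> : U == (U + <[v]>)%VS by rewrite eqEdim addvSl e leqnn.
  by apply: (subvP (addvSr _ _)); apply: memv_line.
have := dimvS (subvf (U + <[v]>)); move: hd lt.
by move: (\dim U) (\dim (U + _)) (\dim fullv); clear; lia.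
Qed.
End Subspaces.

Section Realization.
Implicit Types (X Y A B : {fset nat}) (phi psi : nat -> rat).

(** Freiman homomorphisms of the pair (X, Y) into [rat], with one map for each side. *)
Definition hom X Y phi psi := forall x x' y y', x \in X -> x' \in X -> y \in Y -> y' \in Y ->
  (x + y = x' + y')%N -> phi x + psi y = phi x' + psi y'.

Lemma homS X Y X' Y' phi psi : X' `<=` X -> Y' `<=` Y -> hom X Y phi psi -> hom X' Y' phi psi.
Proof.
by move=> /fsubsetP sX /fsubsetP sY h x x' y y' *; apply: h; rewrite ?sX ?sY.
Qed.

(** The triple ((x, y), y') records a + y' = x + y with all entries but a in (X, Y): the value of a
    homomorphism at a is then forced by its values on (X, Y). *)
Definition attl X Y a := exists t : nat * nat * nat,
  [/\ t.1.1 \in X, t.1.2 \in Y, t.2 \in Y & (a + t.2 = t.1.1 + t.1.2)%N].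
Definition attr X Y b := exists t : nat * nat * nat,
  [/\ t.1.1 \in X, t.1.2 \in Y, t.2 \in X & (t.2 + b = t.1.1 + t.1.2)%N].

Lemma attlS X Y X' Y' a : X' `<=` X -> Y' `<=` Y -> attl X' Y' a -> attl X Y a.
Proof. by move=> /fsubsetP sX /fsubsetP sY [t [/sX ? /sY ? /sY ? ?]]; exists t. Qed.

Lemma attrS X Y X' Y' a : X' `<=` X -> Y' `<=` Y -> attr X' Y' a -> attr X Y a.
Proof. by move=> /fsubsetP sX /fsubsetP sY [t [/sX ? /sY ? /sX ? ?]]; exists t. Qed.

Variable N : nat.
(** [false] marks the left set of a pair and [true] the right one. *)
Definition vert := (bool * 'I_N.+1)%type.
Definition hfun := {ffun vert -> rat^o}.
Definition ev (h : hfun) s (a : nat) : rat := h (s, inord a).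

Lemma evP s k (u v : hfun) a : ev (k *: u + v) s a = k * ev u s a + ev v s a.
Proof. by rewrite /ev !ffunE. Qed.

(* Homomorphisms of (X, Y) are extended by 0 outside X and Y, so that they form a
   finite-dimensional space. *)
Definition isHom X Y (h : hfun) := [/\ hom X Y (ev h false) (ev h true),
  forall i, nat_of_ord i \notin X -> h (false, i) = 0 & forall i, nat_of_ord i \notin Y -> h (true, i) = 0].

Lemma Hom_ex X Y : exists U : {vspace hfun}, forall h, h \in U <-> isHom X Y h.
Proof.
apply: subspace_ex.
  by split=> [x x' y y' *|i _|i _]; rewrite /ev ?ffunE.
move=> k u v [h1 h2 h3] [g1 g2 g3]; split=> [x x' y y' xX x'X yY y'Y e|i hi|i hi].
- have := h1 _ _ _ _ xX x'X yY y'Y e; have := g1 _ _ _ _ xX x'X yY y'Y e.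
  rewrite !evP => eg eh; rewrite addrACA -mulrDr eh eg; ring.
- by rewrite !ffunE h2 // g2 // scaler0 addr0.
- by rewrite !ffunE h3 // g3 // scaler0 addr0.
Qed.

Definition Hom X Y : {vspace hfun} := projT1 (cid (Hom_ex X Y)).
Lemma HomP X Y h : h \in Hom X Y <-> isHom X Y h.
Proof. exact: projT2 (cid (Hom_ex X Y)) h. Qed.

Definition bounded X := forall x, x \in X -> (x <= N)%N.

Definition mkE X Y phi psi : hfun := [ffun v : vert =>
  if v.1 then (if nat_of_ord v.2 \in Y then psi v.2 else 0)
  else (if nat_of_ord v.2 \in X then phi v.2 else 0)].

Lemma ev_mkE X Y phi psi : bounded X -> bounded Y ->
  (forall x, x \in X -> ev (mkE X Y phi psi) false x = phi x) /\
  (forall y, y \in Y -> ev (mkE X Y phi psi) true y = psi y).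
Proof.
move=> bX bY; split => x xX; rewrite /ev ffunE /= inordK ?xX // ltnS; [exact: bX|exact: bY].
Qed.

Lemma mkE_Hom X Y phi psi : bounded X -> bounded Y -> hom X Y phi psi -> mkE X Y phi psi \in Hom X Y.
Proof.
move=> bX bY h; have [eX eY] := ev_mkE phi psi bX bY; apply/HomP; split.
- by move=> x x' y y' xX x'X yY y'Y e; rewrite !eX ?eY //; apply: h.
- by move=> i /negPf hi; rewrite ffunE /= hi.
- by move=> i /negPf hi; rewrite ffunE /= hi.
Qed.

Lemma dim_Hom X Y : (\dim (Hom X Y) <= #|` X| + #|` Y|)%N.
Proof.
pose dl (v : vert) : hfun := [ffun w => (w == v)%:R].
pose L := [seq dl (false, inord x) | x <- X] ++ [seq dl (true, inord y) | y <- Y].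
have -> : (#|` X| + #|` Y| = size L)%N by rewrite size_cat !size_map.
apply: leq_trans (dim_span L); apply: dimvS; apply/subvP => h /HomP[_ hX hY].
have -> : h = \sum_v h v *: dl v.
  apply/ffunP => w; rewrite sum_ffunE (bigD1 w) //= !ffunE eqxx big1 ?addr0.
    by rewrite -[LHS]mulr1.
  by move=> v; rewrite !ffunE eq_sym => /negPf ->; rewrite scaler0.
apply: memv_suml => -[s i] _.
have [hi|hi] := boolP (nat_of_ord i \in if s then Y else X).
  apply: memvZ; apply: memv_span; rewrite mem_cat.
  case: s hi => hi; apply/orP; [right|left]; apply/mapP; exists (nat_of_ord i) => //;
    by rewrite inord_val.
by case: s hi => hi; rewrite ?hX ?hY // scale0r mem0v.
Qed.


Definition valt phi psi (t : nat * nat * nat) : rat := phi t.1.1 + psi t.1.2 - psi t.2.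
Definition valr phi psi (t : nat * nat * nat) : rat := phi t.1.1 + psi t.1.2 - phi t.2.

Lemma attl_val X Y a t phi psi : hom X Y phi psi -> a \in X -> t.1.1 \in X -> t.1.2 \in Y ->
  t.2 \in Y -> (a + t.2 = t.1.1 + t.1.2)%N -> phi a = valt phi psi t.
Proof. by move=> h aX t1 t2 t3 e; rewrite /valt -(h _ _ _ _ aX t1 t3 t2 e) addrK. Qed.

Lemma attr_val X Y b t phi psi : hom X Y phi psi -> b \in Y -> t.1.1 \in X -> t.1.2 \in Y ->
  t.2 \in X -> (t.2 + b = t.1.1 + t.1.2)%N -> psi b = valr phi psi t.
Proof.
by move=> h bY t1 t2 t3 e; rewrite /valr -(h _ _ _ _ t3 t1 bY t2 e) [phi _ + _]addrC addrK.
Qed.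

Definition extends X Y a a' b b' phi psi := exists phi' psi',
  [/\ hom (X `|` [fset a; a']) (Y `|` [fset b; b']) phi' psi',
    forall x, x \in X -> phi' x = phi x & forall y, y \in Y -> psi' y = psi y].

(** Extension is asked for two elements of each side at a time, as many as a single coincidence a +
    b = a' + b' involves. *)
Definition closed X Y A B := forall a a' b b' phi psi, a \in A -> a' \in A -> b \in B -> b' \in B ->
  hom X Y phi psi -> extends X Y a a' b b' phi psi.

Definition restr X Y (h : {ffun vert -> rat^o}) : {ffun vert -> rat^o} :=
  [ffun v => if nat_of_ord v.2 \in (if v.1 then Y else X) then h v else 0].

Lemma restr_linear X Y : linear (restr X Y).
Proof.
move=> k u v; apply/ffunP => w; rewrite !ffunE; case: ifP => // _.
by rewrite scaler0 addr0.
Qed.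
HB.instance Definition _ X Y := GRing.isLinear.Build rat {ffun vert -> rat^o} {ffun vert -> rat^o} _
  (restr X Y) (restr_linear X Y).

(** Restriction from the enlarged pair to (X, Y) is injective on homomorphisms, because the new
    elements are attached, and it misses the homomorphism that does not extend. So the dimension
    drops strictly. *)
Lemma closing_step X Y A B : bounded X -> bounded Y -> bounded A -> bounded B ->
  (forall a, a \in A -> attl X Y a) -> (forall b, b \in B -> attr X Y b) ->
  ~ closed X Y A B -> exists X1 Y1, [/\ X `<=` X1, Y `<=` Y1, X1 `<=` X `|` A & Y1 `<=` Y `|` B] /\
   (#|` X1| + #|` Y1| <= #|` X| + #|` Y| + 4)%N /\ (\dim (Hom X1 Y1) < \dim (Hom X Y))%N.
Proof.
move=> bX bY bA bB hA hB nc.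
have [[a [a' [b [b' [phi [psi [[aA a'A bB' b'B] [h no]]]]]]]]|yes] := pselect (exists a a' b b' phi psi,
   [/\ a \in A, a' \in A, b \in B & b' \in B] /\ hom X Y phi psi /\
   ~ extends X Y a a' b b' phi psi); last first.
  exfalso; apply: nc => a a' b b' phi psi ? ? ? ? h; have [//|no] := pselect (extends X Y a a' b b' phi psi).
  by exfalso; apply: yes; exists a, a', b, b', phi, psi.
set X1 := X `|` [fset a; a'] in no; set Y1 := Y `|` [fset b; b'] in no.
have sX : X `<=` X1 by apply: fsubsetUl.
have sY : Y `<=` Y1 by apply: fsubsetUl.
have sX1 : X1 `<=` X `|` A.
  by apply: fsetUS; apply/fsubsetP => x; rewrite !inE => /orP[/eqP ->|/eqP ->].
have sY1 : Y1 `<=` Y `|` B.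
  by apply: fsetUS; apply/fsubsetP => x; rewrite !inE => /orP[/eqP ->|/eqP ->].
have bX1 : bounded X1 by move=> x /(fsubsetP sX1); rewrite inE => /orP[/bX|/bA].
have bY1 : bounded Y1 by move=> x /(fsubsetP sY1); rewrite inE => /orP[/bY|/bB].
exists X1, Y1; split=> //; split.
  have c2 (S : {fset nat}) c c' : (#|` S `|` [fset c; c']| <= #|` S| + 2)%N.
    rewrite cardfsU; apply: leq_trans (leq_subr _ _) _; rewrite leq_add2l cardfs2; by case: eqP.
  by have := c2 X a a'; have := c2 Y b b'; rewrite -/X1 -/Y1; lia.
pose r : 'End({ffun vert -> rat^o}) := linfun (restr X Y).
have evr h' : (forall x, x \in X -> ev (r h') false x = ev h' false x) /\
      (forall y, y \in Y -> ev (r h') true y = ev h' true y).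
  by split=> x xX; rewrite /ev lfunE ffunE /= inordK ?xX // ltnS; [exact: bX|exact: bY].
have rH h' : h' \in Hom X1 Y1 -> r h' \in Hom X Y.
  move=> /HomP[h1 h2 h3]; apply/HomP; have [eX eY] := evr h'; split.
  - move=> x x' y y' xX x'X yY y'Y e; rewrite !eX ?eY //; apply: h1 => //;
      by [exact: (fsubsetP sX)|exact: (fsubsetP sY)].
  - by move=> i /negPf hi; rewrite lfunE ffunE /= hi.
  - by move=> i /negPf hi; rewrite lfunE ffunE /= hi.
have inj : (Hom X1 Y1 :&: lker r = 0)%VS.
  apply/eqP; rewrite -subv0; apply/subvP => h' /memv_capP[/HomP[h1 h2 h3]].
  rewrite memv_ker memv0 => /eqP r0; have [eX eY] := evr h'.
  have zX x : x \in X -> ev h' false x = 0 by move=> /eX <-; rewrite r0 /ev ffunE.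
  have zY y : y \in Y -> ev h' true y = 0 by move=> /eY <-; rewrite r0 /ev ffunE.
  have zX1 x : x \in X1 -> ev h' false x = 0.
    move=> xX1; have := fsubsetP sX1 _ xX1; rewrite inE => /orP[/zX//|/hA[t [t1 t2 t3 e]]].
    rewrite (attl_val h1 xX1 _ _ _ e) ?(fsubsetP sX) ?(fsubsetP sY) //.
    by rewrite /valt zX // !zY // subr0 addr0.
  have zY1 x : x \in Y1 -> ev h' true x = 0.
    move=> xX1; have := fsubsetP sY1 _ xX1; rewrite inE => /orP[/zY//|/hB[t [t1 t2 t3 e]]].
    rewrite (attr_val h1 xX1 _ _ _ e) ?(fsubsetP sX) ?(fsubsetP sY) //.
    by rewrite /valr !zX // zY // subr0 addr0.
  apply/eqP/ffunP => -[s i]; rewrite ffunE.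
  case: s.
    have [hi|/h3//] := boolP (nat_of_ord i \in Y1).
    by have := zY1 _ hi; rewrite /ev inord_val.
  have [hi|/h2//] := boolP (nat_of_ord i \in X1).
  by have := zX1 _ hi; rewrite /ev inord_val.
rewrite -(limg_dim_eq inj) ltn_neqAle.
have sub : (r @: Hom X1 Y1 <= Hom X Y)%VS.
  by apply/subvP => _ /memv_imgP[h' /rH h'H ->].
rewrite dimvS // andbT; apply/negP => /eqP e; apply: no.
have mH := mkE_Hom bX bY h.
have /memv_imgP[h' /HomP[h1 _ _] e'] : mkE X Y phi psi \in (r @: Hom X1 Y1)%VS.
  by have /eqP -> : (r @: Hom X1 Y1)%VS == Hom X Y by rewrite eqEdim sub e leqnn.
have [e1 e2] := ev_mkE phi psi bX bY; have [eX eY] := evr h'.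
exists (ev h' false), (ev h' true); split => //.
- by move=> x xX; rewrite -eX // -e' e1.
- by move=> x xX; rewrite -eY // -e' e2.
Qed.

(* The dimension of the space of homomorphisms drops at each step. *)
Lemma closing X Y A B : bounded X -> bounded Y -> bounded A -> bounded B ->
  (forall a, a \in A -> attl X Y a) -> (forall b, b \in B -> attr X Y b) ->
  exists X1 Y1, [/\ X `<=` X1, Y `<=` Y1, X1 `<=` X `|` A & Y1 `<=` Y `|` B] /\
   (#|` X1| + #|` Y1| <= 5 * (#|` X| + #|` Y|))%N /\ closed X1 Y1 A B.
Proof.
move=> bX bY bA bB hA hB.
(* The dimension is at most |X| + |Y| initially, and each drop costs at most four new elements,
   hence the factor 5. *)
suff H n X' Y' : X `<=` X' -> Y `<=` Y' -> X' `<=` X `|` A -> Y' `<=` Y `|` B ->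
    (\dim (Hom X' Y') <= n)%N ->
  exists X1 Y1, [/\ X `<=` X1, Y `<=` Y1, X1 `<=` X `|` A & Y1 `<=` Y `|` B] /\
   (#|` X1| + #|` Y1| <= #|` X'| + #|` Y'| + 4 * n)%N /\ closed X1 Y1 A B.
  have [X1 [Y1 [h [hs hc]]]] := H _ X Y (fsubset_refl _) (fsubset_refl _) (fsubsetUl _ _) (fsubsetUl _ _) (dim_Hom X Y).
  by exists X1, Y1; split => //; split => //; apply: leq_trans hs _; lia.
elim: n X' Y' => [|n IH] X' Y' sX sY sX' sY' hd;
  have [hc|nc] := pselect (closed X' Y' A B); try (by exists X', Y'; do !split => //; rewrite leq_addr).
all: have bX' : bounded X' by move=> x /(fsubsetP sX'); rewrite inE => /orP[/bX|/bA].
all: have bY' : bounded Y' by move=> x /(fsubsetP sY'); rewrite inE => /orP[/bY|/bB].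
all: have hA' a : a \in A -> attl X' Y' a by move=> /hA; apply: attlS.
all: have hB' b : b \in B -> attr X' Y' b by move=> /hB; apply: attrS.
all: have [X1 [Y1 [[s1 s2 s3 s4] [hs dlt]]]] := closing_step bX' bY' bA bB hA' hB' nc.
  by move: dlt hd; lia.
have [||||| X2 [Y2 [h2 [hs2 hc2]]]] := IH X1 Y1.
- exact: fsubset_trans s1.
- exact: fsubset_trans s2.
- by apply: fsubset_trans s3 _; rewrite fsubUset sX' fsubsetUr.
- by apply: fsubset_trans s4 _; rewrite fsubUset sY' fsubsetUr.
- by rewrite -ltnS; apply: leq_trans dlt hd.
exists X2, Y2; split => //; split => //; apply: leq_trans hs2 _; move: hs; lia.
Qed.


Definition tl X Y a : nat * nat * nat :=
  if pselect (attl X Y a) is left h then projT1 (cid h) else (0, 0, 0)%N.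
Definition tr X Y b : nat * nat * nat :=
  if pselect (attr X Y b) is left h then projT1 (cid h) else (0, 0, 0)%N.

Lemma tlP X Y a : attl X Y a -> [/\ (tl X Y a).1.1 \in X, (tl X Y a).1.2 \in Y, (tl X Y a).2 \in Y &
  (a + (tl X Y a).2 = (tl X Y a).1.1 + (tl X Y a).1.2)%N].
Proof. by rewrite /tl; case: pselect => // h _; apply: projT2 (cid h). Qed.

Lemma trP X Y b : attr X Y b -> [/\ (tr X Y b).1.1 \in X, (tr X Y b).1.2 \in Y, (tr X Y b).2 \in X &
  ((tr X Y b).2 + b = (tr X Y b).1.1 + (tr X Y b).1.2)%N].
Proof. by rewrite /tr; case: pselect => // h _; apply: projT2 (cid h). Qed.

(* The image of an element is the tuple of its values under a basis of homomorphisms. *)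
Theorem realization X Y A B : bounded X -> bounded Y ->
  (forall a, a \in A -> attl X Y a) -> (forall b, b \in B -> attr X Y b) -> closed X Y A B ->
  exists d (v w : nat -> 'rV[rat]_d),
   (forall a a' b b', a \in A -> a' \in A -> b \in B -> b' \in B ->
     (a + b = a' + b')%N <-> v a + w b = v a' + w b') /\
   (forall X1 Y1 phi psi, X `<=` X1 -> Y `<=` Y1 -> hom X1 Y1 phi psi ->
     exists c, [/\ islin c, forall a, a \in A -> a \in X1 -> phi a = c (v a) &
       forall b, b \in B -> b \in Y1 -> psi b = c (w b)]).
Proof.
move=> bX bY hA hB hc; set U := Hom X Y; pose hb i : hfun := (vbasis U)`_i.
exists (\dim U).
(* For a outside X the coordinate is the value that the attachment of a would force on an
   extension. *)
exists (fun a => \row_(i < \dim U) valt (ev (hb i) false) (ev (hb i) true) (tl X Y a)).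
exists (fun b => \row_(i < \dim U) valr (ev (hb i) false) (ev (hb i) true) (tr X Y b)).
have hbU (i : 'I_(\dim U)) : isHom X Y (hb i).
  by apply/HomP; apply: vbasis_mem; apply: mem_nth; rewrite size_tuple.
have link X1 Y1 phi psi : X `<=` X1 -> Y `<=` Y1 -> hom X1 Y1 phi psi ->
   exists c, [/\ islin c, forall a, a \in A -> a \in X1 ->
      phi a = c (\row_(i < \dim U) valt (ev (hb i) false) (ev (hb i) true) (tl X Y a)) &
       forall b, b \in B -> b \in Y1 ->
      psi b = c (\row_(i < \dim U) valr (ev (hb i) false) (ev (hb i) true) (tr X Y b))].
  move=> sX sY h1; pose h := mkE X Y phi psi.
  have hU : h \in U by apply: mkE_Hom => //; apply: homS h1.
  have [e1 e2] := ev_mkE phi psi bX bY.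
  pose k i := coord (vbasis U) i h.
  have hE : h = \sum_i k i *: hb i by exact: coord_vbasis.
  have evE s x : ev h s x = \sum_i k i * ev (hb i) s x.
    by rewrite hE /ev sum_ffunE; apply: eq_bigr => i _; rewrite ffunE.
  exists (fun u : 'rV[rat]_(\dim U) => \sum_i k i * u 0 i); split.
  - move=> a u w; rewrite big_distrr -big_split; apply: eq_bigr => i _ /=.
    by rewrite !mxE; ring.
  - move=> a aA aX1; have [t1 t2 t3 e] := tlP (hA a aA).
    rewrite (attl_val h1 aX1 _ _ _ e) ?(fsubsetP sX) ?(fsubsetP sY) //.
    rewrite /valt -e1 // -!e2 // !evE -sumrN -!big_split /=.
    by apply: eq_bigr => i _; rewrite mxE /valt; ring.
  - move=> b bB bY1; have [t1 t2 t3 e] := trP (hB b bB).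
    rewrite (attr_val h1 bY1 _ _ _ e) ?(fsubsetP sX) ?(fsubsetP sY) //.
    rewrite /valr -!e1 // -e2 // !evE -sumrN -!big_split /=.
    by apply: eq_bigr => i _; rewrite mxE /valr; ring.
split; last exact: link.
move=> a a' b b' aA a'A bB b'B; split=> [e|e].
  apply/rowP => i; rewrite !mxE; have [h1 _ _] := hbU i.
  (* Closedness extends the basis homomorphism to a, a', b, b' at once; the attachments identify the
     coordinates with values of the extension, which respects the coincidence. *)
  have [phi' [psi' [h' e1 e2]]] := hc _ _ _ _ _ _ aA a'A bB b'B h1.
  have ea x : x \in A -> x \in X `|` [fset a; a'] -> valt (ev (hb i) false) (ev (hb i) true) (tl X Y x) = phi' x.
    move=> xA xX; have [t1 t2 t3 ex] := tlP (hA x xA).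
    by rewrite (attl_val h' xX _ _ _ ex) ?inE ?t1 ?t2 ?t3 // /valt e1 // !e2.
  have eb x : x \in B -> x \in Y `|` [fset b; b'] -> valr (ev (hb i) false) (ev (hb i) true) (tr X Y x) = psi' x.
    move=> xA xX; have [t1 t2 t3 ex] := trP (hB x xA).
    by rewrite (attr_val h' xX _ _ _ ex) ?inE ?t1 ?t2 ?t3 // /valr !e1 // e2.
  rewrite !ea ?eb //; rewrite ?inE ?eqxx ?orbT //.
  by apply: h' => //; rewrite !inE eqxx ?orbT.
(* Conversely, the inclusion into the rationals is a homomorphism, so some functional recovers a
   from v a and b from w b. *)
have hN : hom (X `|` A) (Y `|` B) (fun x => x%:R) (fun x => x%:R).
  by move=> x x' y y' _ _ _ _ exy; rewrite -!natrD exy.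
have [c [lc cA cB]] := link _ _ _ _ (fsubsetUl _ _) (fsubsetUl _ _) hN.
have := congr1 c e; rewrite !islinD // -!cA -?cB ?inE ?aA ?a'A ?bB ?b'B ?orbT //.
by rewrite -!natrD => /eqP; rewrite eqr_nat => /eqP.
Qed.

End Realization.

(** * Certificates *)

Section Certificates.
Implicit Types (X Y A B : {fset nat}) (phi psi : nat -> rat).
Variable N : nat.

Definition lab_val T (phi psi : nat -> T) (l : bool * nat) := (if l.1 then psi else phi) l.2.

(* (A, B) sits in a pair (X, Y) of sets of size at most S whose homomorphisms vanish
   on A and B as soon as they vanish at the tau labels L; [true] marks labels in Y. *)
Definition cert S tau A B := exists X Y (L : seq (bool * nat)),
  [/\ bounded N X, bounded N Y, (#|` X| <= S)%N & (#|` Y| <= S)%N] /\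
  [/\ A `<=` X, B `<=` Y, size L = tau & forall l, l \in L -> l.2 \in (if l.1 then Y else X)] /\
  forall phi psi, hom X Y phi psi -> (forall l, l \in L -> lab_val phi psi l = 0) ->
    (forall a, a \in A -> phi a = 0) /\ (forall b, b \in B -> psi b = 0).

(** Homomorphisms factor through (v, w), so labels whose images span all the images of A' and B'
    suffice. These images lie in [Dsp A1 + Dsp B1] enlarged by the lines through v a0 and w b0: this
    is the 2 in the rank. *)
Lemma cert_real d (v w : nat -> 'rV[rat]_d) X Y A B (A1 B1 : {fset 'rV[rat]_d}) (A' B' : {fset nat}) S :
  bounded N X -> bounded N Y -> bounded N A -> bounded N B ->
  (forall X1 Y1 phi psi, X `<=` X1 -> Y `<=` Y1 -> hom X1 Y1 phi psi ->
     exists c, [/\ islin c, forall a, a \in A -> a \in X1 -> phi a = c (v a) &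
       forall b, b \in B -> b \in Y1 -> psi b = c (w b)]) ->
  A' `<=` A -> B' `<=` B -> A' != fset0 -> B' != fset0 ->
  (forall a, a \in A' -> v a \in A1) -> (forall b, b \in B' -> w b \in B1) ->
  (#|` X| + #|` A'| <= S)%N -> (#|` Y| + #|` B'| <= S)%N ->
  cert S (\dim (Dsp A1 + Dsp B1)).+2 A' B'.
Proof.
move=> bX bY bA bB link /fsubsetP sA /fsubsetP sB /fset0Pn[a0 a0A] /fset0Pn[b0 b0B] vA wB cX cY.
pose L0 := [seq (false, a) | a <- A'] ++ [seq (true, b) | b <- B'].
have L0P l : l \in L0 -> l.2 \in (if l.1 then B' else A').
  by rewrite mem_cat => /orP[] /mapP[x xA ->].
pose g (l : bool * nat) := (if l.1 then w else v) l.2.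
have [t [st ct ht]] := basis_subseq g L0.
set D := (Dsp A1 + Dsp B1)%VS.
have dt : (size t <= (\dim D).+2)%N.
  apply: leq_trans ct _.
  apply: (@leq_trans (\dim (D + <[v a0]> + <[w b0]>))); last first.
    apply: leq_trans (dim_addv_line _ _) _; rewrite ltnS; exact: dim_addv_line.
  apply: dimvS; apply/span_subvP => _ /mapP[[s x] /L0P /= xA ->]; rewrite /g /=; case: s xA => xA.
    rewrite -(subrK (w b0) (w x)); apply: memv_add; last exact: memv_line.
    by apply: (subvP (addvSl _ _)); apply: (subvP (addvSr _ _)); apply: mem_Dsp; apply: wB.
  apply: (subvP (addvSl _ _)); rewrite -(subrK (v a0) (v x)); apply: memv_add; last exact: memv_line.
  by apply: (subvP (addvSl _ _)); apply: mem_Dsp; apply: vA.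
(* The list of labels is padded to the exact length by repeating a0. *)
exists (X `|` A'), (Y `|` B'), (t ++ nseq ((\dim D).+2 - size t) (false, a0)).
have sub l : l \in t ++ nseq ((\dim D).+2 - size t) (false, a0) -> l \in L0.
  rewrite mem_cat => /orP[/st//|]; rewrite mem_nseq => /andP[_ /eqP ->].
  by rewrite mem_cat; apply/orP; left; apply: map_f.
split; last split.
- split.
  + by move=> x; rewrite inE => /orP[/bX//|/sA/bA].
  + by move=> x; rewrite inE => /orP[/bY//|/sB/bB].
  + by rewrite cardfsU; apply: leq_trans (leq_subr _ _) cX.
  + by rewrite cardfsU; apply: leq_trans (leq_subr _ _) cY.
- split; rewrite ?fsubsetUr //; first by rewrite size_cat size_nseq subnKC.
  by move=> [s x] /sub/L0P /=; case: s; rewrite inE => ->; rewrite orbT.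
- move=> phi psi h hL; have [c [lc cA cB]] := link _ _ _ _ (fsubsetUl _ _) (fsubsetUl _ _) h.
  have cg l : l \in L0 -> lab_val phi psi l = c (g l).
    case: l => -[] x /L0P /= xA; rewrite /lab_val /g /=.
      by apply: cB; [exact: sB|rewrite inE xA orbT].
    by apply: cA; [exact: sA|rewrite inE xA orbT].
  have z l : l \in L0 -> lab_val phi psi l = 0.
    move=> lL; rewrite cg //; apply: (islin_span lc _ (ht _ lL)) => _ /mapP[l' l't ->].
    by rewrite -cg; [apply: hL; rewrite mem_cat l't|apply: st].
  split=> x xA.
    by apply: (z (false, x)); rewrite mem_cat; apply/orP; left; apply: map_f.
  by apply: (z (true, x)); rewrite mem_cat; apply/orP; right; apply: map_f.
Qed.

Section Data.
Variables S tau : nat.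
Local Notation idx := 'I_S.+1.
Definition quad := ((idx * idx) * (idx * idx))%type.
(* Spanning relations, position of A and B in X and Y, position and value of the labels. *)
Definition datum := ({ffun 'I_(S.+1 + S.+1) -> quad} * ({set idx} * {set idx}) *
  ({ffun 'I_tau -> bool * idx} * {ffun 'I_tau -> 'I_N.+1}))%type.

Definition holds (T : zmodType) (x y : idx -> T) (q : quad) := x q.1.1 + y q.1.2 = x q.2.1 + y q.2.2.

Definition isdatum (D : datum) A B := exists x y : idx -> nat,
  [/\ A = [fset x i | i in D.1.2.1], B = [fset y i | i in D.1.2.2],
     forall k, (x (D.1.1 k).1.1 + y (D.1.1 k).1.2 = x (D.1.1 k).2.1 + y (D.1.1 k).2.2)%N &
     forall l, (if (D.2.1 l).1 then y else x) (D.2.1 l).2 = D.2.2 l] /\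
  forall phi psi : idx -> rat, (forall k, holds phi psi (D.1.1 k)) ->
    (forall l, (if (D.2.1 l).1 then psi else phi) (D.2.1 l).2 = 0) ->
    (forall i, i \in D.1.2.1 -> phi i = 0) /\ (forall i, i \in D.1.2.2 -> psi i = 0).

(* The difference of the two inclusions is a homomorphism vanishing at the labels. *)
Lemma datum_inj D A B A' B' : isdatum D A B -> isdatum D A' B' -> A = A' /\ B = B'.
Proof.
move=> [x [y [[eA eB hq hl] h]]] [x' [y' [[eA' eB' hq' hl'] _]]].
have [||hA hB] := h (fun i => (x i)%:R - (x' i)%:R) (fun i => (y i)%:R - (y' i)%:R).
- move=> k; rewrite /holds [LHS]addrACA [RHS]addrACA -!opprD -!natrD.
  by rewrite hq hq'.
- by move=> l; have := hl l; have := hl' l; case: (D.2.1 l) => -[] i /= -> ->; rewrite subrr.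
split.
  rewrite eA eA'; apply: eq_in_imfset => // i /hA /eqP.
  by rewrite subr_eq0 eqr_nat => /eqP.
rewrite eB eB'; apply: eq_in_imfset => // i /hB /eqP.
by rewrite subr_eq0 eqr_nat => /eqP.
Qed.

(** The many relations of (X, Y) are vectors in a space of dimension 2 (S + 1). A basis of their
    span implies all of them, so a datum stores only that number of relations. *)
Lemma cert_datum A B : cert S tau A B -> exists D, isdatum D A B.
Proof.
move=> [X [Y [L [[bX bY cX cY] [[/fsubsetP sA /fsubsetP sB sL hL] h]]]]].
pose x (i : idx) := nth 0%N X i; pose y (i : idx) := nth 0%N Y i.
pose V := 'rV[rat]_(S.+1 + S.+1).
pose el i : V := delta_mx 0 (lshift _ i); pose er i : V := delta_mx 0 (rshift _ i).
pose g (q : quad) := el q.1.1 + er q.1.2 - (el q.2.1 + er q.2.2).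
pose val (q : quad) := [&& q.1.1 < #|` X|, q.1.2 < #|` Y|, q.2.1 < #|` X|, q.2.2 < #|` Y| &
   x q.1.1 + y q.1.2 == x q.2.1 + y q.2.2]%N.
have [t [st ct ht]] := basis_subseq g [seq q <- enum {: quad} | val q].
have {}ct : (size t <= S.+1 + S.+1)%N.
  apply: leq_trans ct _; apply: leq_trans (dimvS (subvf _)) _.
  by rewrite dimvf /dim /= mul1n.
(* The padding relation is trivially true. *)
pose q0 : quad := ((ord0, ord0), (ord0, ord0)).
pose beta := [ffun k : 'I_(S.+1 + S.+1) => nth q0 t k].
pose l0 : bool * nat := (false, 0%N).
pose lb := [ffun k : 'I_tau => let l := nth l0 L k in
   (l.1, inord (index l.2 (if l.1 then (Y : seq nat) else X)) : idx)].
pose vl := [ffun k : 'I_tau => inord (nth l0 L k).2 : 'I_N.+1].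
pose MA := [set i : idx | (i < #|` X|)%N && (x i \in A)].
pose MB := [set i : idx | (i < #|` Y|)%N && (y i \in B)].
have idxX a : a \in X -> (index a X < #|` X|)%N by rewrite -index_mem.
have idxY a : a \in Y -> (index a Y < #|` Y|)%N by rewrite -index_mem.
have inX a : a \in X -> (inord (index a X) : idx) = index a X :> nat.
  by move=> /idxX aX; rewrite inordK // ltnS; apply: leq_trans (ltnW aX) cX.
have inY a : a \in Y -> (inord (index a Y) : idx) = index a Y :> nat.
  by move=> /idxY aX; rewrite inordK // ltnS; apply: leq_trans (ltnW aX) cY.
have xi a : a \in X -> x (inord (index a X)) = a by move=> aX; rewrite /x inX // nth_index.
have yi a : a \in Y -> y (inord (index a Y)) = a by move=> aX; rewrite /y inY // nth_index.
have Lk (k : 'I_tau) : nth l0 L k \in L by rewrite mem_nth // sL.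
have val0 k : (x (beta k).1.1 + y (beta k).1.2 = x (beta k).2.1 + y (beta k).2.2)%N.
  rewrite ffunE; have [lt|ge] := ltnP k (size t); last by rewrite nth_default.
  by have := st _ (mem_nth q0 lt); rewrite mem_filter => /andP[/and5P[_ _ _ _ /eqP]].
exists ((beta, (MA, MB)), (lb, vl)), x, y; split=> [|phi psi hq hlab].
  split=> //=.
  - apply/fsetP => a; apply/idP/imfsetP => [aA|[i /=]].
      exists (inord (index a X)); last by rewrite xi // sA.
      by rewrite /= inE xi ?sA // aA andbT inX ?idxX ?sA.
    by rewrite inE => /andP[_ h'] ->.
  - apply/fsetP => a; apply/idP/imfsetP => [aA|[i /=]].
      exists (inord (index a Y)); last by rewrite yi // sB.
      by rewrite /= inE yi ?sB // aA andbT inY ?idxY ?sB.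
    by rewrite inE => /andP[_ h'] ->.
  - move=> l; rewrite !ffunE /=; have := hL _ (Lk l); case: (nth l0 L l) => -[] a /= aX.
      by rewrite yi // inordK // ltnS bY.
    by rewrite xi // inordK // ltnS bX.
pose phi' a := phi (inord (index a X)); pose psi' b := psi (inord (index b Y)).
pose c (u : V) := \sum_i phi i * u 0 (lshift _ i) + \sum_i psi i * u 0 (rshift _ i).
have lc : islin c.
  move=> k u w; rewrite /c mulrDr !big_distrr -!big_split /=.
  by apply: eq_bigr => i _; rewrite !mxE; ring.
have cel i : c (el i) = phi i.
  rewrite /c (bigD1 i) //= big1 ?addr0 => [|j /negPf ji]; last first.
    by rewrite mxE !eqxx /= eq_lshift ji mulr0.
  by rewrite big1 ?addr0 => [|j _]; rewrite mxE ?eqxx ?mulr1 // eq_rlshift mulr0.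
have cer i : c (er i) = psi i.
  rewrite /c [X in _ + X](bigD1 i) //= big1 => [|j _]; last by rewrite mxE eq_lrshift mulr0.
  rewrite big1 ?addr0 ?add0r => [|j /negPf ji]; first by rewrite mxE !eqxx mulr1.
  by rewrite mxE !eqxx /= eq_rshift ji mulr0.
have cg q : c (g q) = phi q.1.1 + psi q.1.2 - (phi q.2.1 + psi q.2.2).
  by rewrite /g islinB // !islinD // !cel !cer.
have ct0 u : u \in map g t -> c u = 0.
  move=> /mapP[q qt ->]; rewrite cg; apply/eqP; rewrite subr_eq0; apply/eqP.
  have lt : (index q t < S.+1 + S.+1)%N by apply: leq_trans ct; rewrite index_mem.
  by have := hq (Ordinal lt); rewrite /holds ffunE /= nth_index.
have hom' : hom X Y phi' psi'.
  move=> a a' b b' aX a'X b_Y b'Y e; apply/eqP; rewrite -subr_eq0; apply/eqP.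
  pose q : quad := ((inord (index a X), inord (index b Y)), (inord (index a' X), inord (index b' Y))).
  have := islin_span lc ct0 (ht q _); rewrite cg; apply.
  by rewrite mem_filter mem_enum andbT /val /= !inX ?inY // !idxX ?idxY //= !xi ?yi // e eqxx.
have [|zA zB] := h _ _ hom'.
  move=> l lL; have lt : (index l L < tau)%N by rewrite -sL index_mem.
  have := hlab (Ordinal lt); rewrite /= ffunE /= nth_index // /lab_val.
  by case: l.1.
split=> i; rewrite inE => /andP[lt iA].
  have := zA _ iA; rewrite /phi' /x index_uniq ?fset_uniq //.
  by rewrite inord_val.
have := zB _ iA; rewrite /psi' /y index_uniq ?fset_uniq //.
by rewrite inord_val.
Qed.

Lemma card_datum : (#|{: datum}| =
  (S.+1 ^ 4) ^ (S.+1 + S.+1) * (2 ^ S.+1 * 2 ^ S.+1) * ((2 * S.+1) ^ tau * N.+1 ^ tau))%N.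
Proof.
have cs (T : finType) : #|{: {set T}}| = (2 ^ #|T|)%N.
  rewrite -[in RHS]cardsT -card_powerset -cardsT; congr #|pred_of_set _|.
  by apply/setP => C; rewrite !inE finset.subsetT.
rewrite !card_prod !card_ffun !cs !card_prod !card_ord card_bool.
by rewrite !expnS expn0 !muln1 !mulnA.
Qed.
End Data.
End Certificates.

(** * Union bound over the subsets of [n] of size m *)

Lemma bin_shift n m p : (p <= m)%N -> (m <= n)%N ->
  ('C(n - p, m - p) * n ^ p <= m ^ p * 'C(n, m))%N.
Proof.
move=> pm mn; elim: p pm => [|p IH] pm; first by rewrite !subn0 !expn0 muln1 mul1n.
have {}IH := IH (ltnW pm).
have np : (0 < n - p)%N by rewrite subn_gt0; apply: leq_trans mn.
have := mul_bin_diag (n - p) (m - p).-1.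
have e2 : ((m - p).-1.+1 = m - p)%N by rewrite prednK // subn_gt0.
rewrite e2 -!subnS => hb.
rewrite -(leq_pmul2l np) mulnA hb !expnS mulnACA.
have h : ((m - p) * n <= m * (n - p))%N.
  by rewrite mulnBl mulnBr; apply: leq_sub2l; rewrite mulnC leq_mul2l mn orbT.
apply: leq_trans (_ : (m * (n - p)) * ('C(n - p, m - p) * n ^ p) <= _)%N.
  by rewrite leq_mul2r h orbT.
apply: leq_trans (leq_mul (leqnn _) IH) _; rewrite leq_eqVlt; apply/orP; left; apply/eqP.
by rewrite -!mulnA mulnCA.
Qed.

Lemma bin_sub a b j : (j <= b)%N -> (b <= a)%N -> ('C(a - j, b - j) <= 'C(a, b))%N.
Proof.
elim: j a b => [|j IH] [|a] [|b] //= jb ba; rewrite !subSS.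
by apply: leq_trans (IH _ _ jb ba) _; rewrite binS leq_addl.
Qed.

(** A set T containing X is determined by T minus X, and C(n - q, m - q) / C(n, m) is a product of
    factors (m - i) / (n - i), each at most m / n. *)
Lemma count_super n m q (X : {set 'I_n}) : (q <= #|X|)%N -> (m <= n)%N ->
  (#|[set T : {set 'I_n} | (X \subset T) && (#|T| == m)]| * n ^ q <= m ^ q * 'C(n, m))%N.
Proof.
move=> qX mn; have [pm|pm] := leqP #|X| m; last first.
  rewrite (_ : [set T | _] = finset.set0) ?cards0 //; apply/finset.setP => T; rewrite !inE.
  apply/negP => /andP[/subset_leq_card h /eqP e]; move: pm; rewrite -e ltnNge h //.
apply: leq_trans (bin_shift (leq_trans qX pm) mn); rewrite leq_mul2r; apply/orP; right.
apply: (@leq_trans 'C(n - #|X|, m - #|X|)).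
  have -> : (n - #|X| = #|~: X|)%N by rewrite [RHS]cardsCs finset.setCK card_ord.
  rewrite -cards_draws -(card_in_imset (f := fun T : {set 'I_n} => T :\: X)).
    apply: subset_leq_card; apply/fintype.subsetP => _ /imsetP[T + ->].
    rewrite !inE => /andP[XT /eqP cT]; rewrite finset.setDE finset.subsetIr /= -finset.setDE cardsD.
    by rewrite (finset.setIidPr XT) cT.
  move=> T T'; rewrite !inE => /andP[XT _] /andP[XT' _] e.
  by rewrite -(finset.setID T X) -(finset.setID T' X) (finset.setIidPr XT) (finset.setIidPr XT') e.
have [j ej] : exists j, #|X| = (q + j)%N by exists (#|X| - q)%N; rewrite subnKC.
rewrite ej in pm *; rewrite !subnDA; apply: bin_sub; by move: pm mn; clear; lia.
Qed.

Section Union.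
Variable R : realFieldType.

Definition tofs n (T : {set 'I_n}) : {fset nat} := [fset (nat_of_ord i).+1 | i in T].

Lemma card_tofs n (T : {set 'I_n}) : #|` tofs T| = #|T|.
Proof.
rewrite card_imfset /=; first by rewrite cardE; congr size.
by move=> i j [] /val_inj.
Qed.

Lemma tofs_sub n (T : {set 'I_n}) : tofs T `<=` interval1 n.
Proof.
apply/fsubsetP => _ /imfsetP[i /= _ ->].
by rewrite /interval1 inE /= mem_iota /= add1n ltnS.
Qed.

Definition badpair n (t : nat * nat * nat) A B (T : {set 'I_n}) :=
  (t.2 <= #|` sumset A B|)%N /\ sumset A B `<=` tofs T.

(** By [datum_inj] all pairs with datum D coincide, so every bad T contains one and the same sumset,
    of size at least t.2. *)
Lemma count_datum n m (t : nat * nat * nat) (D : datum n t.1.1 t.1.2) : (m <= n)%N ->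
  (#|[set T : {set 'I_n} | (#|T| == m) && `[< exists A B, isdatum D A B /\ badpair t A B T >]]| * n ^ t.2 <=
     m ^ t.2 * 'C(n, m))%N.
Proof.
move=> mn; set F := [set T | _].
have [->|/finset.set0Pn[T0]] := eqVneq F finset.set0; first by rewrite cards0.
rewrite inE => /andP[_ /asboolP[A [B [hD [hq hs]]]]].
pose X := [set i : 'I_n | i.+1 \in sumset A B].
have eX : tofs X = sumset A B.
  apply/fsetP => z; apply/imfsetP/idP => [[i /=]|zs]; first by rewrite inE => h ->.
  have /imfsetP[i /= _ ez] := fsubsetP hs _ zs.
  by exists i => //; rewrite /= inE -ez.
apply: leq_trans (@count_super n m t.2 X _ mn); last by rewrite -card_tofs eX.
rewrite leq_mul2r; apply/orP; right; apply: subset_leq_card; apply/fintype.subsetP => T.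
rewrite !inE => /andP[-> /asboolP[A' [B' [hD' [_ hs']]]]]; rewrite andbT.
have [eA eB] := datum_inj hD hD'; move: hs'; rewrite -eA -eB => hs'.
apply/fintype.subsetP => i; rewrite inE => /(fsubsetP hs')/imfsetP[j /= jT [e]].
by rewrite (val_inj e).
Qed.

(** A triple of [fam] consists of a size S, a rank tau and a lower bound for the sumsets to be
    avoided at that price. *)
Theorem avoid n m (fam : seq (nat * nat * nat)) : (m <= n)%N -> (0 < n)%N ->
  \sum_(t <- fam) #|{: datum n t.1.1 t.1.2}|%:R * ((m%:R / n%:R) ^+ t.2 : R) < 1 ->
  exists T : {fset nat}, [/\ T `<=` interval1 n, #|` T| = m &
    forall t, t \in fam -> forall A B, cert n t.1.1 t.1.2 A B ->
      (t.2 <= #|` sumset A B|)%N -> ~ (sumset A B `<=` T)].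
Proof.
move=> mn n0 hsum.
pose bad (t : nat * nat * nat) (D : datum n t.1.1 t.1.2) :=
  [set T : {set 'I_n} | (#|T| == m) && `[< exists A B, isdatum D A B /\ badpair t A B T >]].
have [T [cT hT]] : exists T : {set 'I_n}, #|T| = m /\
   forall t, t \in fam -> forall D : datum n t.1.1 t.1.2, T \notin bad t D.
  apply: contrapT => no.
  have cov (T : {set 'I_n}) : #|T| = m -> (1 <= \sum_(t <- fam) \sum_(D : datum n t.1.1 t.1.2) (T \in bad t D))%N.
    move=> cT; rewrite lt0n; apply/negP => /eqP z; apply: no; exists T; split => // t tf D.
    apply/negP => TD; move: z; apply/eqP; rewrite -lt0n.
    rewrite (big_rem t) //= (bigD1 D) //= TD; lia.
  have cov2 : ('C(n, m) <= \sum_(t <- fam) \sum_(D : datum n t.1.1 t.1.2) #|bad t D|)%N.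
    have -> : 'C(n, m) = #|[set T : {set 'I_n} | #|T| == m]|.
      rewrite -[in LHS](card_ord n) -cardsT -cards_draws; congr #|pred_of_set _|.
      by apply/finset.setP => T; rewrite !inE finset.subsetT.
    rewrite -sum1_card; apply: leq_trans (_ : \sum_(T in [set T : {set 'I_n} | #|T| == m])
      \sum_(t <- fam) \sum_(D : datum n t.1.1 t.1.2) (T \in bad t D) <= _)%N.
      by apply: leq_sum => T; rewrite inE => /eqP /cov.
    rewrite exchange_big; apply: leq_sum => t _; rewrite exchange_big; apply: leq_sum => D _.
    rewrite -sum1_card [leqRHS]big_mkcond [leqLHS]big_mkcond; apply: leq_sum => T _ /=.
    by case: ifP => // _; case: (_ \in bad t D).
  have C0 : (0 : R) < 'C(n, m)%:R by rewrite ltr0n bin_gt0.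
  have : ('C(n, m)%:R : R) <= (\sum_(t <- fam) #|{: datum n t.1.1 t.1.2}|%:R * ((m%:R / n%:R) ^+ t.2 : R)) * 'C(n, m)%:R.
    apply: (@le_trans _ _ (\sum_(t <- fam) \sum_(D : datum n t.1.1 t.1.2) #|bad t D|)%N%:R).
      by rewrite ler_nat.
    rewrite natr_sum big_distrl /=; apply: ler_sum => t _; rewrite natr_sum.
    rewrite -mulrA mulr_natl -sumr_const; apply: ler_sum => D _.
    have nn : (0 : R) < n%:R ^+ t.2 by rewrite exprn_gt0 // ltr0n.
    rewrite exprMn exprVn mulrAC ler_pdivlMr // -!natrX -!natrM ler_nat.
    exact: count_datum.
  by rewrite -[leLHS]mul1r ler_pM2r // leNgt hsum.
exists (tofs T); split; [exact: tofs_sub|by rewrite card_tofs|].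
move=> t tf A B /cert_datum[D hD] hq hs; have := hT t tf D; rewrite inE cT eqxx /=.
by move/negP; apply; apply/asboolP; exists A, B.
Qed.
End Union.

(** * Every pair of large sets contains a certified pair *)

Lemma card_fsum_le (T1 T2 : choiceType) (T : choiceType) (A B : {fset T}) (f : T -> T -> T1) (g : T -> T -> T2) :
  (forall a a' b b', a \in A -> a' \in A -> b \in B -> b' \in B -> f a b = f a' b' -> g a b = g a' b') ->
  (#|` fsum g A B| <= #|` fsum f A B|)%N.
Proof.
move=> h; pose s := [seq (a, b) | a <- A, b <- B].
have [->|/fset0Pn[z0 /fsumP[a0 [b0 [aA bB _]]]]] := eqVneq (fsum g A B) fset0.
  by rewrite cardfs0.
pose k (z : T1) : T2 := let p := nth (a0, b0) s (find (fun p => f p.1 p.2 == z) s) in g p.1 p.2.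
have hk a b : a \in A -> b \in B -> g a b = k (f a b).
  move=> aA' bB'; rewrite /k.
  have hs : has (fun p => f p.1 p.2 == f a b) s.
    by apply/hasP; exists (a, b) => //; apply: allpairs_f.
  have /= /eqP e := nth_find (a0, b0) hs.
  move: hs; rewrite has_find => hs; have := mem_nth (a0, b0) hs.
  move: e; case: (nth _ _ _) => a1 b1 /= e /allpairsP[[x y] /= [xA yB [ex ey]]].
  by apply: h; rewrite ?ex ?ey // -ex -ey e.
apply: (@leq_trans #|` [fset k z | z in fsum f A B]|); last exact: leq_imfset_card.
apply: fsubset_leq_card; apply/fsubsetP => z /fsumP[a [b [aA' bB' ->]]].
rewrite hk //; apply/imfsetP; exists (f a b) => //=; apply/fsumP; exists a, b; by [].
Qed.

Section RobustSub.
Variable vT : vectType rat.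
Implicit Types A B : {fset vT}.

Definition robust rho A B := forall A1 B1, A1 `<=` A -> B1 `<=` B ->
  (#|` A| <= #|` A1| + rho)%N -> (#|` B| <= #|` B1| + rho)%N ->
  (\dim (Dsp A + Dsp B) <= \dim (Dsp A1 + Dsp B1))%N.

(** Each failure of robustness lowers the dimension and costs at most [rho] elements on each
    side. *)
Lemma robust_sub rho A B : exists A1 B1, [/\ A1 `<=` A, B1 `<=` B,
  (#|` A| <= #|` A1| + \dim (Dsp A + Dsp B) * rho)%N,
  (#|` B| <= #|` B1| + \dim (Dsp A + Dsp B) * rho)%N & robust rho A1 B1].
Proof.
have [n] := ubnP (\dim (Dsp A + Dsp B)); elim: n A B => // n IH A B hn.
have [r|nr] := pselect (robust rho A B).
  by exists A, B; split; rewrite ?fsubset_refl ?leq_addr.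
have [[A1 [B1 [[sA sB cA cB] lt]]]|no] := pselect (exists A1 B1, [/\ A1 `<=` A, B1 `<=` B,
  (#|` A| <= #|` A1| + rho)%N & (#|` B| <= #|` B1| + rho)%N] /\
  (\dim (Dsp A1 + Dsp B1) < \dim (Dsp A + Dsp B))%N); last first.
  exfalso; apply: nr => A1 B1 sA sB cA cB; rewrite leqNgt; apply/negP => lt; apply: no.
  by exists A1, B1.
have [|A2 [B2 [sA2 sB2 cA2 cB2 r]]] := IH A1 B1; first by apply: leq_trans lt _.
exists A2, B2; split => //.
- exact: fsubset_trans sA2 sA.
- exact: fsubset_trans sB2 sB.
- move: cA cA2 lt; move: #|` _| #|` _| #|` _| (\dim _) (\dim _); clear; nia.
- move: cB cB2 lt; move: #|` _| #|` _| #|` _| (\dim _) (\dim _); clear; nia.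
Qed.

Lemma dim_pair_gt0 A B : (1 < #|` A|)%N -> (0 < \dim (Dsp A + Dsp B))%N.
Proof.
move=> A1; rewrite lt0n dimv_eq0; apply/negP => /eqP e.
have /fset0Pn[a aA] : A != fset0 by rewrite -cardfs_gt0; lia.
suff : A `<=` [fset a] by move/fsubset_leq_card; rewrite cardfs1 leqNgt A1.
apply/fsubsetP => x xA; rewrite inE -subr_eq0 -memv0 -e.
by apply: (subvP (addvSl _ _)); apply: mem_Dsp.
Qed.
End RobustSub.

Lemma sumsetE (A B : {fset nat}) : fsum addn A B = sumset A B.
Proof. by []. Qed.

Lemma card_subset (T : choiceType) (A : {fset T}) k : (k <= #|` A|)%N ->
  exists2 A1 : {fset T}, A1 `<=` A & #|` A1| = k.
Proof.
move=> kA; exists [fset x in take k A].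
  by apply/fsubsetP => x; rewrite inE; apply: mem_take.
rewrite card_fseq undup_id ?take_uniq ?fset_uniq // size_take; case: ltnP => //.
by move=> h; apply/eqP; rewrite eqn_leq h kA.
Qed.

Section Whole.
Variables (n k : nat) (A B : {fset nat}).
Hypotheses (bA : bounded n A) (bB : bounded n B) (cA : #|` A| = k) (cB : #|` B| = k) (k0 : (0 < k)%N).

(** (A, B) is closed over itself. The rank is the dimension plus 2, the very factor in
    [freiman_weak]; the size is 2 k because [cert_real] adds the sizes of X and A'. *)
Lemma whole_cert : exists tau, [/\ cert n (2 * k) tau A B, (tau * k <= 2 * #|` sumset A B|)%N &
  (1 < tau <= 2 * k)%N].
Proof.
have A0 : A != fset0 by rewrite -cardfs_gt0 cA.
have B0 : B != fset0 by rewrite -cardfs_gt0 cB.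
have [/fset0Pn[a0 a0A] /fset0Pn[b0 b0B]] := (A0, B0).
have hA a : a \in A -> attl A B a by move=> aA; exists (a, b0, b0).
have hB b : b \in B -> attr A B b by move=> aA; exists (a0, b, a0).
have hc : closed A B A B.
  move=> a a' b b' phi psi aA a'A b_B b'B h; exists phi, psi; split => //; apply: homS h.
    by apply/fsubsetP => x; rewrite !inE => /or3P[|/eqP->|/eqP->].
  by apply/fsubsetP => x; rewrite !inE => /or3P[|/eqP->|/eqP->].
have [d [v [w [iso link]]]] := realization bA bB hA hB hc.
pose A1 := [fset v a | a in A]; pose B1 := [fset w b | b in B].
have cA1 : #|` A1| = k.
  rewrite card_in_imfset // => a a' aA a'A e.
  have /iso : v a + w b0 = v a' + w b0 by rewrite e.
  by move=> /(_ aA a'A b0B b0B)/eqP; rewrite eqn_add2r => /eqP.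
have cB1 : #|` B1| = k.
  rewrite card_in_imfset // => a a' aA a'A e.
  have /iso : v a0 + w a = v a0 + w a' by rewrite e.
  by move=> /(_ a0A a0A aA a'A)/eqP; rewrite eqn_add2l => /eqP.
have hs : (#|` sumv A1 B1| <= #|` sumset A B|)%N.
  apply: leq_trans (card_fsum_le (f := addn) (g := fun a b => v a + w b) _).
    apply: fsubset_leq_card; apply/fsubsetP => z /sumvP[_ [_ [/imfsetP[a /= aA ->] /imfsetP[b /= b_B ->] ->]]].
    by apply/fsumP; exists a, b.
  by move=> a a' b b' aA a'A b_B b'B /iso; apply.
exists (\dim (Dsp A1 + Dsp B1)).+2; split.
- apply: (@cert_real n d v w A B A B) => //.
  + by move=> a aA; apply: in_imfset.
  + by move=> a aA; apply: in_imfset.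
  + by rewrite cA; lia.
  + by rewrite cB; lia.
- have := @freiman_weak _ A1 B1; rewrite cA1 cB1 => /(_ k0 erefl) h.
  by apply: leq_trans h _; rewrite leq_mul2l hs orbT.
- have := @dim_pair_le _ A1 B1; rewrite cA1 cB1 -!cardfs_gt0 cA1 cB1 => /(_ k0 k0).
  by rewrite mul2n addnn.
Qed.
End Whole.

(** * Choice of parameters as powers of b *)

Section Arith.
Local Open Scope nat_scope.
Variables (k b : nat).
Hypotheses (hb : 32 <= b) (hk : b ^ 30 <= k).
(** [rho] is the unit of deletion. Sampling uses b^4 and b^8 representations, a good element has at
    most b^13 unpopular partners, and the thresholds for heavy cosets run from b^14 to b^29; b^30 <=
    k leaves room above all of them. *)
Let rho := k %/ b ^ 3.

Let b0 : 0 < b. Proof. exact: leq_trans hb. Qed.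
Let eb i : 0 < b ^ i. Proof. by rewrite expn_gt0 b0. Qed.

Lemma rho_le : rho * b ^ 3 <= k. Proof. exact: leq_trunc_div. Qed.
Lemma rho_gt : k < rho.+1 * b ^ 3. Proof. by rewrite ltn_ceil. Qed.
Lemma pow_le_rho i : i <= 27 -> b ^ i <= rho.
Proof.
move=> hi; rewrite /rho leq_divRL // -expnD; apply: leq_trans hk.
by rewrite leq_pexp2l //; lia.
Qed.
(** 32 = 5 (3 + 3) + 2: the closure of two sets of size 3 [rho], together with a subset of size 2
    [rho]. *)
Lemma rho32 : 32 * rho <= k %/ b ^ 2.
Proof.
rewrite leq_divRL //; apply: leq_trans rho_le; rewrite mulnAC mulnC leq_mul2l [b ^ 3]expnS.
by rewrite leq_mul2r hb !orbT.
Qed.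
Lemma sample_size1 m : m <= k -> b ^ 4 * (b * (m %/ b ^ 8).+1) <= 2 * rho.
Proof.
move=> mk; rewrite mulnA -expnSr mulnS mulSn mul1n leq_add ?pow_le_rho //.
rewrite /rho leq_divRL // mulnAC -expnD mulnC; apply: leq_trans mk.
exact: leq_trunc_div.
Qed.
Lemma sample_size2 m : m <= k -> b * (m %/ b ^ 4).+1 <= 2 * rho.
Proof.
move=> mk; rewrite mulnS mulSn mul1n leq_add //; first by rewrite -[X in X <= _]expn1 pow_le_rho.
rewrite /rho leq_divRL // mulnAC -expnS mulnC; apply: leq_trans mk.
exact: leq_trunc_div.
Qed.
(** The exceptional elements number at most (b^8 + b^4) k b / b^13, about k / b^4, which is small
    against [rho]. *)
Lemma good_size x y s : x * b ^ 13 <= y * b ^ 13 + (b ^ 8 + b ^ 4) * s -> s <= k * b -> x <= y + rho.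
Proof.
move=> h hs; rewrite leqNgt; apply/negP => lt.
have h1 : rho.+1 * b ^ 13 <= (b ^ 8 + b ^ 4) * s.
  have : (y + rho.+1) * b ^ 13 <= x * b ^ 13 by rewrite leq_mul2r addnS lt orbT.
  rewrite mulnDl; move: h; move: (y * _) (x * _) (_ * s) (rho.+1 * _) => u1 u2 u3 u4; clear; lia.
have h2 : (b ^ 8 + b ^ 4) * s <= (2 * b ^ 8) * (k * b).
  by rewrite leq_mul // mul2n -addnn leq_add2l leq_pexp2l.
have h3 : (2 * b ^ 8) * (k * b) < (2 * b ^ 8) * (rho.+1 * b ^ 3 * b).
  have p0 : 0 < 2 * b ^ 8 by rewrite muln_gt0 eb.
    by rewrite (ltn_pmul2l p0) (ltn_pmul2r b0) rho_gt.
have h4 : (2 * b ^ 8) * (rho.+1 * b ^ 3 * b) <= rho.+1 * b ^ 13.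
  rewrite (_ : _ * _ = 2 * (rho.+1 * b ^ 12)); last by rewrite !expnS expn0; ring.
  by rewrite [b ^ 13]expnS [leqRHS]mulnCA leq_mul2r (leq_trans _ hb) ?orbT.
by move: (leq_ltn_trans (leq_trans h1 h2) (leq_trans h3 h4)); rewrite ltnn.
Qed.
End Arith.

(** * Certificates for pairs with small sumset *)

Section LowCore.
Variables (vT : vectType rat) (k b : nat).
Hypotheses (hb : (32 <= b)%N) (hk : (b ^ 30 <= k)%N) (hl : (k * b < 2 ^ b)%N).
Let rho := (k %/ b ^ 3)%N.
Let b0 : (0 < b)%N. Proof. exact: leq_trans hb. Qed.
Let eb i : (0 < b ^ i)%N. Proof. by rewrite expn_gt0 b0. Qed.

(** [freiman_weak] bounds the dimension by O(b), so robustness costs only O(b [rho]) = O(k / b^2)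
    elements. The good elements of the robust pair satisfy the hypotheses of [robust_popular], and a
    small sample realizes all the popular sums that it counts. *)
Lemma low_core (A B : {fset vT}) : #|` A| = (k - rho)%N -> #|` B| = (k - rho)%N ->
  (#|` sumv A B| <= k * b)%N ->
  exists A1 B1 X Y, [/\ A1 `<=` A, B1 `<=` B, X `<=` A1 & Y `<=` B1] /\
   [/\ (#|` X| <= 2 * rho)%N, (#|` Y| <= 2 * rho)%N, ((\dim (Dsp A1 + Dsp B1)).+2 <= 3 * b)%N &
    (b.-1 * b.-1 * (\dim (Dsp A1 + Dsp B1)).+2 * k <= 3 * b * b * #|` sumv X Y|)%N].
Proof.
move=> cA cB cS.
have rk : (rho * b ^ 3 <= k)%N := rho_le k b.
have rk2 : ((6 * b + 4) * rho * b <= k)%N.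
  apply: leq_trans rk; rewrite mulnAC mulnC leq_mul2l; apply/orP; right.
  by rewrite !expnS expn0 muln1; clear -hb; nia.
have rp i : (i <= 27)%N -> (b ^ i <= rho)%N := pow_le_rho hb hk (i := i).
(* Tolerance 2 [rho]: one [rho] for passing to the good elements, the other for [robust_popular]. *)
have [A1 [B1 [sA sB dA dB rob]]] := robust_sub (2 * rho) A B.
have A_0 : (0 < k - rho)%N.
  have := rp 0%N isT; move: rk2; rewrite expn0; clear -hb; nia.
have d0 : ((\dim (Dsp A + Dsp B)).+2 <= 3 * b)%N.
  have := @freiman_weak _ A B; rewrite cA cB => /(_ A_0 erefl) h.
  have : ((\dim (Dsp A + Dsp B)).+2 * (k - rho) <= 3 * b * (k - rho))%N.
    apply: leq_trans h _; apply: leq_trans (_ : 2 * (k * b) <= _)%N; first by rewrite leq_mul2l cS.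
    move: rk2; clear -hb; nia.
  by rewrite leq_pmul2r.
have d1 : (\dim (Dsp A1 + Dsp B1) <= \dim (Dsp A + Dsp B))%N by apply: dimvS; rewrite addvS // DspS.
have c1 (C C1 : {fset vT}) : #|` C| = (k - rho)%N -> (#|` C| <= #|` C1| + \dim (Dsp A + Dsp B) * (2 * rho))%N ->
    (k - rho - 6 * b * rho <= #|` C1|)%N.
  move=> -> h; have : (\dim (Dsp A + Dsp B) * (2 * rho) <= 6 * b * rho)%N.
    by move: d0; move: (\dim _) => dd; clear; nia.
  move: h; move: (_ * (2 * rho))%N #|` _|; clear; lia.
have cA1 := c1 _ _ cA dA; have cB1 := c1 _ _ cB dB.
have cA1' : (#|` A1| <= k)%N by apply: leq_trans (fsubset_leq_card sA) _; rewrite cA leq_subr.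
have cB1' : (#|` B1| <= k)%N by apply: leq_trans (fsubset_leq_card sB) _; rewrite cB leq_subr.
pose f : vT -> vT -> vT := +%R.
have fl y : injective (f^~ y) by apply: addIr.
have fr x : injective (f x) by apply: addrI.
have cS1 : (#|` fsum f A1 B1| <= k * b)%N.
  by apply: leq_trans cS; apply: fsubset_leq_card; apply: sumvS.
pose Rp := (b ^ 8 + b ^ 4)%N; pose D := (b ^ 13)%N.
pose P := popular f Rp A1 B1.
pose A2 := goodl f Rp D A1 B1; pose B2 := goodr f Rp D A1 B1.
have cA2 : (#|` A1| <= #|` A2| + rho)%N by apply: (good_size hb _ cS1); apply: card_goodl.
have cB2 : (#|` B1| <= #|` B2| + rho)%N by apply: (good_size hb _ cS1); apply: card_goodr.
have sA2 : A2 `<=` A1 by apply/fsubsetP => x; rewrite !inE => /andP[].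
have sB2 : B2 `<=` B1 by apply/fsubsetP => x; rewrite !inE => /andP[].
have dd : \dim (Dsp A2 + Dsp B2) = \dim (Dsp A1 + Dsp B1).
  apply/eqP; rewrite eqn_leq; apply/andP; split; first by apply: dimvS; rewrite addvS // DspS.
  by apply: rob => //; [apply: leq_trans cA2 _|apply: leq_trans cB2 _]; rewrite leq_add2l mul2n -addnn leq_addr.
pose kap := (k - 2 * rho - 6 * b * rho)%N.
have kA2 : (kap <= #|` A2|)%N.
  by move: cA1 cA2; rewrite /kap; move: #|` _| #|` _|; clear; lia.
have kB2 : (kap <= #|` B2|)%N.
  by move: cB1 cB2; rewrite /kap; move: #|` _| #|` _|; clear; lia.
have kk : (b.-1 * k <= b * (kap - 2 * rho))%N.
  rewrite /kap; move: rk2; case: (b) hb => // n _ /=; clear; nia.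
have kb29 : (b ^ 14 * b ^ (5 * 3) < kap)%N.
  rewrite -expnD /=; apply: (@leq_trans (2 * b ^ 29)).
    by rewrite mul2n -addnn -addn1 leq_add2l.
  rewrite -(leq_pmul2l b0); apply: leq_trans (_ : b * (kap - 2 * rho) <= _)%N; last first.
    by rewrite leq_mul2l leq_subr orbT.
  apply: leq_trans kk; rewrite mulnCA -expnS; apply: leq_mul hk.
  by clear -hb; lia.
have k2 : (k <= 2 * rho * b ^ 3)%N.
  have h := ltnW (@rho_gt k b hb); apply: (leq_trans h); apply: leq_mul => //; rewrite -/rho.
  by have := rp 0%N isT; rewrite expn0; clear; lia.
have hRL : (b.-1 * (\dim (Dsp A2 + Dsp B2)).+2 * (kap - 2 * rho) <= 3 * b * #|` P `&` sumv A2 B2|)%N.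
  (* Here T = k b <= 2 [rho] b^4. So thresholds at ratio b^5 satisfy the gap condition, since 20 <=
     b, and L = 4 b^4 gives 2 T <= L [rho]. *)
  apply: (@robust_popular _ A2 B2 P D (fun i => b ^ 14 * b ^ (5 * i))%N (4 * b ^ 4) b kap (k * b) rho).
  - exact: leq_trans hb.
  - by rewrite muln_gt0 eb.
  - apply: dim_pair_gt0; apply: leq_trans kA2; apply: leq_ltn_trans kb29.
    by rewrite muln_gt0 !eb.
  - by rewrite muln0 expn0 muln1; apply: (@leq_trans (b ^ 1)); [rewrite expn1 (leq_trans _ hb)|rewrite leq_pexp2l].
  - by move=> i j ij; rewrite leq_mul2l leq_pexp2l ?orbT // leq_mul2l ij.
  - move=> i; have -> : (b * D * (4 * b ^ 4) = 4 * b ^ 18)%N by rewrite /D !expnS; ring.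
    apply: (@leq_trans (b * b ^ 18)); first by rewrite leq_mul2r (leq_trans _ hb) ?orbT.
    by rewrite -expnS mulnS expnD mulnA -expnD leq_pmulr.
  - move=> i; rewrite mulnS expnD; set r := (b ^ 14 * b ^ (5 * i))%N.
    have r1 : (D <= r)%N by apply: (@leq_trans (b ^ 14)); rewrite /D ?leq_pexp2l // leq_pmulr.
    have r0 : (0 < r)%N by apply: leq_trans r1; rewrite /D eb.
    apply: (@leq_trans ((5 * r) * (2 * (2 * rho * b ^ 3 * b)))%N).
      apply: leq_mul; first by clear -r1 r0; lia.
      by rewrite leq_mul2l leq_mul2r k2 !orbT.
    have -> : (5 * r * (2 * (2 * rho * b ^ 3 * b)) = 20 * (r * rho * b ^ 4))%N by rewrite !expnS; ring.
    have -> : (rho * (b ^ 14 * (b ^ 5 * b ^ (5 * i))) = b * (r * rho * b ^ 4))%N.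
      by rewrite /r !(expnS b 4) !expnS; ring.
    by rewrite leq_mul2r (leq_trans _ hb) ?orbT.
  - apply: (@leq_trans (2 * (2 * rho * b ^ 3 * b))%N); first by rewrite leq_mul2l leq_mul2r k2 !orbT.
    by rewrite leq_eqVlt; apply/orP; left; apply/eqP; rewrite !expnS; ring.
  - rewrite dd; apply: leq_trans (rp 2 isT); move: d0 d1.
    by move: (\dim _) (\dim _); rewrite !expnS expn0 muln1; clear -hb; nia.
  - exact: kb29.
  - move=> a; rewrite !inE => /andP[_ h]; apply: leq_trans h; exact: count_fset_sub.
  - move=> c; rewrite !inE => /andP[_ h]; apply: leq_trans h.
    apply: leq_trans (count_fset_sub _ sA2) _; rewrite leq_eqVlt; apply/orP; left; apply/eqP.
    by apply: eq_count => a; rewrite /f addrC.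
  - exact: kA2.
  - exact: kB2.
  - apply: leq_trans cS1; apply: fsubset_leq_card; apply: fsubset_trans (fsubsetIr _ _) _.
    exact: sumvS.
  - move=> A3 B3 sA3 sB3 cA3 cB3; rewrite dd; apply: rob.
    + exact: fsubset_trans sA2.
    + exact: fsubset_trans sB2.
    + by move: cA2 cA3; move: #|` _| #|` _| #|` _|; clear; lia.
    + by move: cB2 cB3; move: #|` _| #|` _| #|` _|; clear; lia.
have [||z zP||X [Y [sX sY cX cY sP]]] := @sample _ _ f fl fr A1 B1 P (b ^ 8) (b ^ 4) b.
- exact: eb.
- exact: eb.
- by move: zP; rewrite !inE => /andP[].
- apply: leq_ltn_trans hl; apply: leq_trans cS1; apply: fsubset_leq_card.
  by apply/fsubsetP => x; rewrite !inE => /andP[].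
exists A1, B1, X, Y; split => //; split.
- by apply: leq_trans cX _; apply: sample_size1.
- by apply: leq_trans cY _; apply: sample_size2.
- by apply: leq_trans d0; rewrite !ltnS.
rewrite dd in hRL; set t := (\dim _).+2 in hRL *.
have h1 : (#|` P `&` sumv A2 B2| <= #|` sumv X Y|)%N.
  by apply: fsubset_leq_card; apply: fsubset_trans (fsubsetIl _ _) sP.
move: hRL h1 kk; move: #|` _| #|` _| (kap - 2 * rho)%N => q p m; clear => h1 h2 h3.
have h4 : (b.-1 * t * (b.-1 * k) <= b.-1 * t * (b * m))%N by rewrite leq_mul2l h3 orbT.
have h5 : (b * (b.-1 * t * m) <= b * (3 * b * q))%N.
  rewrite leq_mul2l; apply/orP; right; apply: leq_trans h1 _; by rewrite leq_mul2l h2 orbT.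
have e1 : (b.-1 * b.-1 * t * k = b.-1 * t * (b.-1 * k))%N by ring.
have e2 : (b.-1 * t * (b * m) = b * (b.-1 * t * m))%N by ring.
have e3 : (b * (3 * b * q) = 3 * b * b * q)%N by ring.
by rewrite e1 -e3; apply: leq_trans h4 _; rewrite e2.
Qed.
End LowCore.

Section LowCert.
Variables (n k b : nat).
Hypotheses (hb : (32 <= b)%N) (hk : (b ^ 30 <= k)%N) (hl : (k * b < 2 ^ b)%N).
Let rho := (k %/ b ^ 3)%N.
Let b0 : (0 < b)%N. Proof. exact: leq_trans hb. Qed.
Let eb i : (0 < b ^ i)%N. Proof. by rewrite expn_gt0 b0. Qed.

(** More than half of V suits each z, so [hit_all] needs at most two elements in each of its b
    rounds. *)
Lemma hit_good (V Z : {fset nat}) (Sd : nat -> nat -> bool) : #|` V| = k -> (#|` Z| <= k)%N ->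
  (forall z, z \in Z -> (count (fun v => ~~ Sd z v) V <= b ^ 13)%N) ->
  exists H : {fset nat}, [/\ H `<=` V, (#|` H| <= rho)%N & forall z, z \in Z -> exists2 v, v \in H & Sd z v].
Proof.
move=> cV cZ hS.
have hD : (2 * b ^ 13 < k)%N.
  apply: leq_trans hk; apply: leq_trans (_ : b ^ 14 < _)%N; last by rewrite ltn_exp2l // (leq_trans _ hb).
  by rewrite ltnS expnS leq_mul2r (leq_trans _ hb) ?orbT.
have [|||H [sH cH hH]] := @hit_all _ _ V Sd Z (k - b ^ 13) b.
- by move: hD; clear; lia.
- move=> z /hS; have := count_predC (Sd z) V; rewrite cV /predC /=.
  by move: (count _ _) (count _ _) => x y; clear; lia.
- apply: leq_ltn_trans hl; apply: leq_trans cZ _; exact: leq_pmulr.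
exists [fset x in H]; split.
- by apply/fsubsetP => x; rewrite inE; apply: sH.
- rewrite card_fseq; apply: leq_trans (size_undup _) _; apply: leq_trans cH _; rewrite cV.
  apply: (@leq_trans (b * 2)).
    rewrite leq_mul2l; apply/orP; right; rewrite ltnS -ltnS ltn_divLR; last by move: hD; clear; lia.
    by move: hD; clear; lia.
  apply: leq_trans (pow_le_rho hb hk (isT : 2 <= 27)%N).
  by rewrite !expnS expn0 muln1 leq_mul2l (leq_trans _ hb) ?orbT.
- by move=> z /hH/hasP[v vH Sv]; exists v => //; rewrite inE.
Qed.

(** The sample in the integers attaches most of A and B to a few elements; its closure realizes them
    in a vector space, where [low_core] finds a subpair. This is pulled back: coincidences of sums
    are the same on both sides, and the rank is read off from the ambient A1, B1. *)
Lemma low_cert (A B : {fset nat}) : bounded n A -> bounded n B -> #|` A| = k -> #|` B| = k ->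
  (#|` sumset A B| <= k * b)%N ->
  exists tau A' B', [/\ A' `<=` A, B' `<=` B, cert n (k %/ b ^ 2) tau A' B', (1 < tau <= 3 * b)%N &
    (b.-1 * b.-1 * tau * k <= 3 * b * b * #|` sumset A' B'|)%N].
Proof.
move=> bA bB cA cB cS.
pose f : nat -> nat -> nat := addn.
have fl y : injective (f^~ y) by apply: addIn.
have fr x : injective (f x) by apply: addnI.
pose Rp := (b ^ 8 + b ^ 4)%N; pose D := (b ^ 13)%N.
pose P := popular f Rp A B.
have sPS : P `<=` fsum f A B by apply/fsubsetP => x; rewrite !inE => /andP[].
have [||z zP||X [Y [sX sY cX cY sP]]] := @sample _ _ f fl fr A B P (b ^ 8) (b ^ 4) b.
- exact: eb.
- exact: eb.
- by move: zP; rewrite !inE => /andP[].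
- by apply: leq_ltn_trans hl; apply: leq_trans cS; apply: fsubset_leq_card.
have {}cX : (#|` X| <= 2 * rho)%N by apply: leq_trans cX _; apply: sample_size1; rewrite ?cA.
have {}cY : (#|` Y| <= 2 * rho)%N by apply: leq_trans cY _; apply: sample_size2; rewrite ?cB.
have cGA : (#|` A| <= #|` goodl f Rp D A B| + rho)%N by apply: (good_size hb _ cS); apply: card_goodl.
have cGB : (#|` B| <= #|` goodr f Rp D A B| + rho)%N by apply: (good_size hb _ cS); apply: card_goodr.
have [|AA sAA cAA] := @card_subset _ (goodl f Rp D A B) (k - rho).
  by rewrite leq_subLR addnC -cA.
have [|BB sBB cBB] := @card_subset _ (goodr f Rp D A B) (k - rho).
  by rewrite leq_subLR addnC -cB.
have sGA : AA `<=` A by apply: fsubset_trans sAA _; apply/fsubsetP => x; rewrite !inE => /andP[].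
have sGB : BB `<=` B by apply: fsubset_trans sBB _; apply/fsubsetP => x; rewrite !inE => /andP[].
have [|z /(fsubsetP sAA)|HB [sHB cHB hHB]] := @hit_good B AA (fun a y => f a y \in P) cB.
- by rewrite cAA leq_subr.
- by rewrite !inE => /andP[].
have [|z /(fsubsetP sBB)|HA [sHA cHA hHA]] := @hit_good A BB (fun c x => f x c \in P) cA.
- by rewrite cBB leq_subr.
- by rewrite !inE => /andP[].
(* For a good a some y in [HB] makes a + y popular, hence a sum of X and Y: this attaches a. [HA]
   does the same for the other side. *)
pose X0 := X `|` HA; pose Y0 := Y `|` HB.
have sX0 : X0 `<=` A by rewrite fsubUset sX sHA.
have sY0 : Y0 `<=` B by rewrite fsubUset sY sHB.
have cX0 : (#|` X0| <= 3 * rho)%N.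
  rewrite cardfsU; apply: leq_trans (leq_subr _ _) _.
  by move: cX cHA; rewrite -/rho; clear; lia.
have cY0 : (#|` Y0| <= 3 * rho)%N.
  rewrite cardfsU; apply: leq_trans (leq_subr _ _) _.
  by move: cY cHB; rewrite -/rho; clear; lia.
have hA a : a \in AA -> attl X0 Y0 a.
  move=> /hHB[y yH /(fsubsetP sP)/fsumP[x' [y' [x'X y'Y e]]]].
  by exists (x', y', y); split; rewrite ?inE ?x'X ?y'Y ?yH ?orbT.
have hB c : c \in BB -> attr X0 Y0 c.
  move=> /hHA[x xH /(fsubsetP sP)/fsumP[x' [y' [x'X y'Y e]]]].
  by exists (x', y', x); split; rewrite ?inE ?x'X ?y'Y ?xH ?orbT.
have bS (C C' : {fset nat}) : C' `<=` C -> bounded n C -> bounded n C'.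
  by move=> s bC x /(fsubsetP s)/bC.
have [X1 [Y1 [[sX01 sY01 sX1 sY1] [c1 hc]]]] := closing (bS _ _ sX0 bA) (bS _ _ sY0 bB)
  (bS _ _ sGA bA) (bS _ _ sGB bB) hA hB.
have sX1A : X1 `<=` A by apply: fsubset_trans sX1 _; rewrite fsubUset sX0 sGA.
have sY1B : Y1 `<=` B by apply: fsubset_trans sY1 _; rewrite fsubUset sY0 sGB.
have hA1 a : a \in AA -> attl X1 Y1 a by move=> /hA; apply: attlS.
have hB1 a : a \in BB -> attr X1 Y1 a by move=> /hB; apply: attrS.
have [d [v [w [iso link]]]] := realization (bS _ _ sX1A bA) (bS _ _ sY1B bB) hA1 hB1 hc.
have kr : (0 < k - rho)%N.
  have := rho_le k b; have := pow_le_rho hb hk (isT : 0 <= 27)%N; rewrite -/rho expn0.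
  have : (2 <= b ^ 3)%N by apply: leq_trans (_ : b ^ 1 <= _)%N; rewrite ?leq_pexp2l // expn1 (leq_trans _ hb).
  by move: (b ^ 3)%N => u; clear; nia.
have /fset0Pn[a0 a0A] : AA != fset0 by rewrite -cardfs_gt0 cAA.
have /fset0Pn[c0 c0B] : BB != fset0 by rewrite -cardfs_gt0 cBB.
have injv : {in AA &, injective v}.
  move=> a a' aA a'A e.
  have /iso : v a + w c0 = v a' + w c0 by rewrite e.
  by move=> /(_ aA a'A c0B c0B)/eqP; rewrite eqn_add2r => /eqP.
have injw : {in BB &, injective w}.
  move=> a a' aA a'A e.
  have /iso : v a0 + w a = v a0 + w a' by rewrite e.
  by move=> /(_ a0A a0A aA a'A)/eqP; rewrite eqn_add2l => /eqP.
pose AV := [fset v a | a in AA]; pose BV := [fset w c | c in BB].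
pose g a c := v a + w c.
have gS (A' B' : {fset nat}) : A' `<=` AA -> B' `<=` BB -> (#|` fsum g A' B'| <= #|` sumset A' B'|)%N.
  move=> /fsubsetP sA' /fsubsetP sB'; rewrite -sumsetE; apply: card_fsum_le.
  by move=> a a' c c' aA a'A cB' c'B /iso; apply; [apply: sA'|apply: sA'|apply: sB'|apply: sB'].
have hsum : (#|` sumv AV BV| <= k * b)%N.
  apply: leq_trans cS; apply: (@leq_trans #|` sumset AA BB|).
    apply: leq_trans (gS _ _ (fsubset_refl _) (fsubset_refl _)); apply: fsubset_leq_card.
    apply/fsubsetP => z /sumvP[_ [_ [/imfsetP[a /= aA ->] /imfsetP[c /= cB' ->] ->]]].
    by apply/fsumP; exists a, c.
  apply: fsubset_leq_card; rewrite -!sumsetE; apply/fsubsetP => z /fsumP[a [c [aA cB' ->]]].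
  by apply/fsumP; exists a, c; split=> //; [exact: (fsubsetP sGA)|exact: (fsubsetP sGB)].
have cAV : #|` AV| = (k - rho)%N by rewrite card_in_imfset.
have cBV : #|` BV| = (k - rho)%N by rewrite card_in_imfset.
have [A1 [B1 [XV [YV [[sA1 sB1 sXV sYV] [cXV cYV ht hq]]]]]] := low_core hb hk hl cAV cBV hsum.
set t := (\dim _).+2 in ht hq.
pose A' := [fset a in AA | v a \in XV]; pose B' := [fset c in BB | w c \in YV].
have sA' : A' `<=` AA by apply/fsubsetP => x; rewrite !inE => /andP[].
have sB' : B' `<=` BB by apply/fsubsetP => x; rewrite !inE => /andP[].
have cA' : (#|` A'| <= 2 * rho)%N.
  apply: leq_trans cXV.
  have <- : #|` [fset v a | a in A']| = #|` A'|.
    by apply: card_in_imfset => a a' /= /(fsubsetP sA') aA /(fsubsetP sA') a'A; apply: injv.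
  by apply: fsubset_leq_card; apply/fsubsetP => _ /imfsetP[a /= + ->]; rewrite !inE => /andP[].
have cB' : (#|` B'| <= 2 * rho)%N.
  apply: leq_trans cYV.
  have <- : #|` [fset w a | a in B']| = #|` B'|.
    by apply: card_in_imfset => a a' /= /(fsubsetP sB') aA /(fsubsetP sB') a'A; apply: injw.
  by apply: fsubset_leq_card; apply/fsubsetP => _ /imfsetP[a /= + ->]; rewrite !inE => /andP[].
have hXY : (#|` sumv XV YV| <= #|` sumset A' B'|)%N.
  apply: leq_trans (gS _ _ sA' sB'); apply: fsubset_leq_card.
  apply/fsubsetP => z /sumvP[x [y [xX yY ->]]].
  have /imfsetP[a /= aA ex] := fsubsetP sA1 _ (fsubsetP sXV _ xX).
  have /imfsetP[c /= cB0 ey] := fsubsetP sB1 _ (fsubsetP sYV _ yY).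
  apply/fsumP; exists a, c; split; last by rewrite ex ey.
    by rewrite !inE; apply/andP; split => //=; rewrite -ex.
  by rewrite !inE; apply/andP; split => //=; rewrite -ey.
have {}hq : (b.-1 * b.-1 * t * k <= 3 * b * b * #|` sumset A' B'|)%N.
  by apply: leq_trans hq _; rewrite leq_mul2l hXY orbT.
(* The lower bound for the sumset is positive; so A' and B' are nonempty, as [cert_real] demands. *)
have /fset0Pn[z /fsumP[a1 [d1 [a1A d1B _]]]] : sumset A' B' != fset0.
  rewrite -cardfs_gt0; apply/negPn/negP; rewrite -eqn0Ngt => /eqP e.
  move: hq; rewrite e muln0 leqn0 !muln_eq0 /t /=; move: kr hb; case: (b) => [|[|?]] //=.
  by case: (k).
exists t, A', B'; split => //.
- exact: fsubset_trans sGA.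
- exact: fsubset_trans sGB.
- apply: (@cert_real n d v w X1 Y1 AA BB A1 B1 A' B') => //.
  + exact: bS sX1A bA.
  + exact: bS sY1B bB.
  + exact: bS sGA bA.
  + exact: bS sGB bB.
  + by apply/fset0Pn; exists a1.
  + by apply/fset0Pn; exists d1.
  + by move=> a; rewrite !inE => /andP[_ /(fsubsetP sXV)].
  + by move=> a; rewrite !inE => /andP[_ /(fsubsetP sYV)].
  + apply: leq_trans (rho32 k hb); move: c1 cX0 cY0 cA'; rewrite -/rho.
    by move: #|` X1| #|` Y1| #|` X0| #|` Y0| #|` A'|; clear; lia.
  + apply: leq_trans (rho32 k hb); move: c1 cX0 cY0 cB'; rewrite -/rho.
    by move: #|` X1| #|` Y1| #|` X0| #|` Y0| #|` B'|; clear; lia.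
Qed.
End LowCert.

Lemma bounded_interval1 n (A : {fset nat}) : A `<=` interval1 n -> bounded n A.
Proof.
move=> /fsubsetP s x /s; rewrite /interval1 inE /= mem_iota => /andP[_].
by rewrite add1n ltnS.
Qed.

Lemma sumsetS (A B A' B' : {fset nat}) : A' `<=` A -> B' `<=` B -> sumset A' B' `<=` sumset A B.
Proof.
move=> /fsubsetP sA /fsubsetP sB; apply/fsubsetP => z /(fsumP addn)[a [b [aA bB ->]]].
by apply/(fsumP addn); exists a, b; split; [exact: sA|exact: sB|].
Qed.

(* Lower bounds for the sumset of a certified pair, when |A + B| >= k b and otherwise. *)
Definition qw k b tau := maxn (k * b) (uphalf (tau * k)).
Definition ql k b tau := ((b.-1 * b.-1 * tau * k) %/ (3 * b * b))%N.

Theorem upper_comb (R : realFieldType) n m k b :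
  (32 <= b)%N -> (b ^ 30 <= k)%N -> (k * b < 2 ^ b)%N -> (m <= n)%N -> (0 < n)%N ->
  \sum_(2 <= tau < (2 * k).+1) #|{: datum n (2 * k) tau}|%:R * ((m%:R / n%:R) ^+ qw k b tau : R) +
  \sum_(2 <= tau < (3 * b).+1) #|{: datum n (k %/ b ^ 2) tau}|%:R * ((m%:R / n%:R) ^+ ql k b tau : R) < 1 ->
  exists T : {fset nat}, [/\ T `<=` interval1 n, #|` T| = m &
    forall A B : {fset nat}, A `<=` interval1 n -> B `<=` interval1 n ->
      (k <= #|` A|)%N -> (k <= #|` B|)%N -> ~ (sumset A B `<=` T)].
Proof.
move=> hb hk hl mn n0 hsum.
pose fam := [seq (2 * k, tau, qw k b tau)%N | tau <- index_iota 2 (2 * k).+1] ++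
  [seq (k %/ b ^ 2, tau, ql k b tau)%N | tau <- index_iota 2 (3 * b).+1].
have [|T [sT cT hT]] := @avoid R n m fam mn n0; first by rewrite big_cat !big_map.
exists T; split => // A B sA sB kA kB hAB.
have [A1 sA1 cA1] := card_subset kA; have [B1 sB1 cB1] := card_subset kB.
have bA : bounded n A1 by apply: bounded_interval1; apply: fsubset_trans sA.
have bB : bounded n B1 by apply: bounded_interval1; apply: fsubset_trans sB.
have sAB : sumset A1 B1 `<=` T by apply: fsubset_trans hAB; apply: sumsetS.
have k0 : (0 < k)%N by apply: leq_trans hk; rewrite expn_gt0 (leq_trans _ hb).
have [le|/ltnW ge] := leqP #|` sumset A1 B1| (k * b).
  have [tau [A' [B' [sA' sB' hc ht hq]]]] := low_cert hb hk hl bA bB cA1 cB1 le.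
  apply: (hT (k %/ b ^ 2, tau, ql k b tau)%N _ A' B') => //=.
  - by rewrite mem_cat; apply/orP; right; apply: (map_f (fun t => (k %/ b ^ 2, t, ql k b t)%N)); rewrite mem_index_iota ltnS.
  - rewrite /ql -ltnS ltn_divLR; last by move: hb; clear; nia.
    apply: leq_ltn_trans hq _; rewrite mulnC ltn_pmul2r //; move: hb; clear; nia.
  - by apply: fsubset_trans sAB; apply: sumsetS.
have [tau [hc hq ht]] := whole_cert bA bB cA1 cB1 k0.
apply: (hT (2 * k, tau, qw k b tau)%N _ A1 B1) => //=.
  by rewrite mem_cat; apply/orP; left; apply: (map_f (fun t => (2 * k, t, qw k b t)%N)); rewrite mem_index_iota ltnS.
rewrite /qw geq_max ge /= -leq_double; move: hq; rewrite -mul2n -(leq_add2r 1%N).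
have := uphalf_half (tau * k); have := odd_double_half (tau * k).
rewrite -mul2n -!mul2n => e1 e2; rewrite e2; case: (odd _) e1; move: (tau * k)%N _./2 #|` _| => u h s; clear; lia.
Qed.

(** * Common neighbourhoods in dense sets *)

Local Open Scope nat_scope.

Section KST.
Variables (T I : eqType) (S : I -> pred T) (Z : seq I) (V : seq T).

(** Each step takes the v outside B adjacent to the most remaining z. Fewer than k elements are in
    use, so every z has at least d - k others, and some v keeps a proportion (d - k) / |V|. *)
Lemma kst d k j : uniq V -> Z != [::] -> (forall z, z \in Z -> d <= count (S z) V) -> k < d -> j <= k ->
  exists B A, [/\ uniq B, {subset B <= V}, size B = j, subseq A Z &
    (forall z b, z \in A -> b \in B -> S z b)] /\ (d - k) ^ j * size Z <= size V ^ j * size A.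
Proof.
move=> uV Z0 hS kd; elim: j => [|j IH] jk.
  by exists [::], Z; split; rewrite ?expn0 //; split.
have [B [A [[uB sB cB sA h] hs]]] := IH (ltnW jk).
have A0 : A != [::].
  apply/eqP => e; move: hs; rewrite e muln0 leqn0 muln_eq0 expn_eq0 size_eq0 (negPf Z0) orbF.
  by rewrite subn_eq0 leqNgt kd.
pose V' := [seq v <- V | v \notin B].
have [||v vV hv] := @hit_one T I V' S A (d - k) _ _ A0.
- by rewrite subn_gt0.
- move=> z zA; have zZ := mem_subseq sA zA.
  rewrite leq_subLR; apply: leq_trans (hS z zZ) _.
  rewrite -size_filter -(count_predC (mem B)) leq_add //.
    rewrite -size_filter; apply: leq_trans (ltnW jk); rewrite -cB; apply: uniq_leq_size.
      by rewrite !filter_uniq.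
    by move=> x; rewrite mem_filter => /andP[].
  rewrite /V' !count_filter; apply: sub_count => x /= /andP[nB Sx].
  by rewrite Sx.
exists (v :: B), [seq a <- A | S a v]; split; first split.
- by rewrite /= uB andbT; move: vV; rewrite mem_filter => /andP[].
- by move=> x; rewrite inE => /orP[/eqP ->|/sB//]; move: vV; rewrite mem_filter => /andP[].
- by rewrite /= cB.
- by apply: subseq_trans sA; apply: filter_subseq.
- move=> z b; rewrite mem_filter inE => /andP[Sz zA] /orP[/eqP -> //|]; exact: h.
rewrite !expnS -mulnA; apply: leq_trans (_ : (d - k) * (size V ^ j * size A) <= _).
  by rewrite leq_mul2l hs orbT.
rewrite mulnCA [size V * _]mulnC -mulnA leq_mul2l size_filter; apply/orP; right.
by apply: leq_trans hv _; rewrite leq_mul2r size_filter count_size orbT.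
Qed.
End KST.

Lemma kst_sumset n l k d (S : {fset nat}) : S `<=` interval1 n -> l <= n -> k < d ->
  n * d < l * (#|` S| - l) ->
  exists A B : {fset nat}, [/\ A `<=` interval1 n, B `<=` interval1 n, sumset A B `<=` S, #|` B| = k &
   (d - k) ^ k * (l * (#|` S| - l) - n * d) <= l ^ k * (l * #|` A|)].
Proof.
move=> /fsubsetP sS ln kd hd.
pose Sr a b := a + b \in S.
pose V := iota 1 l; pose W := iota 1 n.
have hsum : l * (#|` S| - l) <= \sum_(a <- W) count (Sr a) V.
  rewrite -(sum_count_swap V Sr W).
  rewrite -[X in X * _](size_iota 1 l) -sum1_size big_distrl /= !big_seq.
  apply: leq_sum => b; rewrite mem_iota mul1n => /andP[b1 bl].
  have : #|` S| <= count (Sr^~ b) W + l.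
    pose S1 := [fset s in S | s <= b].
    have -> : #|` S| = count (fun s => ~~ (s <= b)) S + count (fun s => s <= b) S.
      by rewrite addnC -(count_predC (fun s => s <= b) S).
    apply: leq_add.
      rewrite -!size_filter -(size_map (fun s => s - b)); apply: uniq_leq_size.
        rewrite map_inj_in_uniq ?filter_uniq ?fset_uniq //.
        by move=> x y; rewrite !mem_filter => /andP[hx _] /andP[hy _]; lia.
      move=> _ /mapP[s + ->]; rewrite !mem_filter => /andP[hs sS'].
      rewrite /Sr subnK ?sS' /=; last by lia.
      by have := sS _ sS'; rewrite /interval1 inE /= !mem_iota; lia.
    rewrite -size_filter -[X in _ <= X](size_iota 1 l); apply: uniq_leq_size.
      by rewrite filter_uniq ?fset_uniq.
    by move=> s; rewrite mem_filter => /andP[hs /sS]; rewrite /interval1 inE /= !mem_iota; lia.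
  by rewrite leq_subLR addnC.
(* The average of the degrees is large because each b <= l loses at most l elements of S; the a of
   degree below d contribute at most n d in all. *)
pose Z := [seq a <- W | d <= count (Sr a) V].
have hZ : l * (#|` S| - l) <= l * size Z + n * d.
  apply: leq_trans hsum _; rewrite size_filter.
  have -> : n * d = \sum_(a <- W) d by rewrite big_const_seq count_predT iter_addn_0 size_iota mulnC.
  rewrite -sum1_count big_distrr /= [X in _ <= X + _]big_mkcond -big_split /=.
  apply: leq_sum => a _; case: (leqP d (count (Sr a) V)) => h; last by rewrite add0n ltnW.
  by rewrite muln1 -[X in X <= _]addn0 leq_add // (leq_trans (count_size _ _)) // size_iota.
have Z0 : Z != [::].
  by apply/eqP => e; move: hZ; rewrite e muln0 add0n leqNgt hd.
have [|B [A [[uB sB cB sA h] hs]]] := @kst nat nat Sr Z V d k k (iota_uniq _ _) Z0 _ kd (leqnn k).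
  by move=> z; rewrite mem_filter => /andP[].
have uA : uniq A by apply: subseq_uniq sA _; rewrite filter_uniq ?iota_uniq.
exists [fset a in A], [fset b in B]; split.
- apply/fsubsetP => a; rewrite inE => /(mem_subseq sA); rewrite mem_filter => /andP[_].
  by rewrite /interval1 inE.
- by apply/fsubsetP => a; rewrite inE => /sB; rewrite /interval1 inE /= !mem_iota; lia.
- by apply/fsubsetP => z /imfset2P[a + [b + ->]]; rewrite !inE; apply: h.
- by rewrite card_fseq undup_id.
- rewrite card_fseq undup_id //; move: hs; rewrite size_iota => hs.
  rewrite mulnCA; apply: leq_trans (_ : l * ((d - k) ^ k * size Z) <= _); last by rewrite leq_mul2l hs orbT.
  rewrite mulnCA leq_mul2l leq_subLR addnC hZ orbT //.
Qed.

Local Open Scope ring_scope.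

(** * Asymptotics *)

(** 10 = 8 + 2: four positions for each of 2 (S + 1) relations, and two subsets of the index set.
    One tau comes from the label positions, the other from n + 1 <= 8 k n. *)
Lemma leq_card_datum n S tau k : (0 < n)%N -> (0 < k)%N -> (S <= 2 * k)%N ->
  (#|{: datum n S tau}| <= (8 * k) ^ (10 * S + 10 + 2 * tau) * n ^ tau)%N.
Proof.
move=> n0 k0 hS; rewrite card_datum.
have e1 : (S.+1 <= 8 * k)%N by lia.
have e2 : (2 * S.+1 <= 8 * k)%N by lia.
have e3 : (2 <= 8 * k)%N by lia.
have e4 : (n.+1 <= 8 * k * n)%N by nia.
have ex i j m : (i <= j)%N -> (i ^ m <= j ^ m)%N by case: m => // m; rewrite leq_exp2r.
apply: (@leq_trans (((8 * k) ^ 4) ^ (S.+1 + S.+1) * ((8 * k) ^ S.+1 * (8 * k) ^ S.+1) *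
  ((8 * k) ^ tau * (8 * k * n) ^ tau))).
  by rewrite !leq_mul ?ex.
rewrite [((8 * k * n) ^ tau)%N]expnMn [((8 * k) ^ tau * (_ * n ^ tau))%N]mulnA mulnA -!expnD -expnM -!expnD.
rewrite leq_mul2r leq_eqVlt; apply/orP; right; apply/orP; left; apply/eqP.
by congr (_ ^ _)%N; lia.
Qed.

Section Upper.
Variable R : realType.

Lemma datum_expR n S tau k : (0 < n)%N -> (0 < k)%N -> (S <= 2 * k)%N ->
  (#|{: datum n S tau}|%:R : R) <=
    expR (ln (8 * k)%:R * (10 * S + 10 + 2 * tau)%:R + ln n%:R * tau%:R).
Proof.
move=> n0 k0 hS; rewrite expRD !expRM_natr !lnK ?posrE ?ltr0n ?muln_gt0 ?k0 //.
by rewrite -!natrX -natrM ler_nat; apply: leq_card_datum.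
Qed.

Lemma sum_term_le (m N : nat) (F : nat -> R) e : (forall i, (2 <= i < N)%N -> F i <= e) ->
  (N <= m)%N -> 0 <= e -> \sum_(2 <= i < N) F i <= m%:R * e.
Proof.
move=> hF Nm e0; apply: (@le_trans _ _ (\sum_(2 <= i < N) e)).
  by rewrite big_nat [leRHS]big_nat; apply: ler_sum => i; apply: hF.
rewrite sumr_const_nat -[leLHS]mulr_natl ler_wpM2r // ler_nat.
by apply: leq_trans Nm; exact: leq_subr.
Qed.

Lemma powerx (x lam : R) q : 0 < x -> lam = - ln x -> x ^+ q = expR (- lam * q%:R).
Proof. by move=> x0 ->; rewrite opprK expRM_natr lnK ?posrE. Qed.

(** Every summand is at most 1 / (8 k), and there are fewer than 8 k of them. *)
Lemma upper_sum (gamma c t lam : R) n m k b :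
  0 < gamma <= 1 -> 0 < c <= 1 -> 1 <= t -> t = ln n%:R -> (0 < n)%N -> (0 < m)%N ->
  lam = - ln (m%:R / n%:R) -> (3 + gamma / 2) * t <= k%:R * lam -> c / 2 <= lam ->
  lam <= gamma / 48 * t -> k%:R <= 5 * t / c -> (b ^ 30 <= k)%N -> (32 <= b)%N ->
  28 / gamma <= b%:R -> 35 * ln (8 * k)%:R <= c / 6 * b%:R ->
  \sum_(2 <= tau < (2 * k).+1) #|{: datum n (2 * k) tau}|%:R * ((m%:R / n%:R) ^+ qw k b tau : R) +
  \sum_(2 <= tau < (3 * b).+1) #|{: datum n (k %/ b ^ 2) tau}|%:R * ((m%:R / n%:R) ^+ ql k b tau : R) < 1.
Proof.
move=> /andP[g0 g1] /andP[c0 c1] t1 tE n0 m0 lamE h1 h2 h3 h4 hbk hb hbg hW.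
have x0 : (0 : R) < m%:R / n%:R by rewrite divr_gt0 ?ltr0n.
set x := m%:R / n%:R in lamE x0 *.
set La := ln (8 * k)%:R in hW *.
have k0 : (0 < k)%N by apply: leq_trans hbk; rewrite expn_gt0 (leq_trans _ hb).
have k1 : (1 : R) <= k%:R by rewrite ler1n.
have La0 : 0 <= La by apply: ln_ge0; rewrite ler1n muln_gt0 k0.
have bR : (32 : R) <= b%:R by rewrite ler_nat.
have eLa : expR (- La) = (8 * k)%:R^-1.
  by rewrite expRN lnK // posrE ltr0n muln_gt0 k0.
have hw tau : (2 <= tau < (2 * k).+1)%N ->
    #|{: datum n (2 * k) tau}|%:R * (x ^+ qw k b tau) <= (8 * k)%:R^-1.
  move=> /andP[t2 tk]; rewrite -eLa (powerx _ x0 lamE).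
  apply: (@le_trans _ _ (expR (La * (10 * (2 * k) + 10 + 2 * tau)%:R + ln n%:R * tau%:R) * expR (- lam * (qw k b tau)%:R))).
    by rewrite ler_wpM2r ?expR_ge0 // datum_expR.
  rewrite -expRD ler_expR -tE.
  (* The part lam tau k / 3 outweighs n^tau, while lam k b / 3 >= c k b / 6 pays for the powers of 8
     k: their exponent, the final 1 / (8 k) included, is at most (20 + 11 + 4) k = 35 k. *)
  have hq : (tau * k + k * b <= 3 * qw k b tau)%N.
    have q1 : (k * b <= qw k b tau)%N := leq_maxl _ _.
    have q2 : (tau * k <= 2 * qw k b tau)%N by rewrite mul2n -leq_uphalf_double leq_maxr.
    by move: q1 q2; move: (qw _ _ _) (tau * k)%N (k * b)%N; clear; lia.
  have hqR : tau%:R * k%:R + k%:R * b%:R <= 3 * (qw k b tau)%:R :> R.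
    by rewrite -!natrM -natrD ler_nat.
  have tkR : tau%:R <= 2 * k%:R :> R by rewrite -natrM ler_nat.
  have t2R : (2 : R) <= tau%:R by rewrite ler_nat.
  have -> : (10 * (2 * k) + 10 + 2 * tau)%:R = 20 * k%:R + 10 + 2 * tau%:R :> R.
    by rewrite mulnA -[(10 * 2)%N]/20%N natrD natrD !natrM.
  move: (tau%:R) (k%:R) (b%:R) ((qw k b tau)%:R) k1 bR hqR tkR t2R hW La0 h1 h2 => T K B Q; clear -t1 g0 c0.
  move=> K1 B1 hQ hT T2 hW L0 h1 h2.
  have lam0 : 0 <= lam by lra.
  have a1 : lam * (T * K + K * B) <= lam * (3 * Q) by rewrite ler_wpM2l.
  have a2 : T * ((3 + gamma / 2) * t) <= T * (K * lam) by rewrite ler_wpM2l //; lra.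
  have a3 : K * B * (c / 2) <= K * B * lam by rewrite ler_wpM2l //; nra.
  have a4 : K * (35 * La) <= K * (c / 6 * B) by rewrite ler_wpM2l //; lra.
  have a5 : La * T <= La * (2 * K) by rewrite ler_wpM2l.
  have a6 : La * 1 <= La * K by rewrite ler_wpM2l.
  have a7 : 0 <= T * (gamma * t) by rewrite !mulr_ge0 //; lra.
  nra.
have hs tau : (2 <= tau < (3 * b).+1)%N ->
    #|{: datum n (k %/ b ^ 2) tau}|%:R * (x ^+ ql k b tau) <= (8 * k)%:R^-1.
  move=> /andP[t2 tk]; rewrite -eLa (powerx _ x0 lamE).
  have b0 : (0 < b)%N by apply: leq_trans hb.
  have sk : (k %/ b ^ 2 <= 2 * k)%N.
    by apply: leq_trans (leq_div _ _) _; rewrite mul2n -addnn leq_addr.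
  apply: (@le_trans _ _ (expR (La * (10 * (k %/ b ^ 2) + 10 + 2 * tau)%:R + ln n%:R * tau%:R) * expR (- lam * (ql k b tau)%:R))).
    by rewrite ler_wpM2r ?expR_ge0 // datum_expR.
  rewrite -expRD ler_expR -tE.
  have S1 : (1 : R) <= (k %/ b ^ 2)%:R.
    rewrite ler1n divn_gt0 ?expn_gt0 ?b0 //; apply: leq_trans hbk; exact: leq_pexp2l.
  have S2 : (k %/ b ^ 2)%:R * (b%:R * b%:R) <= k%:R :> R.
    by rewrite -!natrM ler_nat mulnn; apply: leq_trunc_div.
  have KB : b%:R * b%:R <= k%:R :> R.
    by rewrite -!natrM ler_nat mulnn; apply: leq_trans hbk; apply: leq_pexp2l.
  have hq : (b%:R - 1) * (b%:R - 1) * tau%:R * k%:R <= 3 * b%:R * b%:R * ((ql k b tau)%:R + 1) :> R.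
    have h : (b.-1 * b.-1 * tau * k < (ql k b tau).+1 * (3 * b * b))%N.
      by rewrite /ql ltn_ceil // !muln_gt0 b0.
    have -> : (b%:R - 1 : R) = b.-1%:R by rewrite -subn1 natrB.
    by rewrite natr1 mulrC -!natrM ler_nat [leqRHS]mulnC mulnC ltnW // mulnC.
  have t2R : (2 : R) <= tau%:R by rewrite ler_nat.
  have -> : (10 * (k %/ b ^ 2) + 10 + 2 * tau)%:R = 10 * (k %/ b ^ 2)%:R + 10 + 2 * tau%:R :> R.
    by rewrite natrD natrD !natrM.
  have hbg' : 28 <= gamma * b%:R by move: hbg; rewrite ler_pdivrMr // mulrC.
  have h4' : c * k%:R <= 5 * t by move: h4; rewrite ler_pdivlMr // mulrC.
  move: hbg' h4' hW k1 bR t2R S1 S2 KB hq La0 h1 h2 h3.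
  move: (tau%:R) ((k %/ b ^ 2)%:R) (k%:R) (b%:R) ((ql k b tau)%:R) => T S K B Q.
  clear -t1 g0 g1 c0 c1 => hbg h4 hW K1 B1 T2 S1 S2 KB hQ L0 h1 h2 h3.
  have B0 : 0 < B by lra.
  have lam0 : 0 <= lam by lra.
  (* The surplus gamma / 12 tau log n pays for the rounding in [ql] and for the powers of 8 k, whose
     exponent is now only about k / b^2. *)
  have lamQ : (1 + gamma / 12) * T * t <= lam * (Q + 1).
    have e1 : (B - 2) * (T * K) <= 3 * B * (Q + 1).
      rewrite -(ler_pM2l B0); apply: le_trans (_ : (B - 1) * (B - 1) * T * K <= _); last first.
        by apply: le_trans hQ _; rewrite !mulrA [B * 3]mulrC.
      have u0 : 0 <= T * K by rewrite mulr_ge0 //; lra.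
      by rewrite -[leRHS]mulrA [leLHS]mulrA ler_wpM2r //; lra.
    have e2 : (B - 2) * T * ((3 + gamma / 2) * t) <= (B - 2) * T * (K * lam).
      by rewrite ler_wpM2l // mulr_ge0 //; lra.
    have e3 : lam * ((B - 2) * (T * K)) <= lam * (3 * B * (Q + 1)) by rewrite ler_wpM2l.
    (* This amounts to gamma B / 4 >= 6 + gamma; 28 = 4 (6 + 1). *)
    have e4 : (3 * B * (1 + gamma / 12)) * (T * t) <= (B - 2) * (3 + gamma / 2) * (T * t).
      rewrite ler_wpM2r //; first by rewrite mulr_ge0 //; lra.
      by lra.
    rewrite -(ler_pM2l (_ : 0 < 3 * B)); last by lra.
    by lra.
  have La1 : 2 * La <= gamma / 48 * t.
    have e1 : c * (B * B) <= 5 * t by apply: le_trans h4; rewrite ler_wpM2l // ltW.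
    have e2 : gamma * (c * (B * B)) <= gamma * (5 * t) by rewrite ler_wpM2l // ltW.
    have e3 : c * B * 28 <= c * B * (gamma * B) by rewrite ler_wpM2l // mulr_ge0 ?ltW.
    by lra.
  have LaS : 21 * (La * S) <= gamma / 56 * t.
    have e1 : S * (35 * La) <= S * (c / 6 * B) by rewrite ler_wpM2l //; lra.
    have e2 : c * (S * (B * B)) <= 5 * t by apply: le_trans h4; rewrite ler_wpM2l // ltW.
    have e3 : (c * S * B) * 28 <= (c * S * B) * (gamma * B).
      by rewrite ler_wpM2l // !mulr_ge0 //; lra.
    have e4 : gamma * (c * (S * (B * B))) <= gamma * (5 * t) by rewrite ler_wpM2l // ltW.
    by lra.
  have e1 : T * (2 * La) <= T * (gamma / 48 * t) by rewrite ler_wpM2l //; lra.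
  have e2 : La * 1 <= La * S by rewrite ler_wpM2l.
  have e3 : 2 * (gamma * t) <= T * (gamma * t) by rewrite ler_wpM2r // mulr_ge0 //; lra.
  by lra.
have p0 : (0 : R) <= (8 * k)%:R^-1 by rewrite invr_ge0 ler0n.
have b3 : ((3 * b).+1 <= 4 * k - 1)%N.
  have : (b * b <= k)%N by rewrite mulnn; apply: leq_trans hbk; apply: leq_pexp2l; rewrite ?(leq_trans _ hb).
  by move: hb; clear; nia.
have s1 := sum_term_le hw (leqnn _) p0.
have s2 := sum_term_le hs b3 p0.
apply: le_lt_trans (lerD s1 s2) _; rewrite -mulrDl -natrD.
rewrite ltr_pdivrMr ?ltr0n ?muln_gt0 ?k0 // mul1r ltr_nat.
by move: k0; clear; lia.
Qed.
End Upper.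

Lemma root_ex i k : (0 < i)%N -> exists b, (b ^ i <= k < b.+1 ^ i)%N.
Proof.
move=> i0; elim: k => [|k [b /andP[h1 h2]]].
  by exists 0%N; rewrite exp0n // exp1n.
have [lt|ge] := ltnP k.+1 (b.+1 ^ i); first by exists b; rewrite lt ltnW.
exists b.+1; have -> : k.+1 = (b.+1 ^ i)%N by apply/eqP; rewrite eqn_leq ge h2.
by rewrite leqnn ltn_exp2r ?ltnS /=.
Qed.

(** * The upper bound for large n *)

Section Bounds.
Variable R : realType.
Implicit Types (gamma c delta : R).

Lemma ln_le_sub1 (x : R) : 0 < x -> ln x <= x - 1.
Proof.
by move=> x0; have := @le_ln1Dx R (x - 1); rewrite [1 + _]addrC subrK; apply; rewrite ltrBrDr addNr.
Qed.

Lemma log_facts c alpha t delta n : 0 < c -> 0 < delta -> t = ln (n%:R : R) -> n%:R `^ (- alpha) <= delta ->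
  (0 < n)%N -> delta <= 1 - c -> c <= ln (1 / delta) <= alpha * t.
Proof.
move=> c0 d0 tE hd n0 dc; have n0R : (0 : R) < n%:R by rewrite ltr0n.
rewrite div1r lnV ?posrE //; apply/andP; split.
  by have := ln_le_sub1 d0; lra.
have : ln (n%:R `^ (- alpha)) <= ln delta by rewrite ler_ln ?posrE ?powR_gt0.
by rewrite ln_powR -tE; lra.
Qed.

(* 70 * 99 = 6 * 35 * 33; see [upper_sum], where ln (8 k) <= 33 ln (b + 1) is used. *)
Lemma root_log c b : 0 < c -> 2 * (70 * 99 * (70 * 99)) / (c * c) <= b%:R -> 70 * 99 * ln (b.+1%:R : R) <= c * b%:R.
Proof.
move=> c0 hb; set z := ln _.
have z0 : 0 <= z by apply: ln_ge0; rewrite ler1n.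
have hz : z * z <= 2 * b%:R.
  have := expR_ge1Dxn 1 z0; rewrite lnK ?posrE // -[X in _ <= X]natr1 => h.
  by move: h; rewrite (_ : 2`! = 2)%N // expr2; lra.
have cc : 0 < c * c by rewrite mulr_gt0.
rewrite ler_pdivrMr // in hb.
rewrite -ler_sqr ?nnegrE ?mulr_ge0 // ?(ltW c0) // ?exprMn.
have b0 : (0 : R) <= b%:R by [].
have : b%:R * (2 * (70 * 99 * (70 * 99))) <= b%:R * (b%:R * (c * c)) by rewrite ler_wpM2l.
by rewrite !expr2; lra.
Qed.

Lemma upper_bound gamma c : 0 < gamma <= 1 -> 0 < c <= 1 ->
  exists2 alpha : R, 0 < alpha & exists N : nat, forall n, (N <= n)%N ->
  forall delta, n%:R `^ (- alpha) <= delta -> delta <= 1 - c ->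
   ~ dense_contains_sumset delta n (Num.truncn ((3 + gamma) * ln n%:R / ln (1 / delta))).+1.
Proof.
move=> /andP[g0 g1] /andP[c0 c1].
have [B [B1 B2 B3]] : exists B : nat, [/\ (32 <= B)%N, 28 / gamma <= B%:R & 2 * (70 * 99 * (70 * 99)) / (c * c) <= B%:R].
  exists (32 + (Num.truncn (28 / gamma)).+1 + (Num.truncn (2 * (70 * 99 * (70 * 99)) / (c * c))).+1)%N.
  have h1 := truncnS_gt (28 / gamma); have h2 := truncnS_gt (2 * (70 * 99 * (70 * 99)) / (c * c)).
  split; first by rewrite -addnA leq_addr.
    by rewrite !natrD; apply: le_trans (ltW h1) _; rewrite -addrA addrCA lerDl addr_ge0.
  by rewrite !natrD; apply: le_trans (ltW h2) _; rewrite lerDr addr_ge0.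
have Bp : (0 : R) < (B ^ 30)%:R by rewrite ltr0n expn_gt0 (leq_trans _ B1).
(* 1 / 2 keeps delta n large, gamma / 48 keeps [lam] small against log n, and 3 / B^30 forces k >=
   B^30 and hence b >= B. *)
pose al : R := Num.min (1 / 2) (Num.min (gamma / 48) (3 / (B ^ 30)%:R)).
have al0 : 0 < al by rewrite !lt_min; apply/and3P; split; rewrite ?divr_gt0.
have al1 : al <= 1 / 2 by rewrite ge_min lexx.
have al2 : al <= gamma / 48 by rewrite !ge_min lexx orbT.
have al3 : al <= 3 / (B ^ 30)%:R by rewrite !ge_min lexx !orbT.
exists al => //; pose T0 := 1 + 64 / (c * gamma).
exists (Num.truncn (expR T0)).+1 => n hn delta hd dc.
have cg : 0 < c * gamma by rewrite mulr_gt0.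
have cg1 : c * gamma <= 1 by rewrite mulr_ile1 // ltW.
have h64 : 64 <= 64 / (c * gamma) by rewrite ler_pdivlMr // ler_piMr.
have nT : expR T0 <= n%:R.
  by apply: ltW; apply: lt_le_trans (truncnS_gt _) _; rewrite ler_nat.
have n0 : (0 < n)%N by apply: leq_trans hn.
have n0R : (0 : R) < n%:R by rewrite ltr0n.
set t := ln n%:R.
have tT : T0 <= t by rewrite -(expRK T0) ler_ln ?posrE ?expR_gt0.
have t1 : 1 <= t by apply: le_trans tT; rewrite /T0; lra.
have d0 : 0 < delta by apply: lt_le_trans hd; apply: powR_gt0.
have /andP[l1 l2] := log_facts c0 d0 erefl hd n0 dc; rewrite -/t in l2.
set l0 := ln (1 / delta) in l1 l2 *.
have l0p : 0 < l0 by apply: lt_le_trans l1.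
have l0E : ln delta = - l0 by rewrite /l0 div1r lnV ?posrE // opprK.
set K := (3 + gamma) * t / l0; set k := (Num.truncn K).+1.
have K0 : 0 <= K by rewrite !mulr_ge0 ?invr_ge0 ?(ltW l0p) //; clear -g0 t1; lra.
have k1 : K < k%:R := truncnS_gt K.
have k2 : k%:R <= K + 1 by rewrite -natr1 lerD2r truncn_le.
have Kl : K * l0 = (3 + gamma) * t by rewrite /K divfK // gt_eqF.
(* Rounding up makes a set of size m dense enough; the price is that [lam] falls below log (1 /
   delta) by at most c gamma / 16. *)
pose m := (Num.truncn (delta * n%:R)).+1.
have dn0 : 0 < delta * n%:R by rewrite mulr_gt0.
have m1 : delta * n%:R < m%:R := truncnS_gt _.
have m2 : m%:R <= delta * n%:R + 1 by rewrite -natr1 lerD2r truncn_le ltW.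
have nt : t + 1 <= n%:R by rewrite -[leRHS]lnK ?posrE // addrC; exact: expR_ge1Dx.
have cn : 1 <= c * n%:R.
  have h : c * (64 / (c * gamma)) <= c * n%:R by rewrite ler_wpM2l ?ltW //; rewrite /T0 in tT; lra.
  apply: le_trans h; have -> : c * (64 / (c * gamma)) = 64 / gamma.
    by field; rewrite !gt_eqF.
  by rewrite ler_pdivlMr //; lra.
have mn : (m <= n)%N.
  rewrite -(ler_nat R); apply: le_trans m2 _.
  have : delta * n%:R <= (1 - c) * n%:R by rewrite ler_wpM2r.
  by lra.
have dn : 16 / (c * gamma) <= delta * n%:R.
  have -> : delta * n%:R = expR (- l0 + t) by rewrite expRD -l0E !lnK.
  have h : al * t <= 1 / 2 * t by rewrite ler_wpM2r //; clear -t1; lra.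
  apply: le_trans (_ : 1 + (- l0 + t) <= _); last exact: expR_ge1Dx.
  have e : 64 / (c * gamma) = 4 * (16 / (c * gamma)) by rewrite mulrA; congr (_ / _); clear; lra.
  by move: tT h h64; rewrite /T0 e; clear -l2 t1; lra.
have x0 : (0 : R) < m%:R / n%:R by rewrite divr_gt0 ?ltr0n.
have dx : delta <= m%:R / n%:R by rewrite ler_pdivlMr // ltW.
pose lam := - ln (m%:R / n%:R : R).
have lam1 : lam <= l0 by rewrite /lam lerNl -l0E ler_ln ?posrE.
have lam2 : l0 - c * gamma / 16 <= lam.
  have hx : m%:R / n%:R <= delta * (1 + (delta * n%:R)^-1).
    rewrite ler_pdivrMr //; apply: le_trans m2 _.
    rewrite mulrDr mulr1 mulrDl; apply: lerD => //.
    by rewrite invfM mulrA divff ?gt_eqF // mul1r mulVf ?gt_eqF.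
  have p1 : 0 < 1 + (delta * n%:R)^-1 by rewrite ltr_wpDr ?invr_ge0 ?(ltW dn0).
  have : ln (m%:R / n%:R) <= ln (delta * (1 + (delta * n%:R)^-1)).
    by rewrite ler_ln ?posrE // mulr_gt0.
  rewrite lnM ?posrE // l0E.
  have h : ln (1 + (delta * n%:R)^-1) <= (delta * n%:R)^-1.
    by apply: le_ln1Dx; apply: lt_le_trans (_ : 0 <= _); rewrite ?invr_ge0 ?(ltW dn0) // oppr_lt0.
  have h' : (delta * n%:R)^-1 <= c * gamma / 16.
    by rewrite -[leRHS]invrK invf_div lef_pV2 ?posrE ?divr_gt0.
  by rewrite /lam; move: h h'; clear; lra.
have lam3 : l0 * (1 - gamma / 16) <= lam.
  have : c * gamma <= l0 * gamma by rewrite ler_wpM2r // ltW.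
  by lra.
have [b /andP[b1 b2]] := @root_ex 30 k isT.
have Bk : (B ^ 30 <= k)%N.
  rewrite -(ler_nat R); apply: le_trans (ltW k1).
  rewrite /K ler_pdivlMr //.
  have : (B ^ 30)%:R * l0 <= (B ^ 30)%:R * (al * t) by rewrite ler_wpM2l.
  have : (B ^ 30)%:R * al <= 3 by rewrite mulrC -ler_pdivlMr.
  move=> h1 h2; apply: le_trans h2 _; rewrite mulrA; apply: (@le_trans _ _ (3 * t)).
    by rewrite ler_wpM2r //; clear -t1; lra.
  by rewrite ler_wpM2r //; clear -t1 g0; lra.
have Bb : (B <= b)%N by rewrite -ltnS -(@ltn_exp2r _ _ 30) //; apply: leq_ltn_trans b2.
have BbR : (B%:R : R) <= b%:R by rewrite ler_nat.
have hz := root_log c0 (le_trans B3 BbR).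
have b32 : (32 <= b)%N by apply: leq_trans Bb.
have bR : (32 : R) <= b%:R by rewrite ler_nat.
have z0 : (0 : R) < b.+1%:R by [].
(* k b <= (b + 1)^31 < exp(b / 2) <= 2^b. *)
have hl : (k * b < 2 ^ b)%N.
  have h1 : (k * b <= b.+1 ^ 31)%N.
    by rewrite (expnSr _ 30) leq_mul // ltnW.
  rewrite -(ltr_nat R); apply: (@le_lt_trans _ _ (b.+1 ^ 31)%:R); first by rewrite ler_nat.
  rewrite !natrX -[X in X ^+ 31](lnK z0) -expRM_natl.
  apply: (@lt_le_trans _ _ (expR (b%:R * (1 / 2)))).
    rewrite ltr_expR; move: hz; set z := ln _ => hz; clear -hz bR c0 c1.
    have : c * b%:R <= 1 * b%:R by rewrite ler_wpM2r.
    lra.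
  rewrite expRM_natl lerXn2r ?nnegrE ?expR_ge0 //.
  have h : 1 / 2 <= expR (- (1 / 2)) :> R by apply: le_trans (expR_ge1Dx _); clear; lra.
  by rewrite -[leLHS]invrK -expRN invf_ple ?posrE ?expR_gt0 // -[leLHS]div1r.
have hW : 35 * ln (8 * k)%:R <= c / 6 * b%:R.
  have h1 : (8 * k <= b.+1 ^ 33)%N.
    rewrite (_ : 33 = 3 + 30)%N // expnD leq_mul ?(ltnW b2) //.
    have b2' : (2 <= b.+1)%N by apply: leqW; apply: leq_trans b32.
    by rewrite -[8%N]/(2 ^ 3)%N leq_exp2r.
  have h2 : ln (8 * k)%:R <= 33 * ln b.+1%:R :> R.
    apply: (@le_trans _ _ (ln (b.+1 ^ 33)%:R)).
      by rewrite ler_ln ?posrE ?ltr0n ?muln_gt0 ?expn_gt0 // ler_nat.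
    by rewrite natrX lnXn // mulr_natl.
  move: h2 hz; set z := ln b.+1%:R; set y := ln (8 * k)%:R; clear; lra.
have hF1 : (3 + gamma / 2) * t <= k%:R * lam.
  have h1 : 0 <= 1 - gamma / 16 by clear -g1; lra.
  have h2 : (3 + gamma) * t * (1 - gamma / 16) <= k%:R * (l0 * (1 - gamma / 16)).
    by rewrite mulrA ler_wpM2r // -Kl ler_wpM2r // ltW.
  have h3 : k%:R * (l0 * (1 - gamma / 16)) <= k%:R * lam by rewrite ler_wpM2l.
  apply: le_trans (le_trans h2 h3); rewrite [leRHS]mulrAC ler_wpM2r //.
    by clear -t1; lra.
  have : gamma * gamma <= 1 * gamma by rewrite ler_wpM2r // ltW.
  by clear -g0; lra.
have hF2 : c / 2 <= lam.
  have h : c * gamma <= c * 1 by rewrite ler_wpM2l // ltW.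
  by clear -h l1 lam2 c0; lra.
have hF3 : lam <= gamma / 48 * t.
  apply: le_trans lam1 (le_trans l2 _); rewrite ler_wpM2r //; clear -t1; lra.
have hF4 : k%:R <= 5 * t / c.
  apply: le_trans k2 _; have h1 : K <= (3 + gamma) * t / c.
    by rewrite ler_pM2l ?lef_pV2 ?posrE // mulr_gt0 //; clear -g0 t1; lra.
  have h2 : 1 <= t / c by rewrite ler_pdivlMr // mul1r; clear -c1 t1; lra.
  have h3 : gamma * (t / c) <= 1 * (t / c) by rewrite ler_wpM2r // divr_ge0 ?ltW //; clear -t1; lra.
  move: h1 h2 h3; rewrite -!mulrA; move: (t / c) => u; clear; lra.
have gb : 28 / gamma <= b%:R by apply: le_trans B2 BbR.
have [|T [sT cT hT]] := @upper_comb R n m k b b32 b1 hl mn n0.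
  by apply: (@upper_sum R gamma c t lam n m k b) => //; rewrite ?g0 ?c0.
move=> /(_ T sT); rewrite cT => /(_ (ltW m1)) [A [B0 [sA sB sAB]]].
by rewrite leq_min => /andP[kA kB]; apply: (hT A B0).
Qed.
End Bounds.

(** * The lower bound for large n *)

Section Lower.
Variable R : realType.
Implicit Types (gamma c delta : R).

Lemma bernoulli (x : R) k : 0 <= x <= 1 -> 1 - k%:R * x <= (1 - x) ^+ k.
Proof.
move=> /andP[x0 x1]; elim: k => [|k IH]; first by rewrite mul0r subr0 expr0.
rewrite exprS; apply: le_trans (_ : (1 - x) * (1 - k%:R * x) <= _); last first.
  by rewrite ler_wpM2l // subr_ge0.
have : 0 <= k%:R * (x * x) :> R by rewrite !mulr_ge0.
by rewrite -natr1; lra.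
Qed.

(** The window l, about 8 k^2 / delta, is so long that lowering the degrees from delta l by k and by
    a proportion 1 / (4 k) leaves at least (1 - 1 / (2 k)) delta l; the k-th power then loses only a
    factor 2. *)
Lemma dense_kst delta n k : 0 < delta <= 1 -> (0 < k)%N ->
  72 * (k%:R * k%:R * k%:R) <= delta * delta * n%:R ->
  16 * (k%:R * k%:R) <= delta ^+ k.+1 * n%:R ->
  dense_contains_sumset delta n k.
Proof.
move=> /andP[d0 d1] k0 h1 h2 S sS hS.
have k1 : (1 : R) <= k%:R by rewrite ler1n.
have kp : (0 : R) < k%:R by rewrite ltr0n.
have kk : k%:R <= k%:R * k%:R :> R by rewrite ler_peMl.
pose l := (Num.truncn (8 * (k%:R * k%:R) / delta)).+1.
have l1 : 8 * (k%:R * k%:R) / delta < l%:R := truncnS_gt _.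
have l2 : l%:R <= 8 * (k%:R * k%:R) / delta + 1.
  by rewrite -[leLHS]natr1 lerD2r truncn_le !mulr_ge0 // invr_ge0 ltW.
have l0 : (0 : R) < l%:R by rewrite ltr0n.
have l1' : 8 * (k%:R * k%:R) < delta * l%:R by rewrite [ltRHS]mulrC -ltr_pdivrMr.
have l2' : delta * l%:R <= 9 * (k%:R * k%:R).
  apply: le_trans (_ : delta * (8 * (k%:R * k%:R) / delta + 1) <= _); first by rewrite ler_wpM2l // ltW.
  rewrite mulrDr [delta * (_ / _)]mulrC divfK ?gt_eqF // mulr1; clear -d1 k1 kk; lra.
have l3 : 8 * k%:R * l%:R <= delta * n%:R.
  rewrite -(ler_pM2l d0).
  have : k%:R * (delta * l%:R) <= k%:R * (9 * (k%:R * k%:R)) by rewrite ler_wpM2l.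
  by move: h1; clear; lra.
have d1n : delta * n%:R <= n%:R by rewrite ler_piMl.
have lk : l%:R <= k%:R * l%:R :> R by rewrite ler_peMl.
have ln' : (l <= n)%N by rewrite -(ler_nat R); move: l3 d1n lk l0; clear; lra.
pose D := (1 - (4 * k%:R)^-1) * (delta * l%:R) : R.
have k4 : (4 * k%:R)^-1 <= 1 / 4 :> R by rewrite div1r lef_pV2 ?posrE ?mulr_gt0 //; clear -k1; lra.
have k4p : 0 <= (4 * k%:R)^-1 :> R by rewrite invr_ge0 mulr_ge0.
have dl0 : 0 < delta * l%:R by rewrite mulr_gt0.
have D0 : 3 / 4 * (delta * l%:R) <= D by rewrite /D ler_wpM2r ?(ltW dl0) //; clear -k4; lra.
pose d := Num.truncn D.
have D0' : 0 <= D by clear -D0 dl0; lra.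
have dD : d%:R <= D by rewrite truncn_le.
have Dd : D < d%:R + 1 by rewrite natr1 truncnS_gt.
have kd : (k < d)%N.
  by rewrite -(ltr_nat R); move: Dd D0 l1' kk k1; clear; lra.
have ls : (l <= #|` S|)%N.
  rewrite -(ler_nat R); apply: le_trans hS; move: l3 lk l0; clear; lra.
have quart : delta * l%:R * (4 * k%:R)^-1 * (4 * k%:R) = delta * l%:R.
  by rewrite mulfVK // mulf_neq0 ?gt_eqF.
(* With threshold (1 - 1 / (4 k)) delta l the degree sum has a surplus 2 E; one E absorbs the
   boundary loss l^2. *)
pose E := delta * l%:R * n%:R / (8 * k%:R) : R.
have hE : E * (8 * k%:R) = delta * l%:R * n%:R by rewrite /E mulfVK // mulf_neq0 ?gt_eqF.
have hgap : E <= l%:R * (#|` S|%:R - l%:R) - n%:R * d%:R.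
  have e1 : l%:R * (delta * n%:R - l%:R) <= l%:R * (#|` S|%:R - l%:R) by rewrite ler_wpM2l // lerD2r.
  have e2 : n%:R * d%:R <= n%:R * D by rewrite ler_wpM2l.
  have e3 : n%:R * D = delta * l%:R * n%:R - 2 * E.
    rewrite /D /E; field; by rewrite gt_eqF.
  have e4 : l%:R * l%:R <= E.
    have : l%:R * (8 * k%:R * l%:R) <= l%:R * (delta * n%:R) by rewrite ler_wpM2l.
    by rewrite /E ler_pdivlMr ?mulr_gt0 //; clear; lra.
  by move: e1 e2 e3 e4; clear; lra.
have n0 : (0 : R) < n%:R by rewrite ltr0n (leq_trans _ ln').
have E0 : 0 < E by rewrite /E divr_gt0 ?mulr_gt0.
have hd : (n * d < l * (#|` S| - l))%N.
  by rewrite -(ltr_nat R) !natrM natrB // -subr_gt0; apply: lt_le_trans hgap.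
have [A [B [sA sB sAB cB hAB]]] := kst_sumset sS ln' kd hd.
exists A, B; split => //; rewrite leq_min cB leqnn andbT -(ler_nat R).
move: hAB; rewrite -(ler_nat R) !natrM !natrX natrB; last exact: ltnW.
rewrite natrB; last exact: ltnW.
rewrite !natrM (natrB _ ls) => hAB.
pose w := delta * l%:R * (4 * k%:R)^-1.
have w2 : 2 * k%:R <= w by rewrite /w ler_pdivlMr ?mulr_gt0 //; move: l1'; clear; lra.
pose th := (1 - (2 * k%:R)^-1) * delta.
have k2 : (2 * k%:R)^-1 = 2 * (4 * k%:R)^-1 :> R by field; rewrite gt_eqF.
have k2' : (2 * k%:R)^-1 <= 1 / 2 :> R by rewrite k2; move: k4; clear; lra.
have k2p : 0 <= (2 * k%:R)^-1 :> R by rewrite invr_ge0 mulr_ge0.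
have th0 : 0 <= th by rewrite /th mulr_ge0 ?(ltW d0) //; move: k2'; clear; lra.
have hth : th * l%:R <= d%:R - k%:R.
  have -> : th * l%:R = delta * l%:R - 2 * w by rewrite /th k2 /w; ring.
  have DE : D = delta * l%:R - w by rewrite /D /w; ring.
  by move: Dd w2 k1; rewrite DE; clear; lra.
have h3 : (th * l%:R) ^+ k * E <= l%:R ^+ k * (l%:R * #|` A|%:R).
  have tl : 0 <= th * l%:R by rewrite mulr_ge0.
  have h : (th * l%:R) ^+ k <= (d%:R - k%:R) ^+ k.
    by apply: lerXn2r; rewrite ?nnegrE //; apply: le_trans hth.
  apply: le_trans hAB; apply: ler_pM => //; first exact: exprn_ge0.
  exact: ltW.
have h4 : th ^+ k * E <= l%:R * #|` A|%:R.
  have lkp : (0 : R) < l%:R ^+ k by rewrite exprn_gt0.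
  by move: h3; rewrite exprMn [_ ^+ k * l%:R ^+ k]mulrC -mulrA ler_pM2l.
have h5 : th ^+ k * (delta * n%:R) <= #|` A|%:R * (8 * k%:R).
  have : th ^+ k * E * (8 * k%:R) <= l%:R * #|` A|%:R * (8 * k%:R) by rewrite ler_wpM2r // mulr_ge0.
  rewrite -[_ * E * _]mulrA hE (_ : delta * l%:R * n%:R = l%:R * (delta * n%:R)); last by ring.
  by rewrite mulrCA -[leRHS]mulrA ler_pM2l.
have h6 : 1 / 2 * delta ^+ k <= th ^+ k.
  rewrite /th exprMn ler_wpM2r ?exprn_ge0 ?(ltW d0) //.
  have hb01 : 0 <= ((2 * k%:R)^-1 : R) <= 1 by rewrite k2p /=; move: k2'; clear; lra.
  apply: le_trans (bernoulli k hb01).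
  have -> : k%:R * (2 * k%:R)^-1 = 1 / 2 :> R by field; rewrite gt_eqF.
  by clear; lra.
have h7 : 1 / 2 * delta ^+ k * (delta * n%:R) <= #|` A|%:R * (8 * k%:R).
  by apply: le_trans h5; rewrite ler_wpM2r // mulr_ge0 ?ltW.
rewrite -(ler_pM2r kp); move: h2 h7; rewrite exprS; clear; lra.
Qed.

Lemma lower_bound gamma c : 0 < gamma <= 1 -> 0 < c <= 1 ->
  exists2 alpha : R, 0 < alpha & exists N : nat, forall n, (N <= n)%N ->
  forall delta, n%:R `^ (- alpha) <= delta -> delta <= 1 - c ->
   dense_contains_sumset delta n (Num.truncn ((1 - gamma) * ln n%:R / ln (1 / delta))).+1.
Proof.
(* delta^(k + 1) n is at least exp(gamma t - 2 log (1 / delta)), t = log n: the 2 comes from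
   rounding k up and from the exponent k + 1. With log (1 / delta) <= gamma t / 8 this exceeds
   exp(gamma t / 2). *)
move=> /andP[g0 g1] /andP[c0 c1]; pose al := gamma / 8.
have al0 : 0 < al by rewrite divr_gt0.
exists al => //; pose T1 := 64 * 48 / (gamma ^+ 3 * c ^+ 2) : R.
(* T1 makes (gamma t / 2)^3 / 6 exceed 16 k^2, and T2 makes (t / 2)^4 / 24 exceed 72 k^3, both by k
   <= 2 t / c. *)
pose T2 := 60 * 60 * 80 / c ^+ 3 : R; pose T0 := 1 + T1 + T2.
have g3 : 0 < gamma ^+ 3 * c ^+ 2 by rewrite mulr_gt0 ?exprn_gt0.
have c3 : 0 < c ^+ 3 by rewrite exprn_gt0.
have T1p : 0 < T1 by rewrite divr_gt0 // mulr_gt0.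
have T2p : 0 < T2 by rewrite divr_gt0 // !mulr_gt0.
exists (Num.truncn (expR T0)).+1 => n hn delta hd dc.
have nT : expR T0 <= n%:R.
  by apply: ltW; apply: lt_le_trans (truncnS_gt _) _; rewrite ler_nat.
have n0 : (0 < n)%N by apply: leq_trans hn.
have n0R : (0 : R) < n%:R by rewrite ltr0n.
set t := ln n%:R.
have tT : T0 <= t by rewrite -(expRK T0) ler_ln ?posrE ?expR_gt0.
have t1 : 1 <= t by apply: le_trans tT; rewrite /T0; move: T1p T2p; clear; lra.
have tT1 : T1 <= t by apply: le_trans tT; rewrite /T0; move: T1p T2p; clear; lra.
have tT2 : T2 <= t by apply: le_trans tT; rewrite /T0; move: T1p T2p; clear; lra.
have t0 : 0 < t by apply: lt_le_trans t1.
have d0 : 0 < delta by apply: lt_le_trans hd; apply: powR_gt0.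
have d1 : delta <= 1 by move: dc c0; clear; lra.
have /andP[l1 l2] := log_facts c0 d0 erefl hd n0 dc; rewrite -/t in l2.
set l0 := ln (1 / delta) in l1 l2 *.
have l0p : 0 < l0 by apply: lt_le_trans l1.
have dE : delta = expR (- l0) by rewrite /l0 div1r lnV ?posrE // opprK lnK.
set K := (1 - gamma) * t / l0; set k := (Num.truncn K).+1.
have K0 : 0 <= K.
  by rewrite mulr_ge0 ?invr_ge0 ?(ltW l0p) // mulr_ge0 ?subr_ge0 // ltW.
have k2 : k%:R <= K + 1 by rewrite -[leLHS]natr1 lerD2r truncn_le.
have Kl : K * l0 = (1 - gamma) * t by rewrite /K divfK // gt_eqF.
have kt : k%:R <= 2 * t / c.
  apply: le_trans k2 _; have h1 : K <= t / c.
    rewrite /K ler_pM ?invr_ge0 ?(ltW l0p) ?mulr_ge0 ?subr_ge0 ?(ltW t0) //.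
      by rewrite ler_piMl ?(ltW t0) //; move: g0; clear; lra.
    by rewrite lef_pV2 ?posrE.
  have h2 : 1 <= t / c by rewrite ler_pdivlMr // mul1r; move: c1 t1; clear; lra.
  by move: h1 h2; rewrite -mulrA; move: (t / c); clear => u; lra.
have kp : (0 : R) <= k%:R by [].
have c2k : c * k%:R <= 2 * t by move: kt; rewrite ler_pdivlMr // mulrC.
have ck0 : 0 <= c * k%:R by rewrite mulr_ge0 // ltW.
have nE : n%:R = expR t by rewrite lnK.
have alt : al * t <= t / 8 by rewrite /al mulrAC ler_wpM2r // ler_piMl // ltW.
apply: dense_kst => //; first by rewrite d0.
- have -> : delta * delta * n%:R = expR (- l0 + - l0 + t) by rewrite dE nE -!expRD.
  apply: le_trans (_ : expR (t / 2) <= _); last first.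
    by rewrite ler_expR; move: l2 alt t0; clear; lra.
  have th : 0 <= t / 2 by rewrite divr_ge0 // ltW.
  have h4 := expR_ge1Dxn 3 th; apply: le_trans h4.
  have h3 : (c * k%:R) ^+ 3 <= (2 * t) ^+ 3 by rewrite lerXn2r ?nnegrE ?mulr_ge0 // ltW.
  rewrite -(ler_pM2l c3).
  have h5 : 60 * 60 * 80 <= t * c ^+ 3 by move: tT2; rewrite /T2 ler_pdivrMr.
  have h6 : t ^+ 3 * (60 * 60 * 80) <= t ^+ 3 * (t * c ^+ 3) by rewrite ler_wpM2l // exprn_ge0 ?ltW.
  have t3 : 0 <= t ^+ 3 by rewrite exprn_ge0 ?ltW.
  have -> : (3.+1)`! = 24%N by [].
  have -> : c ^+ 3 * (72 * (k%:R * k%:R * k%:R)) = 72 * (c * k%:R) ^+ 3 by ring.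
  have -> : c ^+ 3 * (1 + (t / 2) ^+ 4 / 24) = c ^+ 3 + t ^+ 3 * (t * c ^+ 3) / 384 by field.
  have h3' : (c * k%:R) ^+ 3 <= 8 * t ^+ 3 by apply: le_trans h3 _; rewrite le_eqVlt; apply/orP; left; apply/eqP; ring.
  move: (ltW c3) h3' h6 t3; move: (t ^+ 3) ((c * k%:R) ^+ 3) (c ^+ 3) => X Y Z.
  by move: (X * (t * Z)); clear => u; lra.
- have -> : delta ^+ k.+1 * n%:R = expR (- l0 * k.+1%:R + t) by rewrite {1}dE nE -expRM_natr -expRD.
  apply: le_trans (_ : expR (gamma * t / 2) <= _); last first.
    rewrite ler_expR -[k.+1%:R]natr1.
    have : k%:R * l0 <= (K + 1) * l0 by rewrite ler_wpM2r // ltW.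
    have gt0 : 0 <= gamma * t by rewrite mulr_ge0 // ltW.
    by move: l2 gt0; rewrite mulrDl Kl /al; clear; lra.
  have th : 0 <= gamma * t / 2 by rewrite divr_ge0 // mulr_ge0 // ltW.
  apply: le_trans (expR_ge1Dxn 2 th).
  have h2 : (c * k%:R) ^+ 2 <= (2 * t) ^+ 2 by rewrite lerXn2r ?nnegrE ?mulr_ge0 // ltW.
  have c2 : 0 < c ^+ 2 by rewrite exprn_gt0.
  rewrite -(ler_pM2l c2).
  have h5 : 64 * 48 <= t * (gamma ^+ 3 * c ^+ 2) by move: tT1; rewrite /T1 ler_pdivrMr.
  have h6 : t ^+ 2 * (64 * 48) <= t ^+ 2 * (t * (gamma ^+ 3 * c ^+ 2)) by rewrite ler_wpM2l // exprn_ge0 ?ltW.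
  have -> : (2.+1)`! = 6%N by [].
  have -> : c ^+ 2 * (16 * (k%:R * k%:R)) = 16 * (c * k%:R) ^+ 2 by ring.
  have -> : c ^+ 2 * (1 + (gamma * t / 2) ^+ 3 / 6) = c ^+ 2 + t ^+ 2 * (t * (gamma ^+ 3 * c ^+ 2)) / 48 by field.
  have h2' : (c * k%:R) ^+ 2 <= 4 * t ^+ 2 by apply: le_trans h2 _; rewrite le_eqVlt; apply/orP; left; apply/eqP; ring.
  move: (ltW c2) h2' h6; move: (t ^+ 2 * (t * _)) => u.
  by move: (t ^+ 2) ((c * k%:R) ^+ 2) (c ^+ 2); clear => X Y Z; lra.
Qed.
End Lower.

Theorem corollary1p2 (R : realType) (gamma c : R) :
  0 < gamma -> gamma <= 1 -> 0 < c ->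
  exists2 alpha : R, 0 < alpha &
    exists N : nat, forall n : nat, (N <= n)%N ->
      forall delta : R, n%:R `^ (- alpha) <= delta -> delta <= 1 - c ->
        (1 - gamma) / ln (1 / delta) <= (phi delta n)%:R / ln (n%:R : R) /\
        (phi delta n)%:R / ln (n%:R : R) <= (3 + gamma) / ln (1 / delta).
Proof.
(* Lowering c to at most 1 only enlarges the range of delta. *)
move=> g0 g1 c0; pose c' := Num.min c 1.
have c'0 : 0 < c' by rewrite lt_min c0 ltr01.
have hc' : 0 < c' <= 1 by rewrite c'0 ge_min lexx orbT.
have hg : 0 < gamma <= 1 by rewrite g0.
have [a1 a1p [N1 lower]] := lower_bound hg hc'.
have [a2 a2p [N2 upper]] := upper_bound hg hc'.
exists (Num.min a1 a2); first by rewrite lt_min a1p.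
exists (N1 + N2 + 2)%N => n hn delta hd dc.
have n1 : (1 < n)%N by move: hn; clear; lia.
have n0 : (0 < n)%N by exact: ltnW.
have dc' : delta <= 1 - c' by apply: le_trans dc _; rewrite lerD2l lerN2 ge_min lexx.
have expo a : Num.min a1 a2 <= a -> n%:R `^ (- a) <= delta.
  by move=> ha; apply: le_trans hd; apply: ler_powR; rewrite ?ler1n // lerN2.
have d0 : 0 < delta by apply: lt_le_trans hd; apply: powR_gt0; rewrite ltr0n.
have t0 : 0 < ln (n%:R : R) by rewrite ln_gt0 // ltr1n.
have /andP[l1 _] := log_facts c'0 d0 erefl hd n0 dc'.
have l0 : 0 < ln (1 / delta) by apply: lt_le_trans l1.
have d1 : delta <= 1 by apply: le_trans dc' _; rewrite gerBl ltW.
have [dense maxi] := phiP n d1.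
split.
  have N1n : (N1 <= n)%N by move: hn; clear; lia.
  (* The [.+1] on the truncation makes k exceed the real bound, so maximality of [phi] gives the
     inequality. *)
  have /(lower n N1n delta)/(_ dc')/maxi : n%:R `^ (- a1) <= delta by apply: expo; rewrite ge_min lexx.
  rewrite -(ler_nat R) ler_pdivlMr // mulrAC; apply: le_trans.
  exact: ltW (truncnS_gt _).
rewrite ler_pdivrMr // mulrAC leNgt; apply/negP => gt.
apply: (upper n _ delta _ dc').
- by move: hn; clear; lia.
- by apply: expo; rewrite ge_min lexx orbT.
(* A [phi] above the real bound is at least the truncation plus 1, so the sets it provides
   contradict [upper]. *)
move=> S sS hS; have [A [B [sA sB sAB hAB]]] := dense S sS hS.
exists A, B; split => //; apply: leq_trans hAB; rewrite ltnNge; apply/negP => le.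
move: gt; rewrite ltNge => /negP; apply.
apply: le_trans (_ : (Num.truncn ((3 + gamma) * ln n%:R / ln (1 / delta)))%:R <= _).
  by rewrite ler_nat.
by rewrite truncn_le; rewrite !mulr_ge0 ?invr_ge0 ?ltW // addr_gt0.
Qed.
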